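(* Let $m,n\ge1$, let $0<\mu_1<\dots<\mu_m$ and $0<\lambda_1\le\dots\le\lambda_n$ be real constants, $\Lambda^+=\mathrm{diag}(\lambda_1,\dots,\lambda_n)$, $\Lambda^-=\mathrm{diag}(\mu_1,\dots,\mu_m)$, and let $\Sigma^{++}\in\mathbb{R}^{n\times n}$, $\Sigma^{+-}\in\mathbb{R}^{n\times m}$, $\Sigma^{-+}\in\mathbb{R}^{m\times n}$, $\Sigma^{--}\in\mathbb{R}^{m\times m}$, $Q_0\in\mathbb{R}^{n\times m}$, $R_1\in\mathbb{R}^{m\times n}$ be constant matrices. Consider, for $t\ge0$ and $x\in[0,1]$, the system with states $u(t,x)\in\mathbb{R}^n$, $v(t,x)\in\mathbb{R}^m$ $$u_t+\Lambda^+u_x=\Sigma^{++}u+\Sigma^{+-}v,\qquad v_t-\Lambda^-v_x=\Sigma^{-+}u+\Sigma^{--}v,$$ with boundary conditions $$u(t,0)=Q_0v(t,0),\qquad v(t,1)=R_1u(t,1)+U(t),$$ and the feedback control law $$U(t)=-R_1u(t,1)+\int_0^1\big[K(1,\xi)u(t,\xi)+L(1,\xi)v(t,\xi)\big]\,d\xi,$$ where $K,L$ are the backstepping kernels defined in the context. Then the closed-loop system reaches its zero equilibrium in finite time $t_F$, where $$t_F=\frac1{\mu_1}+\frac1{\lambda_1},$$ i.e. for every initial condition $(u^0,v^0)\in L^2([0,1])$ the solution satisfies $u(t,\cdot)=0$ and $v(t,\cdot)=0$ for all $t\ge t_F$. Moreover, the zero equilibrium of the closed-loop system is exponentially stable in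 the $L^2$ sense.
   Context: Exponential stability in the $L^2$ sense: there are constants $C,\nu>0$ such that $\|(u,v)(t,\cdot)\|_{L^2}\le Ce^{-\nu t}\|(u^0,v^0)\|_{L^2}$ for all $t\ge0$ and all initial data in $L^2([0,1])$. Solutions of the PDE system are understood in the usual weak (characteristics) sense. Kernels. Write $\Sigma^{++}=(\sigma^{++}_{ij})$ etc., $Q_0=(q_{ij})$, and let $\mathcal{T}=\{(x,\xi)\in[0,1]^2:\xi\le x\}$. $K=(K_{ij})_{1\le i\le m,1\le j\le n}$ and $L=(L_{ij})_{1\le i,j\le m}$ are the unique solution in $L^\infty(\mathcal{T})$ (in the sense of integration along characteristic lines) of the following system. For $1\le i\le m$, $1\le j\le n$: $$\mu_i\partial_xK_{ij}-\lambda_j\partial_\xi K_{ij}=\sum_{k=1}^n\sigma^{++}_{kj}K_{ik}+\sum_{p=1}^m\sigma^{-+}_{pj}L_{ip}-\sum_{i\le p\le m}K_{pj}(x,\xi)\omega_{ip}(x);$$ for $1\le i,j\le m$: $$\mu_i\partial_xL_{ij}+\mu_j\partial_\xi L_{ij}=\sum_{k=1}^m\sigma^{--}_{kj}L_{ik}+\sum_{p=1}^n\sigma^{+-}_{pj}K_{ip}-\sum_{i\le p\le m}L_{pj}(x,\xi)\omega_{ip}(x);$$ with $K_{ij}(x,x)=-\sigma^{-+}_{ij}/(\mu_i+\lambda_j)$ for all $i,j$; $L_{ij}(x,x)=-\sigma^{--}_{ij}/(\mu_i-\mu_j)$ for $j<i$; $\mu_jL_{ij}(x,0)=\sum_{k=1}^n\lambda_kK_{ik}(x,0)q_{kj}$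 for all $1\le i,j\le m$; and $\omega_{ij}(x)=(\mu_i-\mu_j)L_{ij}(x,x)+\sigma^{--}_{ij}$ for $i\le j$. In the integrated sense, the characteristic line of $K_{ij}$ through $(x,\xi)$, in direction $(-\mu_i,\lambda_j)$, is followed to the diagonal $x=\xi$. That of $L_{ij}$, in direction $(-\mu_i,-\mu_j)$, is followed to the diagonal if $j<i$ and $\mu_i\xi-\mu_jx\ge0$, and to the side $\xi=0$ otherwise. The value of the kernel at $(x,\xi)$ is the boundary value at the terminal point plus the integral of the right-hand side along the line. The existence and uniqueness of such $K,L$ may be taken as given. *)

(* Defs.v *)
From HB Require Import structures.
From mathcomp Require Import all_boot all_order all_algebra.
From mathcomp Require Import all_classical all_reals all_analysis.

Set Implicit Arguments.
Unset Strict Implicit.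
Unset Printing Implicit Defensive.

Import Order.TTheory GRing.Theory Num.Theory.
Import numFieldNormedType.Exports.

Local Open Scope classical_set_scope.
Local Open Scope ring_scope.

(* The norm of L^2([0,1]; R^n x R^m) for the Euclidean norm on R^n x R^m.
   It is extended-real valued: it is +oo outside L^2. *)
Definition L2norm (R : realType) (n m : nat)
    (f : R -> 'cV[R]_n) (g : R -> 'cV[R]_m) : \bar R :=
  'N[@lebesgue_measure R]_(2%:E)[
    (fun x => (Num.sqrt (\sum_(i < n) f x i 0 ^+ 2
                         + \sum_(j < m) g x j 0 ^+ 2))%:E) \_ `[0, 1]].

(* Borel representatives of elements of L^2([0,1]; R^n x R^m). *)
Definition in_L2 (R : realType) (n m : nat)
    (f : R -> 'cV[R]_n) (g : R -> 'cV[R]_m) : Prop :=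
  [/\ forall i : 'I_n, measurable_fun (`[0, 1] : set R) (fun x => f x i 0),
      forall j : 'I_m, measurable_fun (`[0, 1] : set R) (fun x => g x j 0)
    & (L2norm f g < +oo)%E].

Section Hyperbolic.
Context (R : realType) (n m : nat).
Variables (lam : 'I_n -> R) (mu : 'I_m -> R).
Variables (Spp : 'M[R]_n) (Spm : 'M[R]_(n, m)).
Variables (Smp : 'M[R]_(m, n)) (Smm : 'M[R]_m).
Variables (Q0 : 'M[R]_(n, m)) (R1 : 'M[R]_(m, n)).

Local Notation leb := (@lebesgue_measure R).

Section Kernels.
Variables (K : R -> R -> 'M[R]_(m, n)) (L : R -> R -> 'M[R]_m).

Definition triangle : set (R * R) := [set z | 0 <= z.2 <= z.1 /\ z.1 <= 1].

(* Used for i <= j only. *)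
Definition omega (i j : 'I_m) (x : R) : R :=
  (mu i - mu j) * L x x i j + Smm i j.

Definition K_rhs (i : 'I_m) (j : 'I_n) (x xi : R) : R :=
  \sum_(k < n) Spp k j * K x xi i k + \sum_(p < m) Smp p j * L x xi i p
  - \sum_(p < m | (i <= p)%N) K x xi p j * omega i p x.

Definition L_rhs (i j : 'I_m) (x xi : R) : R :=
  \sum_(k < m) Smm k j * L x xi i k + \sum_(p < n) Spm p j * K x xi i p
  - \sum_(p < m | (i <= p)%N) L x xi p j * omega i p x.

(* Boundary value at the terminal point of the characteristic line through
   (x, xi), plus the integral along s |-> (x - mu i * s, xi + lam j * s); the
   diagonal is reached at s = (x - xi) / (mu i + lam j). *)
Definition K_char (i : 'I_m) (j : 'I_n) (x xi : R) : R :=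
  - Smp i j / (mu i + lam j)
  + \int[leb]_(s in `[0, (x - xi) / (mu i + lam j)])
      K_rhs i j (x - mu i * s) (xi + lam j * s).

(* The line is s |-> (x - mu i * s, xi - mu j * s); it reaches the diagonal at
   s = (x - xi) / (mu i - mu j), or the side xi = 0 at s = xi / mu j. *)
Definition L_char (i j : 'I_m) (x xi : R) : R :=
  if (j < i)%N && (0 <= mu i * xi - mu j * x) then
    - Smm i j / (mu i - mu j)
    + \int[leb]_(s in `[0, (x - xi) / (mu i - mu j)])
        L_rhs i j (x - mu i * s) (xi - mu j * s)
  else
    (mu j)^-1 * \sum_(k < n) lam k * K (x - mu i * (xi / mu j)) 0 i k * Q0 k j
    + \int[leb]_(s in `[0, xi / mu j])
        L_rhs i j (x - mu i * s) (xi - mu j * s).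

(* Bounded Borel functions satisfying the integrated equations at every point
   of the triangle. This fixes the representative of the class in L^oo, so that
   the traces L(x, x), K(x, 0), K(1, xi) and L(1, xi) are meaningful. *)
Definition backstepping_kernels : Prop :=
  [/\ forall i j, measurable_fun triangle (fun z : R * R => K z.1 z.2 i j),
      forall i j, measurable_fun triangle (fun z : R * R => L z.1 z.2 i j),
      exists M : R, forall x xi, triangle (x, xi) ->
        (forall i j, `|K x xi i j| <= M) /\ (forall i j, `|L x xi i j| <= M),
      forall x xi, triangle (x, xi) -> forall i j,
        K x xi i j = K_char i j x xi
    & forall x xi, triangle (x, xi) -> forall i j,
        L x xi i j = L_char i j x xi].

Definition feedback (u : R -> R -> 'cV[R]_n) (v : R -> R -> 'cV[R]_m)
    (t : R) : 'cV[R]_m :=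
  - (R1 *m u t 1)
  + \col_(i < m) \int[leb]_(xi in `[0, 1])
      (K 1 xi *m u t xi + L 1 xi *m v t xi) i 0.

End Kernels.

Section Solutions.
Variables (U : R -> 'cV[R]_m) (u0 : R -> 'cV[R]_n) (v0 : R -> 'cV[R]_m).
Variables (u : R -> R -> 'cV[R]_n) (v : R -> R -> 'cV[R]_m).

(* The characteristic of u_i through (t, x), followed backwards in time, either
   stays in [0,1] until time 0 (if te <= 0) or leaves through the side x = 0 at
   the time te, where the boundary condition u = Q0 v applies. *)
Definition u_char (i : 'I_n) (t x : R) : R :=
  let te := t - x / lam i in
  (if te <= 0 then u0 (x - lam i * t) i 0 else (Q0 *m v te 0) i 0)
  + \int[leb]_(s in `[Num.max 0 te, t])
      (Spp *m u s (x - lam i * (t - s)) + Spm *m v s (x - lam i * (t - s))) i 0.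

(* Likewise for v_j, which leaves through x = 1, where v = R1 u + U. *)
Definition v_char (j : 'I_m) (t x : R) : R :=
  let te := t - (1 - x) / mu j in
  (if te <= 0 then v0 (x + mu j * t) j 0 else (R1 *m u te 1 + U te) j 0)
  + \int[leb]_(s in `[Num.max 0 te, t])
      (Smp *m u s (x + mu j * (t - s)) + Smm *m v s (x + mu j * (t - s))) j 0.

(* Solutions in the sense of characteristics, in L^2_loc in time with values in
   L^2([0,1]). The functions u(., 0), u(., 1), v(., 0), v(., 1) of time are the
   boundary traces: the last two clauses determine them for a.e. t (at x = 0 for
   u and x = 1 for v they are the boundary conditions themselves), whereas the
   two preceding ones say nothing about the null set {0, 1} of space. The
   integrability of the sources along almost every characteristic follows from
   the first three clauses. *)
Record is_solution : Prop := IsSolution {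
  sol_u_meas : forall i, measurable_fun (`[0, +oo[ `*` `[0, 1] : set (R * R))
    (fun z : R * R => u z.1 z.2 i 0);
  sol_v_meas : forall j, measurable_fun (`[0, +oo[ `*` `[0, 1] : set (R * R))
    (fun z : R * R => v z.1 z.2 j 0);
  sol_L2 : forall T : R, 0 <= T ->
    (\int[leb]_(t in `[0%R, T]) (L2norm (u t) (v t) ^+ 2) < +oo)%E;
  sol_u : forall i t, 0 <= t ->
    {ae leb, forall x, 0 <= x <= 1 -> u t x i 0 = u_char i t x};
  sol_v : forall j t, 0 <= t ->
    {ae leb, forall x, 0 <= x <= 1 -> v t x j 0 = v_char j t x};
  sol_u_trace : forall i x, x = 0 \/ x = 1 ->
    {ae leb, forall t, 0 <= t -> u t x i 0 = u_char i t x};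
  sol_v_trace : forall j x, x = 0 \/ x = 1 ->
    {ae leb, forall t, 0 <= t -> v t x j 0 = v_char j t x}
}.

End Solutions.

Definition closed_loop_solution K L (u0 : R -> 'cV[R]_n) (v0 : R -> 'cV[R]_m)
    (u : R -> R -> 'cV[R]_n) (v : R -> R -> 'cV[R]_m) : Prop :=
  is_solution (feedback K L u v) u0 v0 u v.

End Hyperbolic.

(* Main.v *)
Require Import Defs.
From HB Require Import structures.
From mathcomp Require Import all_boot all_order all_algebra.
From mathcomp Require Import all_classical all_reals all_analysis.
From mathcomp Require Import measurable_realfun.
From mathcomp Require Import ring lra.

Set Implicit Arguments.
Unset Strict Implicit.
Unset Printing Implicit Defensive.

Import Order.TTheory GRing.Theory Num.Theory.
Import numFieldNormedType.Exports.

Local Open Scope classical_set_scope.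
Local Open Scope ring_scope.

(* The pair (u, v) is handled as a single family z_j, j in 'I_n + 'I_m, each z_j being
   transported with the speed lam_k or - mu_i. Along a characteristic x + mu_i s = const of
   v_i, consider the integral over [0, x] of sum_j z_j k_ij, with k_ij the entries of K and
   L: the kernel equations say that k_ij is transported backwards with the speed of z_j,
   and the boundary values of the kernels and u = Q0 v control the fluxes at both ends.
   Hence beta_i = v_i - int_0^x (K u + L v)_i satisfies beta_i' = sum_(p >= i) omega_ip
   beta_p along this line, and the feedback says that beta_i = 0 at x = 1. By Gronwall's
   inequality beta = 0 from the time 1 / mu_1 on; then v = int_0^x (K u + L v) is bounded by
   u, and v(., 0) = 0, so no u enters through x = 0. A second Gronwall inequality gives
   u = v = 0 for x <= lam_1 (t - 1 / mu_1), that is everywhere at t_F. Exponential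
   stability follows because the L^2 norm grows at most by a constant factor on
   [0, t_F]; this factor depends on bounds of the coefficients only. *)

(** * Lebesgue integrals on the line *)

(** Nothing is differentiated: the state is only in L^2, and [L] may jump across the lines
    [mu i * xi = mu j * x], so every differential identity is an integrated one. On the line
    [x = g0 - mu i * s] of [v_i], the characteristic of [k_ij] through [(x, xi)] is the path of
    [z_j] itself. In the coordinate carried along with this path, state and kernel are both
    primitives in [s], and their product obeys a product rule. The obstacle is null sets. At a given
    time the state satisfies its equations for almost every [x] only, whereas the identity for
    [beta_i] lives on single lines and at the end [x = 0]. On lines the state is therefore replaced
    by its own transport formula. The error is carried as an extra term, which disappears only when
    all parallel lines are integrated over; sweeping them in time instead of space gives the trace
    at [x = 0]. Both Gronwall arguments presuppose finite masses, and the identities presuppose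
    integrability at every time; the latter comes from the energy estimate. *)

Section Affine.
Context {R : realType}.
Local Notation leb := (@lebesgue_measure R).

Lemma measurable_affine (a b : R) D : measurable_fun D (fun x : R => a * x + b).
Proof.
by apply: measurable_funTS; apply: measurable_funD; [exact: mulrl_measurable|exact: measurable_cst].
Qed.

(** Lebesgue measure is determined by its values on half-open intervals, and the right-hand side is
    a measure with the same values. For [a < 0] the preimage of []p, q]] is closed at its other end,
    which does not change its length. *)
Lemma lebesgue_measure_affine (a b : R) (A : set R) : a != 0 -> measurable A ->
  (leb A = `|a|%:E * pushforward leb (fun x : R => (a * x + b)%R : measurableTypeR R) A)%E.
Proof.
move=> a0 mA.
have mphi : measurable_fun setT (fun x : R => (a * x + b)%R : measurableTypeR R).
  exact: measurable_affine.
pose phi : {mfun _ >-> _} := HB.pack (fun x : measurableTypeR R => (a * x + b)%R : measurableTypeR R)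
  (isMeasurableFun.Build _ _ _ _ (fun x : measurableTypeR R => (a * x + b)%R : measurableTypeR R) mphi).
rewrite (lebesgue_measure_unique (mu := mscale (NngNum (normr_ge0 a)) (pushforward leb phi)))//.
move=> _ [[p q]] _ <-.
rewrite /= /mscale /= /pushforward /=.
rewrite lebesgue_measure_itv/= lte_fin.
have [apos|aneg] : 0 < a \/ a < 0.
  by have := a0; rewrite neq_lt => /orP[]; [right|left].
- have -> : (fun x : R => a * x + b) @^-1` `]p, q]%classic = `](p - b) / a, (q - b) / a]%classic.
    apply/seteqP; split => x /=; rewrite !in_itv/= ltr_pdivrMr// ler_pdivlMr// (mulrC x a); lra.
  rewrite lebesgue_measure_itv/= lte_fin ltr_pM2r ?invr_gt0// ltrD2r.
  case: ifPn => pq; last by rewrite mule0.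
  rewrite gtr0_norm// -!EFinB -EFinM; congr EFin; rewrite -mulrBl mulrC divfK//; lra.
- have -> : (fun x : R => a * x + b) @^-1` `]p, q]%classic = `[(q - b) / a, (p - b) / a[%classic.
    apply/seteqP; split => x /=; rewrite !in_itv/= ltr_ndivlMr// ler_ndivrMr// (mulrC x a); lra.
  rewrite lebesgue_measure_itv/= lte_fin ltr_nM2r ?invr_lt0// ltrD2r.
  case: ifPn => pq; last by rewrite mule0.
  rewrite ltr0_norm// -!EFinB -EFinM; congr EFin; rewrite -mulrBl mulNr mulrC divfK//; lra.
Qed.

Lemma ge0_integral_affine (a b : R) (f : R -> \bar R) : a != 0 ->
  measurable_fun setT f -> (forall x, 0 <= f x)%E ->
  (\int[leb]_x f (a * x + b)%R = (`|a|^-1)%:E * \int[leb]_x f x)%E.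
Proof.
move=> a0 mf f0.
have mphi : measurable_fun setT (fun x : measurableTypeR R => (a * x + b)%R : measurableTypeR R).
  exact: measurable_affine.
pose phi : {mfun _ >-> _} := HB.pack (fun x : measurableTypeR R => (a * x + b)%R : measurableTypeR R)
  (isMeasurableFun.Build _ _ _ _ (fun x : measurableTypeR R => (a * x + b)%R : measurableTypeR R) mphi).
rewrite [in RHS](eq_measure_integral (mscale (NngNum (normr_ge0 a)) (pushforward leb phi))); last first.
  by move=> A mA _; rewrite /= (lebesgue_measure_affine b a0 mA).
rewrite ge0_integral_mscale//= muleA -EFinM mulVf ?normr_eq0// mul1e.
by rewrite ge0_integral_pushforward//= preimage_setT.
Qed.

End Affine.

Lemma measurable_sumr d (T : measurableType d) (R : realType) (D : set T) (I : Type) (s : seq I)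
    (P : pred I) (f : I -> T -> R) :
  (forall i, measurable_fun D (f i)) -> measurable_fun D (fun x => \sum_(i <- s | P i) f i x).
Proof.
move=> mf; elim: s => [|i s ih].
  by under eq_fun do rewrite big_nil; exact: measurable_cst.
under eq_fun do rewrite big_cons; case: (P i) => //.
exact: measurable_funD.
Qed.

Local Notation measurable2 R f := (measurable_fun setT (fun p : R * R => f p.1 p.2)).

(** Curried functions are known to be measurable only as functions of a pair. The two clauses with a
    nested [match] therefore present [F (g1 x) (g2 x)], or the partial application [F s], as a
    composition with a map into the product. *)
Ltac meas1 :=
  match goal with
  | H : ?G |- ?G => exact: H
  | |- measurable_fun _ (fun _ => ?a) => exact: measurable_cst
  | |- measurable_fun _ (fun x => x) => exact: measurable_id
  | |- measurable_fun _ (fun x => x.1) => exact: measurable_fst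
  | |- measurable_fun _ (fun x => x.2) => exact: measurable_snd
  | |- measurable_fun _ (fun x => ((@?f x)%:E)) => apply/measurable_EFinP
  | |- measurable_fun _ (fun x => ((@?f x) + (@?g x))%R) => first [apply: (@measurable_funD _ _ _ _ f g) | apply: (@emeasurable_funD _ _ _ _ f g)]
  | |- measurable_fun _ (fun x => (- (@?f x))%R) => apply: (@measurable_funN _ _ _ _ f)
  | |- measurable_fun _ (fun x => ((@?f x) * (@?g x))%R) => apply: (@measurable_funM _ _ _ _ f g)
  | |- measurable_fun _ (fun x => ((@?f x) ^+ ?n)%R) => apply: (@measurable_funX _ _ _ _ f n)
  | |- measurable_fun _ (fun x => `| @?f x |%R) => apply: (measurableT_comp (@normr_measurable _ setT) (g:=f))
  | |- measurable_fun _ (fun x => ((@?f x) <= (@?g x))%R) => apply: (@measurable_fun_ler _ _ _ _ f g)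
  | |- measurable_fun _ (fun x => ((@?f x) < (@?g x))%R) => apply: (@measurable_fun_ltr _ _ _ _ f g)
  | |- measurable_fun _ (fun x => ((@?f x) && (@?g x))) => apply: (@measurable_and _ _ _ f g)
  | |- measurable_fun setT (fun x => (@?f x, @?g x)) => apply: (@measurable_fun_pair _ _ _ _ _ _ f g)
  | |- measurable_fun _ (fun x => `| @?f x |%E) => apply: (measurableT_comp (@abse_measurable _ setT) (g:=f))
  | |- measurable_fun _ (fun x => ((@?f x) * (@?g x))%E) => apply: (@emeasurable_funM _ _ _ _ f g)
  | H : measurable_fun setT ?f |- measurable_fun _ (fun x => ?f (@?g x)) =>
      apply: (measurableT_comp H (g:=g))
  | |- measurable_fun _ (fun x => ?F (@?g1 x) (@?g2 x)) =>
      match goal with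
      | H : measurable_fun _ (fun z => ?F' z.1 z.2) |- _ =>
          let u := constr:(fun x => (g1 x, g2 x)) in let u := eval cbv beta in u in refine (measurableT_comp H (g := u) _)
      | H : forall j, measurable_fun _ (fun z => @?F' j z.1 z.2) |- _ =>
          let u := constr:(fun x => (g1 x, g2 x)) in let u := eval cbv beta in u in refine (measurableT_comp (H _) (g := u) _)
      end
  | |- measurable_fun _ (?F ?s) =>
      match goal with
      | H : measurable_fun _ (fun z => ?F' z.1 z.2) |- _ =>
          refine (measurableT_comp H (g := fun x => (s, x)) _)
      | H : forall j, measurable_fun _ (fun z => @?F' j z.1 z.2) |- _ =>
          refine (measurableT_comp (H _) (g := fun x => (s, x)) _)
      end
  | H : forall j, measurable_fun setT (?f j) |- measurable_fun _ (fun x => ?f ?j (@?g x)) =>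
      apply: (measurableT_comp (H j) (g:=g))
  | |- measurable_fun _ _ => first [apply: measurable_fun_ifT | apply: measurable_sumr => ?]
  end.
Ltac meas := repeat meas1.

Section Integrals.
Context {R : realType}.
Local Notation leb := (@lebesgue_measure R).

Lemma Rint_if (a b : R) (f : R -> R) :
  \int[leb]_(s in `[a, b]) f s = \int[leb]_s (if a <= s <= b then f s else 0).
Proof.
rewrite Rintegral_mkcond; congr Rintegral; apply/funext => x.
by rewrite patchE mem_setE in_itv.
Qed.

Lemma int_if (a b : R) (f : R -> \bar R) :
  (\int[leb]_(s in `[a, b]) f s = \int[leb]_s (if (a <= s <= b)%R then f s else 0))%E.
Proof.
rewrite integral_mkcond; congr integral; apply/funext => x.
by rewrite patchE mem_setE in_itv.
Qed.

Lemma integrable_if (a b : R) (f : R -> R) :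
  leb.-integrable `[a, b] (EFin \o f) <->
  leb.-integrable setT (fun s => (if a <= s <= b then f s else 0)%:E).
Proof.
have -> : (fun s => (if a <= s <= b then f s else 0)%:E) = (EFin \o f) \_ `[a, b].
  by apply/funext => x; rewrite patchE mem_setE in_itv/=; case: ifP.
exact: integrable_mkcond.
Qed.

(** No integrability is required: the positive and negative parts have measurable integrals by
    Tonelli, and [fine] is measurable, sending infinite values to 0. *)
Lemma measurable_Rint_param d (T : measurableType d) (f : T * R -> R) :
  measurable_fun setT f -> measurable_fun setT (fun x => \int[leb]_y f (x, y)).
Proof.
move=> mf; have mEf : measurable_fun setT (EFin \o f) by exact/measurable_EFinP.
rewrite /Rintegral; apply: measurableT_comp; first exact: fine_measurable.
under eq_fun do rewrite integralE.
apply: emeasurable_funB.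
- have := measurable_fun_fubini_tonelli_F (m2 := leb) ((EFin \o f)^\+)%E.
  by move=> H; apply: eq_measurable_fun (H _ _); [move=> x _; apply: eq_integral => y _; rewrite !funeposE | exact: measurable_funepos|].
- have := measurable_fun_fubini_tonelli_F (m2 := leb) ((EFin \o f)^\-)%E.
  by move=> H; apply: eq_measurable_fun (H _ _); [move=> x _; apply: eq_integral => y _; rewrite !funenegE | exact: measurable_funeneg|].
Qed.

Lemma measurable_Rint_itv d (T : measurableType d) (f : T -> R -> R) (a b : T -> R) :
  measurable_fun setT (fun z : T * R => f z.1 z.2) ->
  measurable_fun setT a -> measurable_fun setT b ->
  measurable_fun setT (fun x => \int[leb]_(y in `[a x, b x]) f x y).
Proof.
move=> mf ma mb; under eq_fun do rewrite Rint_if.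
by apply: (@measurable_Rint_param _ _ (fun z => if a z.1 <= z.2 <= b z.1 then f z.1 z.2 else 0)); meas.
Qed.

Lemma measurable_int_itv d (T : measurableType d) (f : T -> R -> \bar R) (a b : T -> R) :
  measurable_fun setT (fun z : T * R => f z.1 z.2) ->
  (forall x y, 0 <= f x y)%E ->
  measurable_fun setT a -> measurable_fun setT b ->
  measurable_fun setT (fun x => \int[leb]_(y in `[a x, b x]) f x y)%E.
Proof.
move=> mf f0 ma mb; under eq_fun do rewrite int_if.
apply: (@measurable_fun_fubini_tonelli_F _ _ _ _ _ leb (fun z => if (a z.1 <= z.2 <= b z.1)%R then f z.1 z.2 else 0)); last first.
  by move=> z; case: ifP => // _; exact: f0.
by meas.
Qed.

Lemma integrable_affine (a b : R) (f : R -> R) : a != 0 ->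
  leb.-integrable setT (EFin \o f) ->
  leb.-integrable setT (fun x => (f (a * x + b))%:E).
Proof.
move=> a0 /integrableP[mf fi].
have mf' : measurable_fun setT f by exact/measurable_EFinP.
apply/integrableP; split.
  by apply/measurable_EFinP; meas.
have /= -> := @ge0_integral_affine R a b (fun x => `|(f x)%:E|%E) a0.
- rewrite lte_mul_pinfty// ?lee_fin//.
- by meas.
- by move=> x; rewrite lee_fin.
Qed.

Lemma integral_affine (a b : R) (f : R -> R) : a != 0 ->
  leb.-integrable setT (EFin \o f) ->
  \int[leb]_x f (a * x + b) = `|a|^-1 * \int[leb]_x f x.
Proof.
move=> a0 fi; have mf := measurable_int _ fi.
have fi' := integrable_affine b a0 fi.
rewrite /Rintegral [in LHS]integralE [in RHS]integralE.
have p := @ge0_integral_affine R a b _ a0 (measurable_funepos mf) (fun x => funepos_ge0 _ x).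
have n := @ge0_integral_affine R a b _ a0 (measurable_funeneg mf) (fun x => funeneg_ge0 _ x).
have p' : (\int[leb]_x ((fun x => (f (a * x + b)%R)%:E)^\+ x) =
    (`|a|^-1)%:E * \int[leb]_x (EFin \o f)^\+ x)%E.
  by rewrite -p; apply: eq_integral => x _; rewrite !funeposE.
have n' : (\int[leb]_x ((fun x => (f (a * x + b)%R)%:E)^\- x) =
    (`|a|^-1)%:E * \int[leb]_x (EFin \o f)^\- x)%E.
  by rewrite -n; apply: eq_integral => x _; rewrite !funenegE.
rewrite p' n'.
have := integrable_pos_fin_num measurableT fi; have := integrable_neg_fin_num measurableT fi.
by case: integral => // u _; case: integral => // v _; rewrite -!EFinM/= mulrBr.
Qed.

Lemma Rint_split (a b c : R) (f : R -> R) : a <= b -> b <= c ->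
  leb.-integrable `[a, c] (EFin \o f) ->
  \int[leb]_(s in `[a, c]) f s = \int[leb]_(s in `[a, b]) f s + \int[leb]_(s in `[b, c]) f s.
Proof.
move=> ab bc fi; apply/eqP; rewrite addrC -subr_eq; apply/eqP.
rewrite Rintegral_itvB ?bnd_simp// Rintegral_itv_obnd_cbnd//.
apply: integrableS fi => //; apply: subset_itvr; rewrite bnd_simp//.
Qed.

End Integrals.

(** * Null sets, Cauchy-Schwarz, and integrals swept along characteristics *)

Section AlmostEverywhere.
Context {R : realType}.
Local Notation leb := (@lebesgue_measure R).

Lemma ae_leb_filter : Filter (almost_everywhere leb).
Proof.
exact: (ae_filter_ringOfSetsType (lebesgue_measure : {measure set (measurableTypeR R) -> \bar R})).
Qed.

Lemma aeS (P Q : R -> Prop) : (forall x, P x -> Q x) ->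
  {ae leb, forall x, P x} -> {ae leb, forall x, Q x}.
Proof. by have F := ae_leb_filter; exact: filterS. Qed.

Lemma aeI (P Q : R -> Prop) :
  {ae leb, forall x, P x} -> {ae leb, forall x, Q x} -> {ae leb, forall x, P x /\ Q x}.
Proof. by have F := ae_leb_filter; exact: filterI. Qed.

Lemma ae_true (P : R -> Prop) : (forall x, P x) -> {ae leb, forall x, P x}.
Proof. by move=> PT; have F := ae_leb_filter; exact: filterE. Qed.

Lemma ae_fin (I : finType) (P : I -> R -> Prop) :
  (forall i, {ae leb, forall x, P i x}) -> {ae leb, forall x, forall i, P i x}.
Proof.
move=> aeP; have F := ae_leb_filter.
exact: (@filter_forall _ _ P _ F).
Qed.

Lemma lebesgue_itvcc (a b : R) : a <= b -> (leb `[a, b] = (b - a)%:E)%E.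
Proof.
move=> ab; rewrite lebesgue_measure_itv/= lte_fin; case: ltP => // ba.
by have -> : b = a by [apply/eqP; rewrite eq_le ab ba]; rewrite subrr.
Qed.

Lemma integrable_cst_itv (a b k : R) : leb.-integrable `[a, b] (fun=> k%:E).
Proof.
apply/integrableP; split; first exact: measurable_cst.
rewrite (integral_cst leb _ `|k%:E|)//= lebesgue_measure_itv/=.
by case: ifP => _; rewrite ?mule0 ?ltry// -EFinB -EFinM ltry.
Qed.

Lemma integrable_sqr (a b : R) (f : R -> R) : a <= b ->
  measurable_fun setT f ->
  (\int[leb]_(s in `[a, b]) ((f s)^+2)%:E < +oo)%E ->
  leb.-integrable `[a, b] (EFin \o f).
Proof.
move=> ab mf fi.
apply: (@le_integrable _ _ _ _ _ _ _ (fun s : measurableTypeR R => ((f s)^+2 + 1)%:E)) => //.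
- by apply: measurable_funTS; rewrite /comp; meas.
- move=> x _; rewrite lee_fin [leRHS]ger0_norm ?addr_ge0 ?sqr_ge0//.
  rewrite -real_normK ?num_real//; have := normr_ge0 (f x); nra.
- apply: (@integrableD _ _ _ _ _ _ (fun s : measurableTypeR R => ((f s)^+2)%:E) (fun=> 1%:E)) => //.
    apply/integrableP; split; first by apply: measurable_funTS; meas.
    by under eq_integral do rewrite gee0_abs ?lee_fin ?sqr_ge0//.
  exact: integrable_cst_itv.
Qed.

Lemma Cauchy_Schwarz_itv (a b : R) (f : R -> R) : a <= b -> measurable_fun setT f ->
  (((\int[leb]_(s in `[a, b]) f s) ^+ 2)%:E <=
     (b - a)%:E * \int[leb]_(s in `[a, b]) ((f s)^+2)%:E)%E.
Proof.
move=> ab mf; have [->|ab'] := eqVneq a b.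
  by rewrite set_itv1 Rintegral_set1 expr0n/= subrr mul0e.
have ba : 0 < b - a by rewrite subr_gt0 lt_neqAle ab' ab.
have I0 : (0 <= \int[leb]_(s in `[a, b]) ((f s)^+2)%:E)%E.
  by apply: integral_ge0 => x _; rewrite lee_fin sqr_ge0.
have [fi|] := ltP (\int[leb]_(s in `[a, b]) ((f s)^+2)%:E)%E +oo%E; last first.
  by rewrite leye_eq => /eqP ->; rewrite gt0_muley ?lte_fin// leey.
have f1 := integrable_sqr ab mf fi.
have f2 : leb.-integrable `[a, b] (EFin \o (fun s => (f s)^+2)).
  apply/integrableP; split; first by apply: measurable_funTS; rewrite /comp; meas.
  by under eq_integral do rewrite gee0_abs ?lee_fin ?sqr_ge0//.
have f2E : (\int[leb]_(s in `[a, b]) ((f s)^+2)%:E)%E = (\int[leb]_(s in `[a, b]) (f s)^+2)%:E.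
  by rewrite /Rintegral fineK// ge0_fin_numE.
rewrite f2E -EFinM lee_fin.
set m := \int[leb]_(s in _) f s; set q := \int[leb]_(s in _) _.
(* [k] is the mean value of [f]; expanding the nonnegative integral of [(f - k) ^+ 2] gives the
   inequality. *)
pose k := m / (b - a).
have : 0 <= \int[leb]_(s in `[a, b]) ((f s)^+2 + ((-2 * k) * f s + k^+2)).
  by apply: Rintegral_ge0 => x _; have := sqr_ge0 (f x - k); nra.
rewrite RintegralD//; last first.
  apply: (@integrableD _ _ _ _ _ _ (fun s : measurableTypeR R => (-2 * k * f s)%:E) (fun=> (k^+2)%:E)) => //; last exact: integrable_cst_itv.
  exact: (integrableZl _ (-2 * k) f1).
rewrite RintegralD//; last 2 first.
- exact: (integrableZl _ (-2 * k) f1).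
- exact: integrable_cst_itv.
rewrite RintegralZl// Rintegral_cst//= lebesgue_itvcc//= -/m -/q.
have -> : m = k * (b - a) by rewrite /k divfK// gt_eqF.
nra.
Qed.

Lemma Tonelli (f : R -> R -> \bar R) :
  measurable2 R f -> (forall x y, 0 <= f x y)%E ->
  (\int[leb]_x \int[leb]_y f x y = \int[leb]_y \int[leb]_x f x y)%E.
Proof.
by move=> mf f0; exact: (@fubini_tonelli _ _ _ _ _ leb leb (fun z => f z.1 z.2)).
Qed.

Lemma measurable_int_l (f : R -> R -> \bar R) :
  measurable2 R f -> (forall x y, 0 <= f x y)%E ->
  measurable_fun setT (fun x => \int[leb]_y f x y)%E.
Proof.
by move=> mf f0; exact: (@measurable_fun_fubini_tonelli_F _ _ _ _ _ leb (fun z => f z.1 z.2)).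
Qed.

Lemma measurable_int_r (f : R -> R -> \bar R) :
  measurable2 R f -> (forall x y, 0 <= f x y)%E ->
  measurable_fun setT (fun y => \int[leb]_x f x y)%E.
Proof.
by move=> mf f0; exact: (@measurable_fun_fubini_tonelli_G _ _ _ _ _ leb (fun z => f z.1 z.2)).
Qed.

(** Integrating first along each characteristic that reaches time [t], then over all of them, covers
    space-time exactly once: at each time [s] the points of these lines are a translate of the
    variable [x]. *)
Lemma sweep_x (c t : R) (h : R -> R -> \bar R) :
  measurable2 R h -> (forall s x, 0 <= h s x)%E ->
  (\int[leb]_x \int[leb]_s h s (x - c * (t - s))%R = \int[leb]_s \int[leb]_x h s x)%E.
Proof.
move=> mh h0.
rewrite (@Tonelli (fun x s => h s (x - c * (t - s))%R)); [|by meas|by move=> x s; exact: h0].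
apply: eq_integral => s _ /=.
have := @ge0_integral_affine R 1 (- (c * (t - s))) (h s) (oner_neq0 _).
rewrite normr1 invr1 mul1e => <- //; last by meas.
by apply: eq_integral => x _; rewrite mul1r.
Qed.

(** The counterpart of [sweep_x] for the characteristics through one position [x] at varying times
    [t]. At time [s] they are spread with density [|c|^-1], whence the factor. *)
Lemma sweep_t (c x : R) (h : R -> R -> \bar R) : c != 0 ->
  measurable2 R h -> (forall s x, 0 <= h s x)%E ->
  (\int[leb]_t \int[leb]_s h s (x - c * (t - s))%R =
    (`|c|^-1)%:E * \int[leb]_s \int[leb]_x h s x)%E.
Proof.
move=> c0 mh h0.
rewrite (@Tonelli (fun t s => h s (x - c * (t - s))%R))//; last by meas.
rewrite -ge0_integralZl_EFin//; last 2 first.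
- by move=> s _; exact: integral_ge0.
- exact: measurable_int_l.
apply: eq_integral => s _ /=.
have := @ge0_integral_affine R (- c) (x + c * s) (h s).
rewrite normrN => <- //; rewrite ?oppr_eq0//; last by meas.
by apply: eq_integral => t _; congr (h s _); ring.
Qed.

Lemma integral_expR_tail (k s T : R) : 0 < k -> s <= T ->
  (\int[leb]_(t in `[s, T]) (expR (- k * t))%:E <= (expR (- k * s) / k)%:E)%E.
Proof.
move=> k0; rewrite le_eqVlt => /predU1P[->|sT].
  by rewrite set_itv1 integral_set1 lee_fin divr_ge0 ?expR_ge0 ?ltW.
have cexpNM : continuous (fun z : R^o => expR (- k * z)).
  move=> z; apply: continuous_comp; last exact: continuous_expR.
  by apply: continuousM => //; apply: (@continuousN _ R^o); exact: cst_continuous.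
have cF : continuous (fun z : R^o => - k^-1 * expR (- k * z)).
  by move=> z; apply: cvgM; [exact: cvg_cst|exact: cexpNM].
rewrite (@continuous_FTC2 _ _ (fun x => - k^-1 * expR (- k * x)))//.
- rewrite -EFinB lee_fin; have := expR_ge0 (- k * T); have : 0 < k^-1 by rewrite invr_gt0.
  nra.
- exact: continuous_subspaceT.
- split.
  + by move=> z _; exact: ex_derive.
  + by apply/cvg_at_right_filter; exact: cF.
  + by apply/cvg_at_left_filter; exact: cF.
- move=> z _.
  rewrite derive1Ml// derive1_comp// derive1E.
  have /funeqP -> := @derive_expR R.
  by rewrite derive1Ml// derive1_id mulr1 mulrCA mulrNN mulVf ?mulr1 ?gt_eqF.
Qed.

End AlmostEverywhere.

Section Gronwall.
Context {R : realType}.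
Local Notation leb := (@lebesgue_measure R).

(* Integrating the hypothesis against exp(-2Ct) turns its integral term, by Tonelli,
   into half of the left-hand side. *)
Lemma Gronwall (T C : R) (A : \bar R) (f : R -> \bar R) : 0 < C -> 0 <= T -> (0 <= A)%E ->
  measurable_fun setT f -> (forall t, 0 <= f t)%E ->
  (\int[leb]_(t in `[0%R, T]) f t < +oo)%E ->
  {ae leb, forall t, 0 <= t <= T -> (f t <= A + C%:E * \int[leb]_(s in `[0%R, t]) f s)%E} ->
  (\int[leb]_(t in `[0%R, T]) f t <= (expR (2 * C * T) / C)%:E * A)%E.
Proof.
move=> C0 T0 A0 mf f0 fi fA.
have coef0 : 0 < expR (2 * C * T) / C by rewrite divr_gt0 ?expR_gt0.
case: A A0 fA => [a||//] a0 fA; last by rewrite gt0_muley ?lte_fin// leey.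
have ? : 0 <= a by rewrite -lee_fin.
pose w (t : R) : R := expR (- (2 * C) * t).
have w0 t : 0 < w t by exact: expR_gt0.
have mw : measurable_fun setT w by apply: measurableT_comp => //; meas.
pose F (t : R) : \bar R := (\int[leb]_(s in `[0%R, t]) f s)%E.
have F0 t : (0 <= F t)%E by exact: integral_ge0.
have mF : measurable_fun setT F.
  by apply: (@measurable_int_itv _ _ _ (fun _ s => f s)) => //; meas.
pose X := (\int[leb]_(t in `[0%R, T]) ((w t)%:E * f t))%E.
have X0 : (0 <= X)%E by apply: integral_ge0 => t _; rewrite mule_ge0 ?lee_fin// ltW.
have w1 t : 0 <= t -> w t <= 1.
  by move=> t0; rewrite /w -[leRHS]expR0 ler_expR; nra.
(* Finiteness is what allows the inequality [XA], which has half of [X] on its right, to be solved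
   for [X]. *)
have Xfin : (X < +oo)%E.
  apply: le_lt_trans fi; apply: ge0_le_integral => //.
  - by move=> t _; rewrite mule_ge0 ?lee_fin// ltW.
  - by apply: measurable_funTS; meas.
  - exact: measurable_funTS.
  - move=> t; rewrite /= in_itv/= => /andP[t0 _].
    by rewrite -[leRHS]mul1e lee_wpmul2r ?lee_fin ?w1.
have XA : (X <= (a / (2 * C))%:E + (2^-1)%:E * X)%E.
  apply: (@le_trans _ _ (\int[leb]_(t in `[0%R, T]) ((w t * a)%:E + C%:E * ((w t)%:E * F t)))%E).
    apply: ae_ge0_le_integral => //.
    - by move=> t _; rewrite mule_ge0 ?lee_fin// ltW.
    - by apply: measurable_funTS; meas.
    - by move=> t _; rewrite adde_ge0 ?mule_ge0 ?lee_fin ?mulr_ge0// ltW.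
    - by apply: measurable_funTS; meas.
    - move: fA; apply: aeS => t ft; rewrite /= in_itv/= => /ft {}ft.
      rewrite EFinM muleCA -ge0_muleDr ?lee_fin//; last by rewrite mule_ge0 ?lee_fin// ltW.
      by rewrite lee_wpmul2l ?lee_fin// ltW.
  rewrite ge0_integralD//; last 4 first.
  - by move=> t _; rewrite lee_fin mulr_ge0// ltW.
  - by apply: measurable_funTS; meas.
  - by move=> t _; rewrite !mule_ge0 ?lee_fin// ltW.
  - by apply: measurable_funTS; meas.
  have C20 : 0 < 2 * C by rewrite mulr_gt0.
  apply: leeD.
    under eq_integral do rewrite mulrC EFinM.
    rewrite ge0_integralZl//=; last 2 first.
    - by apply: measurable_funTS; meas.
    - by move=> t _; rewrite lee_fin ltW.
    rewrite EFinM lee_wpmul2l ?lee_fin//.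
    apply: le_trans (integral_expR_tail C20 T0) _.
    by rewrite mulr0 expR0 mul1r.
  rewrite ge0_integralZl//=; last 3 first.
  - by apply: measurable_funTS; meas.
  - by move=> t _; rewrite mule_ge0 ?lee_fin// ltW.
  - by rewrite lee_fin ltW.
  pose h (t s : R) : \bar R := (if (0 <= t <= T)%R && (0 <= s <= t)%R then (w t)%:E * f s else 0)%E.
  have h0 t s : (0 <= h t s)%E by rewrite /h; case: ifP => // _; rewrite mule_ge0 ?lee_fin// ltW.
  have mh : measurable2 R h by rewrite /h; meas.
  have -> : (\int[leb]_(t in `[0%R, T]) ((w t)%:E * F t) = \int[leb]_t \int[leb]_s h t s)%E.
    rewrite int_if; apply: eq_integral => t _; rewrite /h; case: ifP => _ /=; last by rewrite integral0.
    rewrite /F int_if -ge0_integralZl//=; last 3 first.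
    - by meas.
    - by move=> s _; case: ifP.
    - by rewrite lee_fin ltW.
    by apply: eq_integral => s _; case: ifP; rewrite ?mule0.
  rewrite Tonelli//.
  rewrite /X int_if.
  rewrite -!ge0_integralZl//=; last 5 first.
  - by meas.
  - by move=> s _; case: ifP => // _; rewrite mule_ge0 ?lee_fin// ltW.
  - exact: measurable_int_r.
  - by move=> s _; exact: integral_ge0.
  - by rewrite lee_fin ltW.
  apply: ge0_le_integral => //.
  - by move=> s _; rewrite mule_ge0 ?lee_fin ?integral_ge0// ltW.
  - by apply: emeasurable_funM => //; exact: measurable_int_r.
  - by meas.
  move=> s _.
  have [/andP[s0 sT]|sN] := boolP (0 <= s <= T); last first.
    rewrite integral0_eq ?mule0// => t _; rewrite /h; case: ifP => // /andP[/andP[t0 tT] /andP[s0 st]].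
    by rewrite s0 (le_trans st tT) in sN.
  have -> : (\int[leb]_t h t s = \int[leb]_(t in `[s, T]) (f s * (w t)%:E))%E.
    rewrite int_if; apply: eq_integral => t _; rewrite /h s0 /=.
    case: ifP => [/andP[/andP[t0 tT] st]|]; first by rewrite st tT muleC.
    case: ifP => // /andP[st tT]; rewrite st tT (le_trans s0 st)//.
  rewrite ge0_integralZl//; last 2 first.
  - by apply: measurable_funTS; meas.
  - by move=> t _; rewrite lee_fin ltW.
  apply: (@le_trans _ _ (C%:E * (f s * (w s / (2 * C))%:E))%E).
    apply: lee_wpmul2l; first by rewrite lee_fin ltW.
    by apply: lee_wpmul2l => //; exact: integral_expR_tail.
  rewrite muleCA muleC -EFinM.
  have -> : C * (w s / (2 * C)) = 2^-1 * w s by field; rewrite gt_eqF.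
  by rewrite EFinM muleA.
have {Xfin}XE : X = (fine X)%:E by rewrite fineK// ge0_fin_numE.
have XaC : fine X <= a / C.
  move: XA; rewrite XE -EFinM -EFinD lee_fin.
  have -> : a / C = 2 * (a / (2 * C)) by field; rewrite gt_eqF.
  lra.
(* On [[0, T]] the weight is at least [expR (- (2 * C) * T)]; removing it costs the exponential
   factor of the conclusion. *)
apply: (@le_trans _ _ ((expR (2 * C * T))%:E * X)%E).
  rewrite -ge0_integralZl//=; last 2 first.
  - by apply: measurable_funTS; meas.
  - by move=> t _; rewrite mule_ge0 ?lee_fin// ltW.
  apply: ge0_le_integral => //.
  - exact: measurable_funTS.
  - by apply: measurable_funTS; meas.
  - move=> t; rewrite /= in_itv/= => /andP[t0 tT].
    rewrite muleA -EFinM -[leLHS]mul1e lee_wpmul2r// lee_fin -expRD -[leLHS]expR0 ler_expR; nra.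
rewrite XE -!EFinM lee_fin.
have -> : expR (2 * C * T) / C * a = expR (2 * C * T) * (a / C) by rewrite mulrAC mulrA.
by apply: ler_wpM2l => //; exact: expR_ge0.
Qed.

End Gronwall.

(** * Integrability and Fubini for real-valued integrals *)

Section Integrability.
Context {R : realType}.
Local Notation leb := (@lebesgue_measure R).

(** Functions on an interval are treated as functions on the whole line, cut off to 0 by an [if].
    One notion of integrability then serves all domains, moving ones included. *)
Definition int1 (f : R -> R) := leb.-integrable setT (fun s : R => (f s)%:E).

(** By Tonelli this is integrability for the product measure (see [int2P]); the iterated form is the
    one that the estimates deliver. *)
Definition int2 (f : R -> R -> R) := measurable2 R f /\
  (\int[leb]_x \int[leb]_y `|f x y|%:E < +oo)%E.

Lemma int1_meas f : int1 f -> measurable_fun setT f.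
Proof. by move=> /integrableP[mf _]; exact/measurable_EFinP. Qed.

Lemma int1P f : int1 f <-> measurable_fun setT f /\ (\int[leb]_x `|f x|%:E < +oo)%E.
Proof.
split=> [/integrableP[mf fi]|[mf fi]]; first by split => //; exact/measurable_EFinP.
by apply/integrableP; split => //; exact/measurable_EFinP.
Qed.

Lemma int1_le (f g : R -> R) : measurable_fun setT f -> (forall x, `|f x| <= `|g x|) ->
  int1 g -> int1 f.
Proof.
move=> mf fg gi; have mg := int1_meas gi; move/int1P : gi => [_ gi].
apply/int1P; split => //; apply: le_lt_trans gi.
by apply: ge0_le_integral => //; [meas|meas|move=> x _; rewrite lee_fin].
Qed.

Lemma int1_ae (f g : R -> R) : measurable_fun setT f -> {ae leb, forall x, f x = g x} ->
  int1 g -> int1 f.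
Proof.
move=> mf fg gi; have mg := int1_meas gi; move/int1P : gi => [_ gi].
apply/int1P; split => //; apply: le_lt_trans gi.
rewrite le_eqVlt; apply/orP; left; apply/eqP.
apply: ge0_ae_eq_integral => //; [by meas|by meas|].
by move: fg; apply: aeS => x -> _.
Qed.

Lemma Rint_ae (f g : R -> R) : measurable_fun setT f -> measurable_fun setT g ->
  {ae leb, forall x, f x = g x} -> \int[leb]_x f x = \int[leb]_x g x.
Proof.
move=> mf mg fg; rewrite /Rintegral; congr fine; apply: ae_eq_integral => //; [by meas|by meas|].
by move: fg; apply: aeS => x -> _.
Qed.

Lemma int1D (f g : R -> R) : int1 f -> int1 g -> int1 (fun x => f x + g x).
Proof. by move=> fi gi; exact: (integrableD _ fi gi). Qed.

Lemma int1Z k (f : R -> R) : int1 f -> int1 (fun x => k * f x).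
Proof. by move=> fi; exact: (integrableZl _ k fi). Qed.

Lemma int1N (f : R -> R) : int1 f -> int1 (fun x => - f x).
Proof. by move=> fi; have := int1Z (-1) fi; rewrite /int1; under [X in leb.-integrable _ X]funext do rewrite mulN1r. Qed.

Lemma int1B (f g : R -> R) : int1 f -> int1 g -> int1 (fun x => f x - g x).
Proof. by move=> fi gi; apply: int1D => //; exact: int1N. Qed.

Lemma int1_norm (f : R -> R) : int1 f -> int1 (fun x => `|f x|).
Proof.
move=> fi; have mf := int1_meas fi.
by apply: int1_le fi; [meas|move=> x; rewrite normr_id].
Qed.

Lemma int1_0 : int1 (fun=> 0).
Proof. exact: integrable0. Qed.

Lemma int1_sum (I : Type) (s : seq I) (f : I -> R -> R) : (forall i, int1 (f i)) ->
  int1 (fun x => \sum_(i <- s) f i x).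
Proof.
move=> fi; elim: s => [|i s ih].
  by under [fun x => _]funext do rewrite big_nil; exact: int1_0.
by under [fun x => _]funext do rewrite big_cons; exact: int1D.
Qed.

Lemma int1_bounded (M : R) (f g : R -> R) : int1 f -> measurable_fun setT g ->
  (forall x, `|g x| <= M) -> int1 (fun x => f x * g x).
Proof.
move=> fi mg gM; have mf := int1_meas fi.
apply: (int1_le (g := fun x => M * f x)); [by meas| |exact: int1Z].
move=> x; rewrite !normrM mulrC ler_wpM2r//.
by rewrite (le_trans (gM x)) ?ler_norm.
Qed.

Lemma int1_cut (P : R -> bool) (f : R -> R) : measurable_fun setT P -> int1 f ->
  int1 (fun x => if P x then f x else 0).
Proof.
move=> mP fi; have mf := int1_meas fi.
by apply: int1_le fi; [meas|move=> x; case: ifP => _ //; rewrite normr0].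
Qed.

Lemma int1_cst (a b k : R) : int1 (fun s => if a <= s <= b then k else 0).
Proof. by apply/(@integrable_if R a b (fun=> k)); exact: integrable_cst_itv. Qed.

Lemma int1_affine (a b : R) (f : R -> R) : a != 0 -> int1 f -> int1 (fun x => f (a * x + b)).
Proof. by move=> a0 fi; exact: integrable_affine. Qed.

Lemma RintD (f g : R -> R) : int1 f -> int1 g ->
  \int[leb]_x (f x + g x) = \int[leb]_x f x + \int[leb]_x g x.
Proof. by move=> fi gi; rewrite RintegralD. Qed.

Lemma RintB (f g : R -> R) : int1 f -> int1 g ->
  \int[leb]_x (f x - g x) = \int[leb]_x f x - \int[leb]_x g x.
Proof. by move=> fi gi; rewrite RintegralB. Qed.

Lemma RintZ k (f : R -> R) : int1 f -> \int[leb]_x (k * f x) = k * \int[leb]_x f x.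
Proof. by move=> fi; rewrite RintegralZl. Qed.

Lemma Rint_sum (I : Type) (s : seq I) (f : I -> R -> R) : (forall i, int1 (f i)) ->
  \int[leb]_x (\sum_(i <- s) f i x) = \sum_(i <- s) \int[leb]_x f i x.
Proof.
move=> fi; elim: s => [|i s ih].
  rewrite big_nil; under eq_Rintegral do rewrite big_nil.
  by rewrite Rintegral_cst// mul0r.
rewrite big_cons -ih -RintD//; last exact: int1_sum.
by apply: eq_Rintegral => x _; rewrite big_cons.
Qed.

Lemma Rint_0 : \int[leb]_x (0 : R) = 0.
Proof. by rewrite Rintegral_cst// mul0r. Qed.

Lemma le_Rint_norm (f : R -> R) : int1 f -> `|\int[leb]_x f x| <= \int[leb]_x `|f x|.
Proof. by move=> fi; exact: le_normr_Rintegral. Qed.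

Lemma le_Rint (f g : R -> R) : int1 f -> int1 g -> (forall x, f x <= g x) ->
  \int[leb]_x f x <= \int[leb]_x g x.
Proof. by move=> fi gi fg; apply: le_Rintegral. Qed.

Lemma Rint_EFin (f : R -> R) : int1 f -> ((\int[leb]_x f x)%:E = \int[leb]_x (f x)%:E)%E.
Proof. by move=> fi; rewrite fineK// integrable_fin_num. Qed.

Lemma int2_le (f g : R -> R -> R) : measurable2 R f ->
  (forall x y, `|f x y| <= `|g x y|) -> int2 g -> int2 f.
Proof.
move=> mf fg [mg gi]; split; first exact: mf.
apply: le_lt_trans gi.
apply: ge0_le_integral => //.
- by move=> x _; exact: integral_ge0.
- by apply: measurable_int_l => //; meas.
- by apply: measurable_int_l => //; meas.
- move=> x _; apply: ge0_le_integral => //; [by meas|by meas|].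
  by move=> y _; rewrite lee_fin.
Qed.

Lemma int2_swap (f : R -> R -> R) : int2 f -> int2 (fun x y => f y x).
Proof.
move=> [mf fi]; split; first by meas.
by rewrite Tonelli//; meas.
Qed.

Lemma int2_prod (p q : R -> R) : int1 p -> int1 q -> int2 (fun x y => p x * q y).
Proof.
move=> pi qi; have mp := int1_meas pi; have mq := int1_meas qi.
split; first by meas.
have -> : (\int[leb]_x \int[leb]_y `|p x * q y|%:E = (\int[leb]_x `|p x|%:E) * \int[leb]_y `|q y|%:E)%E.
  rewrite -ge0_integralZr//; [|by meas|by apply: integral_ge0].
  apply: eq_integral => x _; rewrite -ge0_integralZl//; [|by meas].
  by apply: eq_integral => y _; rewrite normrM EFinM.
move/int1P : pi => [_ pi]; move/int1P : qi => [_ qi].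
have p0 : (0 <= \int[leb]_x `|p x|%:E)%E by apply: integral_ge0.
have q0 : (0 <= \int[leb]_x `|q x|%:E)%E by apply: integral_ge0.
move: p0 q0 pi qi; case: integral => // u; case: integral => // v *.
by rewrite -EFinM ltry.
Qed.

Let int2_prodint (f : R -> R -> R) : int2 f ->
  (leb \x leb)%E.-integrable setT (fun z : R * R => (f z.1 z.2)%:E).
Proof.
move=> [mf fi].
by apply/(@integrable12ltyP _ _ _ _ _ leb leb (fun z => (f z.1 z.2)%:E)); first meas.
Qed.

Lemma int2_ae (f : R -> R -> R) : int2 f -> {ae leb, forall x, int1 (f x)}.
Proof.
move=> fi; have := ae_integrable1 (int2_prodint fi).
exact: aeS.
Qed.

Lemma int2_int (f : R -> R -> R) : int2 f -> int1 (fun x => \int[leb]_y f x y).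
Proof.
move=> fi; have [mf f2] := fi.
have mF : measurable_fun setT (fun x => \int[leb]_y f x y).
  exact: (measurable_Rint_param (f := fun z => f z.1 z.2)).
apply/int1P; split => //; apply: le_lt_trans f2.
apply: ae_ge0_le_integral => //.
- by meas.
- by move=> x _; exact: integral_ge0.
- by apply: measurable_int_l => //; meas.
- have := int2_ae fi; apply: aeS => x fx _.
  have nfx := int1_norm fx.
  by rewrite -Rint_EFin// lee_fin; exact: le_Rint_norm.
Qed.

(** The inner real-valued integral agrees with the extended one only on integrable slices, which are
    almost all of them; the outer integral does not see the rest. *)
Lemma Fubini_R (f : R -> R -> R) : int2 f ->
  \int[leb]_x \int[leb]_y f x y = \int[leb]_y \int[leb]_x f x y.
Proof.
move=> fi; have fi' := int2_swap fi.
have := Fubini (int2_prodint fi) => /= H.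
have E g : int2 g -> ((\int[leb]_x \int[leb]_y g x y)%:E = \int[leb]_x \int[leb]_y (g x y)%:E)%E.
  move=> gi; have [mg _] := gi.
  rewrite Rint_EFin; last exact: int2_int.
  apply: ae_eq_integral => //.
  - by apply/measurable_EFinP; exact: (int1_meas (int2_int gi)).
  - have -> : (fun x => \int[leb]_y (g x y)%:E)%E =
      (fun x => \int[leb]_y ((fun z : R * R => (g z.1 z.2)%:E) (x, y)))%E by [].
    exact: measurable_fubini_F (int2_prodint gi).
  - by have := int2_ae gi; apply: aeS => x gx _; rewrite Rint_EFin.
by apply: EFin_inj; rewrite E// E//.
Qed.

End Integrability.

(** * A product rule for primitives *)

Section Intervals.
Context {R : realType}.
Local Notation leb := (@lebesgue_measure R).

Lemma ae_neq (x0 : R) : {ae leb, forall x, x != x0}.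
Proof.
exists [set x0]; split; [exact: measurable_set1|exact: lebesgue_measure_set1|].
by move=> x /= /negP/negPn/eqP.
Qed.

Lemma int1_itv (a b : R) (f : R -> R) :
  int1 (fun s => if a <= s <= b then f s else 0) -> leb.-integrable `[a, b] (EFin \o f).
Proof. by move=> fi; apply/integrable_if. Qed.

Lemma int1_sub (a b c d : R) (f : R -> R) : a <= c -> d <= b ->
  int1 (fun s => if a <= s <= b then f s else 0) ->
  int1 (fun s => if c <= s <= d then f s else 0).
Proof.
move=> ac db fi.
have -> : (fun s => if c <= s <= d then f s else 0) =
    (fun s => if c <= s <= d then (if a <= s <= b then f s else 0) else 0).
  apply/funext => s; case: ifP => // /andP[cs sd].
  by rewrite (le_trans ac cs) (le_trans sd db).
by apply: (int1_cut (P := fun s => c <= s <= d)) => //; meas.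
Qed.

Lemma int1_Rint_split (a b c : R) (f : R -> R) : a <= b -> b <= c ->
  int1 (fun s => if a <= s <= c then f s else 0) ->
  \int[leb]_(s in `[a, c]) f s = \int[leb]_(s in `[a, b]) f s + \int[leb]_(s in `[b, c]) f s.
Proof. by move=> ab bc fi; apply: Rint_split => //; exact: int1_itv. Qed.

Lemma eq_int1 (f g : R -> R) : (forall x, f x = g x) -> int1 g -> int1 f.
Proof. by move=> fg; have -> : f = g by apply/funext. Qed.

Lemma eq_Rint (f g : R -> R) : (forall x, f x = g x) -> \int[leb]_x f x = \int[leb]_x g x.
Proof. by move=> fg; have -> : f = g by apply/funext. Qed.

Lemma Rint_eq0 (f : R -> R) : (forall x, f x = 0) -> \int[leb]_x f x = 0.
Proof. by move=> f0; rewrite (eq_Rint f0) Rint_0. Qed.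

(** Fubini on the triangle [a <= s <= r <= b], where [p s * q r] is dominated by an integrable
    product; this makes the cross terms of the product rule cancel. *)
Lemma triangle_swap (a b : R) (p q : R -> R) :
  int1 (fun s => if a <= s <= b then p s else 0) ->
  int1 (fun s => if a <= s <= b then q s else 0) ->
  \int[leb]_(s in `[a, b]) (p s * \int[leb]_(r in `[s, b]) q r) =
  \int[leb]_(r in `[a, b]) (q r * \int[leb]_(s in `[a, r]) p s).
Proof.
move=> pi qi.
pose P (s : R) : R := if a <= s <= b then p s else 0; pose Q (s : R) : R := if a <= s <= b then q s else 0.
have mP : measurable_fun setT P by exact: int1_meas.
have mQ : measurable_fun setT Q by exact: int1_meas.
pose k (s r : R) := if s <= r then P s * Q r else 0.
have mk : measurable2 R k by rewrite /k; meas.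
have k2 : int2 k.
  apply: int2_le (int2_prod pi qi) => // s r; rewrite /k; case: ifP => //.
  by rewrite normr0.
have /= := Fubini_R k2; set X := Rintegral _ _ _; set Y := Rintegral _ _ _ => XY.
transitivity X; [|transitivity Y; first by []].
- rewrite Rint_if; apply: eq_Rint => s; rewrite /k /P.
  case: ifP => [/andP[as_ sb]|_]; last first.
    by rewrite Rint_eq0// => r; case: ifP; rewrite ?mul0r.
  rewrite Rint_if -RintZ; last by apply: int1_sub qi.
  apply: eq_Rint => r; rewrite /Q; case: (leP s r) => sr /=; rewrite ?mulr0//.
  by rewrite (le_trans as_ sr)/=.
- rewrite Rint_if; apply: eq_Rint => r; rewrite /k /Q.
  case: ifP => [/andP[ar rb]|_]; last first.
    by rewrite Rint_eq0// => s; case: ifP; rewrite ?mulr0.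
  rewrite Rint_if -RintZ; last by apply: int1_sub pi.
  apply: eq_Rint => s; rewrite /P; case: (leP s r) => sr /=; rewrite ?andbT ?andbF ?mulr0//.
  by rewrite (le_trans sr rb) andbT mulrC; case: ifP; rewrite ?mulr0.
Qed.

Lemma Rint_bound (a b c d : R) (f : R -> R) : a <= c -> d <= b ->
  int1 (fun s => if a <= s <= b then f s else 0) ->
  `|\int[leb]_(s in `[c, d]) f s| <= \int[leb]_(s in `[a, b]) `|f s|.
Proof.
move=> ac db fi; have fi' := int1_sub ac db fi.
rewrite !Rint_if; apply: le_trans (le_Rint_norm fi') _.
apply: le_Rint; [exact: int1_norm| |].
  by apply: eq_int1 (int1_norm fi) => s; case: ifP; rewrite ?normr0.
move=> s; case: ifP => [/andP[cs sd]|_]; last by rewrite normr0; case: ifP.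
by rewrite (le_trans ac cs) (le_trans sd db).
Qed.

Section ProductRule.
Variables (a b P0 Q1 : R) (p q : R -> R).
Hypothesis ab : a <= b.
Hypothesis pi : int1 (fun s => if a <= s <= b then p s else 0).
Hypothesis qi : int1 (fun s => if a <= s <= b then q s else 0).
Let P s := P0 + \int[leb]_(r in `[a, s]) p r.
Let Q s := Q1 + \int[leb]_(r in `[s, b]) q r.

(** [P] has the derivative [p] and [Q] the derivative [- q] in the integrated sense only. Both sides
    are expanded bilinearly and compared by [triangle_swap]. [Q] is anchored at the right end
    because a kernel is known from its value at the end of its characteristic. *)
Lemma product_rule :
  P b * Q b - P a * Q a = \int[leb]_(s in `[a, b]) (p s * Q s - P s * q s).
Proof.
pose p' (s : R) : R := if a <= s <= b then p s else 0; pose q' (s : R) : R := if a <= s <= b then q s else 0.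
have mp : measurable_fun setT p' by exact: int1_meas.
have mq : measurable_fun setT q' by exact: int1_meas.
have p'E s : (if a <= s <= b then p' s else 0) = p' s by rewrite /p'; case: (_ && _).
have q'E s : (if a <= s <= b then q' s else 0) = q' s by rewrite /q'; case: (_ && _).
pose P' (s : R) : R := \int[leb]_(r in `[a, s]) p' r.
pose Q' (s : R) : R := \int[leb]_(r in `[s, b]) q' r.
have mP : measurable_fun setT P'.
  by apply: (@measurable_Rint_itv _ _ _ (fun _ r => p' r)); meas.
have mQ : measurable_fun setT Q'.
  by apply: (@measurable_Rint_itv _ _ _ (fun _ r => q' r)); meas.
have PE s : a <= s <= b -> P s = P0 + P' s.
  move=> /andP[as_ sb]; rewrite /P /P' !Rint_if; congr (_ + _); apply: eq_Rint => r.
  rewrite /p'; case: ifP => // /andP[-> rs] /=; by rewrite (le_trans rs sb).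
have QE s : a <= s <= b -> Q s = Q1 + Q' s.
  move=> /andP[as_ sb]; rewrite /Q /Q' !Rint_if; congr (_ + _); apply: eq_Rint => r.
  rewrite /q'; case: ifP => // /andP[sr ->] /=; by rewrite (le_trans as_ sr).
have pI s : int1 (fun r => if a <= r <= s then p' r else 0).
  by apply: (int1_cut (P := fun r => a <= r <= s)) => //; meas.
have qI s : int1 (fun r => if s <= r <= b then q' r else 0).
  by apply: (int1_cut (P := fun r => s <= r <= b)) => //; meas.
have Pb s : `|P' s| <= \int[leb]_r `|p' r|.
  rewrite /P' Rint_if; apply: le_trans (le_Rint_norm (pI s)) _.
  apply: le_Rint; [exact: int1_norm (pI s)|exact: int1_norm|].
  by move=> r; case: ifP; rewrite ?normr0.
have Qb s : `|Q' s| <= \int[leb]_r `|q' r|.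
  rewrite /Q' Rint_if; apply: le_trans (le_Rint_norm (qI s)) _.
  apply: le_Rint; [exact: int1_norm (qI s)|exact: int1_norm|].
  by move=> r; case: ifP; rewrite ?normr0.
have pQ : int1 (fun s => p' s * Q' s) by exact: int1_bounded Qb.
have qP : int1 (fun s => q' s * P' s) by exact: int1_bounded Pb.
have tri : \int[leb]_s (p' s * Q' s) = \int[leb]_s (q' s * P' s).
  transitivity (\int[leb]_(s in `[a, b]) (p' s * Q' s)).
    by rewrite Rint_if; apply: eq_Rint => s; rewrite /p'; case: (_ && _); rewrite ?mul0r.
  transitivity (\int[leb]_(s in `[a, b]) (q' s * P' s)).
    exact: (@triangle_swap a b p' q' (pI b) (qI a)).
  by rewrite Rint_if; apply: eq_Rint => s; rewrite /q'; case: (_ && _); rewrite ?mul0r.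
transitivity (\int[leb]_s ((Q1 * p' s + p' s * Q' s) - (P0 * q' s + q' s * P' s))); last first.
  rewrite Rint_if; apply: eq_Rint => s; rewrite /p' /q'; case: ifP => sab.
    by rewrite PE// QE//; ring.
  by rewrite !mul0r !mulr0 !addr0 subrr.
have Zp := int1Z Q1 pi; have Zq := int1Z P0 qi.
rewrite RintB; [|exact: int1D|exact: int1D].
rewrite !RintD// !RintZ// tri.
have Pb' : P b = P0 + \int[leb]_s p' s by rewrite PE ?ab ?lexx// /P' Rint_if; congr (_ + _); apply: eq_Rint => s; exact: p'E.
have Qa' : Q a = Q1 + \int[leb]_s q' s by rewrite QE ?ab ?lexx// /Q' Rint_if; congr (_ + _); apply: eq_Rint => s; exact: q'E.
have Pa' : P a = P0 by rewrite /P set_itv1 Rintegral_set1 addr0.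
have Qb' : Q b = Q1 by rewrite /Q set_itv1 Rintegral_set1 addr0.
by rewrite Pb' Qa' Pa' Qb'; ring.
Qed.

End ProductRule.

End Intervals.

(** * The Leibniz rule on a moving half-line *)

Section MovingDomain.
Context {R : realType}.
Local Notation leb := (@lebesgue_measure R).

Lemma Rint_opp (f : R -> R) : \int[leb]_x (- f x) = - \int[leb]_x f x.
Proof.
rewrite /Rintegral [in LHS]integralE [in RHS]integralE.
have -> : (fun x : measurableTypeR R => (- f x)%:E) = (fun x => - (f x)%:E)%E by [].
rewrite funeposN funenegN.
have := @integral_ge0 _ _ _ leb setT (fun x : measurableTypeR R => (f x)%:E)^\+%E (fun x _ => funepos_ge0 _ x).
have := @integral_ge0 _ _ _ leb setT (fun x : measurableTypeR R => (f x)%:E)^\-%E (fun x _ => funeneg_ge0 _ x).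
case: integral => [u||] // _; case: integral => [v||] //= _; rewrite ?oppr0 ?opprB//.
Qed.

Section IncreasingDomain.
Variables (a b k0 : R) (f g : R -> R -> R).
Hypothesis ab : a <= b.
Hypothesis mf : measurable2 R f.
Hypothesis gi : int2 (fun s y => if a <= s <= b then g s y else 0).
Hypothesis fb : int1 (f b).
Hypothesis fg : {ae leb, forall y, forall s1 s2, a <= s1 -> s1 <= s2 -> s2 <= b ->
  f s2 y - f s1 y = \int[leb]_(s in `[s1, s2]) g s y}.

(** Only the final slice is assumed integrable; the initial one differs from it, for almost every
    [y], by the integral of [g] over [[a, b]]. *)
Lemma int1_fa : int1 (f a).
Proof.
have [mg _] := gi.
apply: (int1_ae (g := fun y => f b y - \int[leb]_s (if a <= s <= b then g s y else 0))).
- by meas.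
- by move: fg; apply: aeS => y fgy; rewrite -Rint_if -(fgy a b)//; ring.
- by apply: int1B => //; exact: int2_int (int2_swap gi).
Qed.

(** A point [y] between [k a] and [k b] enters the half-line at the time [t] with [k t = y], and
    from then on [f] changes by the integral of [g]. The entry values [N], integrated over [y],
    become the flux term under the substitution [y = k s]. Integrability of [f] along the moving end
    is obtained, not assumed: almost everywhere [N] is a difference of integrable functions. *)
Lemma Leibniz_up (k1 : R) : 0 < k1 ->
  int1 (fun s => if a <= s <= b then f s (k0 + k1 * s) else 0) /\
  \int[leb]_y (if y <= k0 + k1 * b then f b y else 0) -
  \int[leb]_y (if y <= k0 + k1 * a then f a y else 0) =
  \int[leb]_s (if a <= s <= b then \int[leb]_y (if y <= k0 + k1 * s then g s y else 0) else 0) +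
  k1 * \int[leb]_s (if a <= s <= b then f s (k0 + k1 * s) else 0).
Proof.
move=> k1_gt0; have fa := int1_fa; have [mg _] := gi.
pose k (s : R) := k0 + k1 * s.
have mk : measurable_fun setT k by rewrite /k; meas.
have kle s t : (k s <= k t) = (s <= t) by rewrite /k lerD2l ler_pM2l.
pose gk (s y : R) : R := if y <= k s then (if a <= s <= b then g s y else 0) else 0.
have gk2 : int2 gk.
  apply: int2_le gi => [|s y]; first by rewrite /gk; meas.
  by rewrite /gk; case: ifP => // _; rewrite normr0.
pose m y := \int[leb]_s gk s y.
have mi : int1 m by exact: int2_int (int2_swap gk2).
pose N (y : R) : R := if k a <= y <= k b then f ((y - k0) / k1) y else 0.
have mN : measurable_fun setT N by rewrite /N; meas.
pose B (y : R) : R := if y <= k b then f b y else 0.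
pose A (y : R) : R := if y <= k a then f a y else 0.
have Bi : int1 B by apply: (int1_cut (P := fun y => y <= k b)) => //; meas.
have Ai : int1 A by apply: (int1_cut (P := fun y => y <= k a)) => //; meas.
pose u y := B y - A y - m y.
have ui : int1 u by apply: int1B => //; apply: int1B.
have Nu : {ae leb, forall y, N y = u y}.
  (* At [y = k a] the identity fails: the point belongs to the initial domain, so that [u] vanishes
     there, yet [N] counts it as entering. *)
  have := aeI fg (ae_neq (k a)); apply: aeS => y [fgy yka].
  rewrite /N /u /A /B /m.
  have [yb|yb] := leP y (k b); last first.
    rewrite andbF Rint_eq0; last first.
      move=> s; rewrite /gk; case: ifP => // ys; case: ifP => // /andP[_ sb].
      by have := lt_le_trans yb ys; rewrite ltNge kle sb.
    by rewrite leNgt (le_lt_trans _ yb) ?kle//= subr0 subrr.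
  have [ya|ya] := leP y (k a).
    rewrite andbT leNgt lt_neqAle yka ya /=.
    rewrite (_ : Rintegral _ _ _ = \int[leb]_(s in `[a, b]) g s y); last first.
      rewrite Rint_if; apply: eq_Rint => s; rewrite /gk.
      have [sab|] := boolP (a <= s <= b); last by case: ifP.
      by rewrite (le_trans ya)// kle; case/andP: sab.
    by rewrite -(fgy a b)//; ring.
  rewrite (ltW ya) /=; set t := (y - k0) / k1.
  have yE : y = k t by rewrite /k /t mulrC divfK ?gt_eqF//; ring.
  have at_ : a <= t by rewrite -kle -yE ltW.
  have tb : t <= b by rewrite -kle -yE.
  rewrite (_ : Rintegral _ _ _ = \int[leb]_(s in `[t, b]) g s y); last first.
    rewrite Rint_if; apply: eq_Rint => s; rewrite /gk.
    rewrite {1}yE kle; have [ts|ts] //= := leP t s.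
    by rewrite (le_trans at_ ts).
  by rewrite -(fgy t b)//; ring.
have Ni : int1 N by exact: int1_ae Nu ui.
have NE s : N (k1 * s + k0) = if a <= s <= b then f s (k0 + k1 * s) else 0.
  rewrite /N addrC -/(k s) !kle; case: ifP => // _; congr (f _ _).
  by rewrite /k addrAC subrr add0r mulrAC divff ?mul1r ?gt_eqF.
have Na := integral_affine k0 (lt0r_neq0 k1_gt0) Ni.
have Nai := int1_affine k0 (lt0r_neq0 k1_gt0) Ni.
split; first by apply: eq_int1 Nai => s; rewrite NE.
have -> : k1 * \int[leb]_s (if a <= s <= b then f s (k0 + k1 * s) else 0) = \int[leb]_y N y.
  rewrite (eq_Rint (g := fun s => N (k1 * s + k0))); last by move=> s; rewrite NE.
  by rewrite Na gtr0_norm// mulrA divff ?mul1r ?gt_eqF.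
rewrite -/(k b) -/(k a).
have -> : \int[leb]_s (if a <= s <= b then \int[leb]_y (if y <= k0 + k1 * s then g s y else 0) else 0) = \int[leb]_y m y.
  rewrite /m -Fubini_R//; apply: eq_Rint => s; rewrite /gk.
  case: (a <= s <= b) => //; rewrite Rint_eq0// => y; by case: ifP.
have u1 := ui; rewrite (Rint_ae mN (int1_meas u1) Nu) /u RintB//; last exact: int1B.
by rewrite RintB// /B /A; ring.
Qed.

Lemma Leibniz_0 :
  \int[leb]_y (if y <= k0 then f b y else 0) -
  \int[leb]_y (if y <= k0 then f a y else 0) =
  \int[leb]_s (if a <= s <= b then \int[leb]_y (if y <= k0 then g s y else 0) else 0).
Proof.
have fa := int1_fa; have [mg _] := gi.
pose gk (s y : R) : R := if y <= k0 then (if a <= s <= b then g s y else 0) else 0.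
have gk2 : int2 gk.
  apply: int2_le gi => [|s y]; first by rewrite /gk; meas.
  by rewrite /gk; case: ifP => // _; rewrite normr0.
have ci (h : R -> R) : int1 h -> int1 (fun y => if y <= k0 then h y else 0).
  by move=> hi; apply: (int1_cut (P := fun y => y <= k0)) => //; meas.
rewrite -RintB; [|exact: ci|exact: ci].
have -> : \int[leb]_s (if a <= s <= b then \int[leb]_y (if y <= k0 then g s y else 0) else 0) =
   \int[leb]_s \int[leb]_y gk s y.
  apply: eq_Rint => s; rewrite /gk.
  case: (a <= s <= b) => //; rewrite Rint_eq0// => y; by case: ifP.
rewrite Fubini_R//; apply: Rint_ae.
- by have := ci _ fb; have := ci _ fa => /int1_meas h1 /int1_meas h2; meas.
- exact: (int1_meas (int2_int (int2_swap gk2))).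
- move: fg; apply: aeS => y fgy; rewrite /gk; case: (y <= k0); last by rewrite subrr Rint_eq0.
  by rewrite (fgy a b)// Rint_if.
Qed.

End IncreasingDomain.

(** The factor [k1] stays inside the flux integrand: for [k1 = 0] nothing is known about [f] along
    the end, while the product is simply 0. *)
Lemma Leibniz (a b k0 k1 : R) (f g : R -> R -> R) : a <= b ->
  measurable2 R f ->
  int2 (fun s y => if a <= s <= b then g s y else 0) -> int1 (f b) ->
  {ae leb, forall y, forall s1 s2, a <= s1 -> s1 <= s2 -> s2 <= b ->
    f s2 y - f s1 y = \int[leb]_(s in `[s1, s2]) g s y} ->
  int1 (fun s => k1 * (if a <= s <= b then f s (k0 + k1 * s) else 0)) /\
  \int[leb]_y (if y <= k0 + k1 * b then f b y else 0) -
  \int[leb]_y (if y <= k0 + k1 * a then f a y else 0) =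
  \int[leb]_s (if a <= s <= b then \int[leb]_y (if y <= k0 + k1 * s then g s y else 0) else 0) +
  \int[leb]_s (k1 * (if a <= s <= b then f s (k0 + k1 * s) else 0)).
Proof.
move=> ab mf gi fb fg.
have [k1_lt0|k1_gt0|k1_0] := ltgtP k1 0; last first.
- rewrite k1_0; split.
    by apply: eq_int1 int1_0 => s; rewrite mul0r.
  rewrite [X in _ = _ + X]Rint_eq0; last by move=> s; rewrite mul0r.
  rewrite addr0 !mul0r addr0; rewrite (Leibniz_0 k0 ab mf gi fb fg).
  by apply: eq_Rint => s; rewrite mul0r addr0.
- have [Ii E] := Leibniz_up k0 ab mf gi fb fg k1_gt0.
  by split; [exact: int1Z|rewrite E RintZ].
(* k1 < 0: reverse the time *)
pose f' s := f (- s); pose g' s y := - g (- s) y.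
pose G0 (s y : R) : R := if a <= s <= b then g s y else 0.
have mG : measurable2 R G0 by have [] := gi.
have N10 : (- 1 : R) != 0 by rewrite oppr_eq0 oner_neq0.
have RintN (h : R -> R) : int1 h -> \int[leb]_s h (- s) = \int[leb]_s h s.
  move=> hi; have := integral_affine 0 N10 hi.
  rewrite normrN1 invr1 mul1r => <-; by apply: eq_Rint => s; rewrite mulN1r addr0.
have int1N' (h : R -> R) : int1 h -> int1 (fun s => h (- s)).
  move=> hi; have := int1_affine 0 N10 hi.
  by apply: eq_int1 => s; rewrite mulN1r addr0.
have abN s : (- b <= s <= - a) = (a <= - s <= b) by apply/idP/idP; lra.
have ab' : - b <= - a by rewrite lerN2.
have mf' : measurable2 R f' by rewrite /f'; meas.
have gi' : int2 (fun s y => if - b <= s <= - a then g' s y else 0).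
  apply: int2_swap.
  have [_ gf] := int2_swap gi.
  split.
    have -> : (fun z : R * R => if - b <= z.2 <= - a then g' z.2 z.1 else 0) =
      (fun z : R * R => - G0 (- z.2) z.1).
      by apply/funext => z; rewrite abN /g' /G0; case: ifP; rewrite ?oppr0.
    by meas.
  apply: le_lt_trans gf; rewrite le_eqVlt; apply/orP; left; apply/eqP.
  apply: eq_integral => y _.
  have := @ge0_integral_affine R (-1) 0 (fun s => `|G0 s y|%:E) N10.
  rewrite normrN1 invr1 mul1e => <- //.
  - apply: eq_integral => s _; rewrite mulN1r addr0 abN /g' /G0; case: ifP => // _.
    by rewrite normrN.
  - by meas.
have fa := int1_fa ab mf gi fb fg.
have fb' : int1 (f' (- a)) by rewrite /f' opprK.
have fg' : {ae leb, forall y, forall s1 s2, - b <= s1 -> s1 <= s2 -> s2 <= - a ->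
    f' s2 y - f' s1 y = \int[leb]_(s in `[s1, s2]) g' s y}.
  have := aeI fg (int2_ae (int2_swap gi)); apply: aeS => y [fgy gy] s1 s2 h1 h2 h3.
  have := fgy (- s2) (- s1); rewrite lerN2 -/(f' s1) -/(f' s2) => H.
  rewrite -opprB H//; [|lra|lra].
  rewrite !Rint_if -RintN; last by apply: (@int1_sub _ a b _ _ (fun s => g s y) _ _ gy); lra.
  rewrite -Rint_opp.
  apply: eq_Rint => s.
  have -> : (- s2 <= - s <= - s1) = (s1 <= s <= s2) by apply/idP/idP; lra.
  by case: ifP => _; rewrite ?oppr0.
have k1N : 0 < - k1 by rewrite oppr_gt0.
have [Ii E] := Leibniz_up k0 ab' mf' gi' fb' fg' k1N.
have Ii' : int1 (fun s => if a <= s <= b then f s (k0 + k1 * s) else 0).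
  by have := int1N' _ Ii; apply: eq_int1 => s; rewrite abN /f' opprK mulrNN.
split; first exact: int1Z.
move: E; rewrite /f' !opprK !mulrNN RintZ// => E.
rewrite -opprB E opprD mulNr opprK; congr (_ + k1 * _); last first.
  by rewrite -(RintN _ Ii'); apply: eq_Rint => s; rewrite abN mulrN mulNr.
pose Gs (s : R) : R := if a <= s <= b then \int[leb]_y (if y <= k0 + k1 * s then g s y else 0) else 0.
have gk2 : int2 (fun s y => if y <= k0 + k1 * s then G0 s y else 0).
  by apply: int2_le gi => [|s y]; [meas|case: ifP => // _; rewrite normr0].
have Gi : int1 Gs.
  have := int2_int gk2; apply: eq_int1 => s; rewrite /Gs /G0; case: (a <= s <= b) => //.
  by rewrite Rint_eq0// => y; case: ifP.
rewrite -/Gs -(RintN _ Gi) -Rint_opp; apply: eq_Rint => s; rewrite /Gs abN.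
case: (a <= - s <= b); last by rewrite oppr0.
rewrite -Rint_opp; apply: eq_Rint => y; rewrite mulrN mulNr /g'.
by case: ifP => _; rewrite ?oppr0 ?opprK.
Qed.

End MovingDomain.

(** * Transport along characteristics *)

Section Trapezoid.
Context {R : realType}.
Local Notation leb := (@lebesgue_measure R).

Lemma int2P (f : R -> R -> R) : int2 f <->
  (leb \x leb)%E.-integrable setT (fun z : R * R => (f z.1 z.2)%:E).
Proof.
split => [[mf fi]|fi].
  by apply/(@integrable12ltyP _ _ _ _ _ leb leb (fun z => (f z.1 z.2)%:E)); first meas.
have mf : measurable2 R f.
  by apply/measurable_EFinP; exact: measurable_int fi.
split => //; move/(@integrable12ltyP _ _ _ _ _ leb leb (fun z => (f z.1 z.2)%:E)) : fi.
by apply; apply/measurable_EFinP.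
Qed.

Lemma int2D (f g : R -> R -> R) : int2 f -> int2 g -> int2 (fun x y => f x y + g x y).
Proof. by move=> /int2P fi /int2P gi; apply/int2P; exact: (integrableD _ fi gi). Qed.

Lemma int2Z k (f : R -> R -> R) : int2 f -> int2 (fun x y => k * f x y).
Proof. by move=> /int2P fi; apply/int2P; exact: (integrableZl _ k fi). Qed.

Lemma int2_norm (f : R -> R -> R) : int2 f -> int2 (fun x y => `|f x y|).
Proof.
move=> fi; have [mf _] := fi.
by apply: int2_le fi; [meas|move=> x y; rewrite normr_id].
Qed.

Lemma eq_int2 (f g : R -> R -> R) : (forall x y, f x y = g x y) -> int2 g -> int2 f.
Proof. by move=> fg; have -> : f = g by apply/funext => x; apply/funext. Qed.

Lemma int2_le_ae (f g : R -> R -> R) : measurable2 R f ->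
  {ae leb, forall x, forall y, `|f x y| <= `|g x y|} -> int2 g -> int2 f.
Proof.
move=> mf fg [mg gi]; split; first exact: mf.
apply: le_lt_trans gi.
apply: ae_ge0_le_integral => //.
- by move=> x _; exact: integral_ge0.
- by apply: measurable_int_l => //; meas.
- by move=> x _; exact: integral_ge0.
- by apply: measurable_int_l => //; meas.
- move: fg; apply: aeS => x fgx _; apply: ge0_le_integral => //; [by meas|by meas|].
  by move=> y _; rewrite lee_fin.
Qed.

Lemma int2_shear (c : R) (f : R -> R -> R) : int2 f -> int2 (fun s y => f s (y + c * s)).
Proof.
move=> [mf fi]; split; first by meas.
apply: le_lt_trans fi; rewrite le_eqVlt; apply/orP; left; apply/eqP.
apply: eq_integral => s _.
have := @ge0_integral_affine R 1 (c * s) (fun y => `|f s y|%:E) (oner_neq0 _).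
rewrite normr1 invr1 mul1e => <- //; last by meas.
by apply: eq_integral => y _; rewrite mul1r.
Qed.

(** The mild solution of [w_s + c w_x = S] on the whole line with initial value [base], defined at
    every point. *)
Definition transport (c : R) (base : R -> R) (S : R -> R -> R) (s x : R) : R :=
  base (x - c * s) + \int[leb]_(r in `[0, s]) S r (x - c * (s - r)).

(** The mild solution of [w_s + c w_x = - P] prescribed at the final time [e]. The final value [B]
    is indexed by the label [x - c * s] of the characteristic, not by the position at time [e]. *)
Definition backward (c e : R) (B : R -> R) (P : R -> R -> R) (s x : R) : R :=
  B (x - c * s) + \int[leb]_(r in `[s, e]) P r (x + c * (r - s)).

Lemma transport_shift c base S s y :
  transport c base S s (y + c * s) = base y + \int[leb]_(r in `[0, s]) S r (y + c * r).
Proof.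
rewrite /transport addrK; congr (_ + _); apply: eq_Rintegral => r _; congr (S _ _); ring.
Qed.

Lemma backward_shift c e B P s y :
  backward c e B P s (y + c * s) = B y + \int[leb]_(r in `[s, e]) P r (y + c * r).
Proof.
rewrite /backward addrK; congr (_ + _); apply: eq_Rintegral => r _; congr (P _ _); ring.
Qed.

Lemma measurable_transport c base S : measurable_fun setT base ->
  measurable2 R S ->
  measurable2 R (transport c base S).
Proof.
move=> mb mS; rewrite /transport; apply: measurable_funD; first by meas.
apply: (@measurable_Rint_itv _ _ _ (fun (z : R * R) r => S r (z.2 - c * (z.1 - r)))); [|by meas|by meas].
refine (measurableT_comp mS (g := fun t : (R * R) * R => (t.2, t.1.2 - c * (t.1.1 - t.2))) _).
have m1 : measurable_fun setT (fun t : (R * R) * R => t.1.1) by apply: measurableT_comp.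
have m2 : measurable_fun setT (fun t : (R * R) * R => t.1.2) by apply: measurableT_comp.
by meas.
Qed.

Lemma measurable_backward c e B P : measurable_fun setT B ->
  measurable2 R P ->
  measurable2 R (backward c e B P).
Proof.
move=> mb mP; rewrite /backward; apply: measurable_funD; first by meas.
apply: (@measurable_Rint_itv _ _ _ (fun (z : R * R) r => P r (z.2 + c * (r - z.1)))); [|by meas|by meas].
refine (measurableT_comp mP (g := fun t : (R * R) * R => (t.2, t.1.2 + c * (t.2 - t.1.1))) _).
have m1 : measurable_fun setT (fun t : (R * R) * R => t.1.1) by apply: measurableT_comp.
have m2 : measurable_fun setT (fun t : (R * R) * R => t.1.2) by apply: measurableT_comp.
by meas.
Qed.

Lemma Rint_le_cst (a b M : R) (f : R -> R) : a <= b -> measurable_fun setT f ->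
  (forall x, `|f x| <= M) -> `|\int[leb]_(x in `[a, b]) f x| <= (b - a) * M.
Proof.
move=> ab mf fM.
have cI : int1 (fun s => if a <= s <= b then M else 0) by exact: int1_cst.
have fi : int1 (fun s => if a <= s <= b then f s else 0).
  apply: int1_le cI; first by meas.
  by move=> x; case: ifP => // _; rewrite (le_trans (fM x)) ?ler_norm.
rewrite Rint_if; apply: le_trans (le_Rint_norm fi) _.
have -> : (b - a) * M = \int[leb]_x (if a <= x <= b then M else 0).
  by rewrite -(@Rint_if _ a b (fun=> M)) Rintegral_cst//= lebesgue_itvcc//= mulrC.
apply: le_Rint => //; first exact: int1_norm.
by move=> x; case: ifP; rewrite ?normr0.
Qed.

(** An integral over [[0, gs]] becomes a difference over two half-lines in the coordinate
    [y = x - c * s], so that [Leibniz] can be applied to each end separately. The half-lines lose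
    the point [x = 0], a null set. *)
Lemma Rint_strip (c s gs : R) (h : R -> R) : 0 <= gs -> int1 h ->
  \int[leb]_y (if y <= gs - c * s then h y else 0) - \int[leb]_y (if y <= - c * s then h y else 0) =
  \int[leb]_(x in `[0, gs]) h (x - c * s).
Proof.
move=> gs0 hi; have mh := int1_meas hi.
rewrite -RintB; last 2 first.
- by apply: (int1_cut (P := fun y => y <= gs - c * s)) => //; meas.
- by apply: (int1_cut (P := fun y => y <= - c * s)) => //; meas.
pose H (y : R) : R := if - c * s < y <= gs - c * s then h y else 0.
have Hi : int1 H by apply: (int1_cut (P := fun y => - c * s < y <= gs - c * s)) => //; meas.
transitivity (\int[leb]_y H y).
  apply: eq_Rint => y; rewrite /H; case: (leP y (gs - c * s)) => h1; case: (leP y (- c * s)) => h2 /=; rewrite ?subrr ?subr0//.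
  lra.
have := integral_affine (- c * s) (oner_neq0 R) Hi; rewrite normr1 invr1 mul1r => <-.
rewrite Rint_if; apply: Rint_ae; [by meas|by meas|].
have := ae_neq (0 : R); apply: aeS => x x0; rewrite /H mul1r mulNr.
by rewrite ltrBrDr addNr lerD2r lt_neqAle eq_sym x0.
Qed.

Lemma sub_sub_add (x1 x2 x3 x4 y1 y2 y3 y4 : R) : x1 - x3 = y1 + y3 -> x2 - x4 = y2 + y4 ->
  x1 - x2 - (x3 - x4) = y1 - y2 + y3 - y4.
Proof. lra. Qed.

Section Pairing.
Variables (c a b e mu g0 M MP : R).
Variables (base B : R -> R) (S P : R -> R -> R).
Hypothesis a0 : 0 <= a.
Hypothesis ab : a <= b.
Hypothesis be : b <= e.
Let gam s := g0 - mu * s.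
Hypothesis ga : 0 <= gam a.
Hypothesis gb : 0 <= gam b.
Hypothesis basei : int1 base.
Hypothesis mS : measurable2 R S.
Hypothesis Si : int2 (fun s x => if 0 <= s <= b then S s x else 0).
Hypothesis mB : measurable_fun setT B.
Hypothesis BM : forall y, `|B y| <= M.
Hypothesis mP : measurable2 R P.
Hypothesis PM : forall s x, `|P s x| <= MP.
Let w := transport c base S.
Let kap := backward c e B P.

Let X (s : R) : R := if a <= s <= b then
    \int[leb]_(x in `[0, gam s]) (S s x * kap s x - w s x * P s x)
    - (mu + c) * (w s (gam s) * kap s (gam s)) + c * (w s 0 * kap s 0) else 0.

(* w and kap are transported with the same speed, so the integral of w * kap over
   [0, gam s] changes only through the two sources and through the fluxes at the moving
   end gam s and at the end 0. *)
Lemma trapezoid : int1 X /\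
  \int[leb]_(x in `[0, gam b]) (w b x * kap b x) - \int[leb]_(x in `[0, gam a]) (w a x * kap a x) =
  \int[leb]_s X s.
Proof.
have mbase := int1_meas basei.
pose sg (s y : R) : R := S s (y + c * s).
pose rh (s y : R) : R := P s (y + c * s).
have msg : measurable2 R sg by rewrite /sg; meas.
have mrh : measurable2 R rh by rewrite /rh; meas.
pose W (s y : R) : R := base y + \int[leb]_(r in `[0, s]) sg r y.
pose Q (s y : R) : R := B y + \int[leb]_(r in `[s, e]) rh r y.
have WE s y : w s (y + c * s) = W s y by exact: transport_shift.
have QE s y : kap s (y + c * s) = Q s y by exact: backward_shift.
have mw : measurable2 R w by exact: measurable_transport.
have mk : measurable2 R kap by exact: measurable_backward.
have mW : measurable2 R W.
  have -> : (fun z : R * R => W z.1 z.2) = (fun z => w z.1 (z.2 + c * z.1)) by apply/funext => z; rewrite WE.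
  by meas.
have mQ : measurable2 R Q.
  have -> : (fun z : R * R => Q z.1 z.2) = (fun z => kap z.1 (z.2 + c * z.1)) by apply/funext => z; rewrite QE.
  by meas.
have sgi : int2 (fun s y => if 0 <= s <= b then sg s y else 0) by exact: (int2_shear c Si).
have b0 : 0 <= b by exact: le_trans ab.
have MP0 : 0 <= MP by exact: le_trans (PM 0 0).
have M0 : 0 <= M by exact: le_trans (BM 0).
pose MQ := M + e * MP.
have QM s y : 0 <= s -> s <= e -> `|Q s y| <= MQ.
  move=> s0 se; apply: le_trans (ler_normD _ _) _; apply: lerD => //.
  apply: le_trans (Rint_le_cst se _ (fun r => PM r (y + c * r))) _; first by meas.
  by apply: ler_wpM2r => //; rewrite lerBlDr lerDl.
(* A bound for [W s y] uniform in [s]: the datum plus the whole source on the characteristic [y]. It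
   dominates the term [W * rh] of [g]. *)
pose Wm (y : R) : R := `|base y| + \int[leb]_s `|if 0 <= s <= b then sg s y else 0|.
have Wmi : int1 Wm.
  apply: int1D; first exact: int1_norm.
  exact: int2_int (int2_norm (int2_swap sgi)).
have Wm0 y : 0 <= Wm y by rewrite addr_ge0// Rintegral_ge0.
(* On the exceptional characteristics the real-valued integral in [W] need not be a primitive of the
   source, so the product rule is available for almost every [y] only. *)
have good : {ae leb, forall y, int1 (fun s => if 0 <= s <= b then sg s y else 0)}.
  exact: int2_ae (int2_swap sgi).
have WM y s : int1 (fun s => if 0 <= s <= b then sg s y else 0) -> 0 <= s <= b -> `|W s y| <= Wm y.
  move=> gy /andP[s0 sb]; apply: le_trans (ler_normD _ _) _; apply: lerD => //.
  apply: le_trans (Rint_bound (lexx 0) sb gy) _; rewrite Rint_if.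
  rewrite le_eqVlt; apply/orP; left; apply/eqP; apply: eq_Rint => r.
  by case: ifP; rewrite ?normr0.
have Wi s : 0 <= s <= b -> int1 (W s).
  move=> sb; apply: int1D => //.
  have := int2_int (int2_swap (int2_le _ _ sgi)).
  move=> /(_ (fun r y => if 0 <= r <= s then sg r y else 0)) H.
  apply: (eq_int1 (g := fun y => \int[leb]_r (if 0 <= r <= s then sg r y else 0))).
    by move=> y; rewrite Rint_if.
  apply: H; first by meas.
  move=> r y; case: ifP => [/andP[-> rs]|_]; last by rewrite normr0.
  by case/andP: sb => _ sb; rewrite (le_trans rs sb).
pose f (s y : R) : R := W s y * Q s y.
pose g (s y : R) : R := sg s y * Q s y - W s y * rh s y.
have mf : measurable2 R f by rewrite /f; meas.
have mg : measurable2 R g by rewrite /g; meas.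
have fi s : 0 <= s <= b -> int1 (f s).
  move=> sb; apply: (int1_bounded (M := MQ)); first exact: Wi.
    by meas.
  move=> y; apply: QM; case/andP: sb => // _ sb; exact: le_trans sb be.
have ab01 s : a <= s <= b -> 0 <= s <= b by move=> /andP[as_ ->]; rewrite (le_trans a0 as_).
have gi0 : int2 (fun s y => if a <= s <= b then g s y else 0).
  apply: int2_swap.
  have H1 := int2_swap (int2Z MQ (int2_norm sgi)).
  have H2 := int2_prod Wmi (int1_cst a b MP).
  apply: int2_le_ae (int2D H1 H2); first by meas.
  move: good; apply: aeS => y gy s; case: ifP => [sab|_]; last by rewrite normr0.
  have /andP[s0 sb] := ab01 _ sab; rewrite s0 sb /=.
  rewrite [leRHS]ger0_norm ?addr_ge0 ?mulr_ge0//; last by rewrite (le_trans _ (QM 0 0 _ _))// (le_trans b0).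
  rewrite /g; apply: le_trans (ler_normB _ _) _; rewrite !normrM mulrC; apply: lerD.
    by apply: ler_wpM2r => //; apply: QM => //; exact: le_trans be.
  by apply: ler_pM => //; [apply: WM => //; rewrite s0|exact: PM].
have fg : {ae leb, forall y, forall s1 s2, a <= s1 -> s1 <= s2 -> s2 <= b ->
    f s2 y - f s1 y = \int[leb]_(s in `[s1, s2]) g s y}.
  move: good; apply: aeS => y gy s1 s2 h1 h2 h3.
  have s10 : 0 <= s1 by exact: le_trans h1.
  have s1b : s1 <= b by exact: le_trans h3.
  have s20 : 0 <= s2 by exact: le_trans h2.
  have s2e : s2 <= e by exact: le_trans be.
  have rI : int1 (fun s => if s1 <= s <= e then rh s y else 0).
    apply: (int1_le (g := fun s => if s1 <= s <= e then MP else 0)); last exact: int1_cst.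
      by meas.
    by move=> s; case: ifP => // _; rewrite (le_trans (PM _ _)) ?ler_norm.
  have PR := @product_rule R s1 s2 (W s1 y) (Q s2 y) (fun s => sg s y) (fun s => rh s y) h2
    (int1_sub s10 h3 gy) (int1_sub (lexx s1) s2e rI).
  have WE' s : s1 <= s <= s2 -> W s1 y + \int[leb]_(r in `[s1, s]) sg r y = W s y.
    move=> /andP[h4 h5]; rewrite /W -addrA -int1_Rint_split//.
    by apply: int1_sub gy => //; exact: le_trans h3.
  have QE' s : s1 <= s <= s2 -> Q s2 y + \int[leb]_(r in `[s, s2]) rh r y = Q s y.
    move=> /andP[h4 h5]; rewrite /Q -addrA [X in _ + X]addrC -int1_Rint_split//.
    by apply: int1_sub rI.
  have H1 : s1 <= s1 <= s2 by rewrite lexx h2.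
  have H2 : s1 <= s2 <= s2 by rewrite lexx h2.
  move: PR; rewrite (WE' s2 H2) (WE' s1 H1) (QE' s2 H2) (QE' s1 H1) => PR; rewrite /f PR.
  rewrite !Rint_if; apply: eq_Rint => s; case: ifP => // h4.
  by rewrite WE'// QE'.
have fbi : int1 (f b) by apply/fi/ab01; rewrite ab lexx.
have fai : int1 (f a) by apply/fi/ab01; rewrite ab lexx.
(* In the coordinate [y] the end [x = gam s] moves with the speed [- (mu + c)] and the end [x = 0]
   with the speed [- c]; these are the two flux coefficients. *)
have [topi topE] := Leibniz g0 (- (mu + c)) ab mf gi0 fbi fg.
have [boti botE] := Leibniz 0 (- c) ab mf gi0 fbi fg.
have fE s x : f s (x - c * s) = w s x * kap s x.
  by rewrite /f -WE -QE subrK.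
have gE s x : g s (x - c * s) = S s x * kap s x - w s x * P s x.
  by rewrite /g -WE -QE /sg /rh subrK.
have ktE s : g0 + - (mu + c) * s = gam s - c * s by rewrite /gam; ring.
have kbE s : 0 + - c * s = - c * s by rewrite add0r.
pose A (s : R) : R := if a <= s <= b then \int[leb]_y (if y <= g0 + - (mu + c) * s then g s y else 0) else 0.
pose D (s : R) : R := if a <= s <= b then \int[leb]_y (if y <= 0 + - c * s then g s y else 0) else 0.
have cutI k0 k1 : int1 (fun s => if a <= s <= b then \int[leb]_y (if y <= k0 + k1 * s then g s y else 0) else 0).
  have gk2 : int2 (fun s y => if y <= k0 + k1 * s then (if a <= s <= b then g s y else 0) else 0).
    by apply: int2_le gi0 => [|s y]; [meas|case: ifP => // _; rewrite normr0].
  have := int2_int gk2; apply: eq_int1 => s; case: (a <= s <= b) => //.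
  by rewrite Rint_eq0// => y; case: ifP.
have Ai : int1 A by exact: cutI.
have Di : int1 D by exact: cutI.
have gam0 s : a <= s <= b -> 0 <= gam s.
  move: ga gb; rewrite /gam => ga' gb' /andP[as_ sb].
  have [m0|/ltW m0] := leP 0 mu.
    by apply: le_trans gb' _; rewrite lerD2l lerN2 ler_wpM2l.
  by apply: le_trans ga' _; rewrite lerD2l lerN2 ler_wnM2l.
have mX : measurable_fun setT X.
  rewrite /X; apply: measurable_fun_ifT; [by meas| |exact: measurable_cst].
  apply: measurable_funD; last by meas.
  apply: measurable_funB; last by rewrite /gam; meas.
  apply: (@measurable_Rint_itv _ _ _ (fun s x => S s x * kap s x - w s x * P s x)); rewrite /gam; meas.
pose X' s := (A s - D s) + - (mu + c) * (if a <= s <= b then f s (g0 + - (mu + c) * s) else 0)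
   - - c * (if a <= s <= b then f s (0 + - c * s) else 0).
have X'i : int1 X' by apply: int1B => //; apply: int1D => //; exact: int1B.
have XX' : {ae leb, forall s, X s = X' s}.
  have := int2_ae gi0; apply: aeS => s gs; rewrite /X /X' /A /D.
  case: ifP gs => [sab gs|_ _]; last by rewrite !mulr0 !subr0 addr0.
  rewrite kbE ktE fE (_ : - c * s = 0 - c * s) ?sub0r ?mulNr// -[in f s _](sub0r (c * s)) fE.
  have := Rint_strip c s (gam0 _ sab) gs; rewrite mulNr => ->.
  have -> : \int[leb]_(x in `[0, gam s]) g s (x - c * s) = \int[leb]_(x in `[0, gam s]) (S s x * kap s x - w s x * P s x).
    by apply: eq_Rintegral => x _; rewrite gE.
  ring.
have Xi : int1 X by exact: int1_ae XX' X'i.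
split=> //.
rewrite (Rint_ae mX (int1_meas X'i) XX') /X' RintB//; last by apply: int1D => //; exact: int1B.
rewrite RintD//; last exact: int1B.
rewrite RintB//.
have /esym -> : \int[leb]_y (if y <= g0 + - (mu + c) * b then f b y else 0) -
    \int[leb]_y (if y <= 0 + - c * b then f b y else 0) = \int[leb]_(x in `[0, gam b]) (w b x * kap b x).
  rewrite ktE kbE (Rint_strip c b gb fbi).
  by apply: eq_Rintegral => x _; rewrite fE.
have /esym -> : \int[leb]_y (if y <= g0 + - (mu + c) * a then f a y else 0) -
    \int[leb]_y (if y <= 0 + - c * a then f a y else 0) = \int[leb]_(x in `[0, gam a]) (w a x * kap a x).
  rewrite ktE kbE (Rint_strip c a ga fai).
  by apply: eq_Rintegral => x _; rewrite fE.
rewrite -/A in topE; rewrite -/D in botE.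
exact: sub_sub_add topE botE.
Qed.

End Pairing.
End Trapezoid.

(** * The kernels *)

Section Kernels.
Context {R : realType} {n m : nat}.
Variables (lam : 'I_n -> R) (mu : 'I_m -> R).
Variables (Spp : 'M[R]_n) (Spm : 'M[R]_(n, m)) (Smp : 'M[R]_(m, n)) (Smm : 'M[R]_m).
Variables (Q0 : 'M[R]_(n, m)).
Variables (K : R -> R -> 'M[R]_(m, n)) (L : R -> R -> 'M[R]_m).
Local Notation leb := (@lebesgue_measure R).
Local Notation J := ('I_n + 'I_m)%type.

Definition speed (j : J) : R := match j with inl i => lam i | inr i => - mu i end.

Definition coupling (j k : J) : R :=
  match j, k with
  | inl i, inl k => Spp i k
  | inl i, inr k => Spm i k
  | inr i, inl k => Smp i k
  | inr i, inr k => Smm i k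
  end.

Definition in_triangle (x y : R) := (0 <= y <= x) && (x <= 1).

Definition kernel0 (i : 'I_m) (j : J) (x y : R) : R :=
  match j with inl k => K x y i k | inr k => L x y i k end.

(** The kernels are specified on the triangle only; extended by 0 they are measurable and bounded on
    the whole plane. *)
Definition kern (i : 'I_m) (j : J) (x y : R) : R :=
  if in_triangle x y then kernel0 i j x y else 0.

Definition omg (i p : 'I_m) (x : R) : R :=
  (mu i - mu p) * kern i (inr p) x x + Smm i p.

Definition kernel_rhs (i : 'I_m) (j : J) (x y : R) : R :=
  if in_triangle x y then
    \sum_(k : J) coupling k j * kern i k x y
    - \sum_(p < m | (i <= p)%N) kern p j x y * omg i p x
  else 0.

Hypothesis mu_pos : forall i, 0 < mu i.
Hypothesis lam_pos : forall i, 0 < lam i.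
Hypothesis mu_incr : forall i j : 'I_m, (i < j)%N -> mu i < mu j.
Hypothesis hKL : backstepping_kernels lam mu Spp Spm Smp Smm Q0 K L.

Lemma in_triangleP x y : in_triangle x y <-> triangle (x, y).
Proof. by rewrite /in_triangle /triangle /=; split => [/andP[]|[-> ->]]. Qed.

Lemma sum_J (F : J -> R) : \sum_(k : J) F k = \sum_(i < n) F (inl i) + \sum_(i < m) F (inr i).
Proof. by rewrite big_sumType. Qed.

Lemma diag_triangle x y : in_triangle x y -> in_triangle x x.
Proof. by rewrite /in_triangle lexx andbT => /andP[/andP[y0 yx] ->]; rewrite (le_trans y0 yx). Qed.

Lemma omgE x y i p : in_triangle x y -> omg i p x = omega mu Smm L i p x.
Proof. by move=> /diag_triangle xx; rewrite /omg /kern xx. Qed.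

Lemma kernel_rhsK i j x y : in_triangle x y ->
  kernel_rhs i (inl j) x y = K_rhs mu Spp Smp Smm K L i j x y.
Proof.
move=> xy; rewrite /kernel_rhs xy /K_rhs sum_J /kern xy /=; congr (_ - _).
by apply: eq_bigr => p _; rewrite (omgE _ _ xy).
Qed.

Lemma kernel_rhsL i j x y : in_triangle x y ->
  kernel_rhs i (inr j) x y = L_rhs mu Spm Smm K L i j x y.
Proof.
move=> xy; rewrite /kernel_rhs xy /L_rhs sum_J /kern xy /=; congr (_ - _); first exact: addrC.
by apply: eq_bigr => p _; rewrite (omgE _ _ xy).
Qed.

Lemma measurable_triangle : measurable (@triangle R).
Proof.
have -> : @triangle R = (fun z : R * R => in_triangle z.1 z.2) @^-1` [set true].
  by apply/seteqP; split => -[x y] /=; [move/in_triangleP|move=> h; apply/in_triangleP].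
have mt : measurable2 R in_triangle.
  by rewrite /in_triangle; meas.
by rewrite -[X in measurable X]setTI; exact: mt.
Qed.

Lemma measurable_kern i j : measurable2 R (kern i j).
Proof.
have [mK mL _ _ _] := hKL.
have -> : (fun z : R * R => kern i j z.1 z.2) = (fun z => kernel0 i j z.1 z.2) \_ (@triangle R).
  apply/funext => z; rewrite /kern patchE.
  have [zt|zt] := boolP (in_triangle z.1 z.2).
    by rewrite ifT// inE; case: z zt => x y /in_triangleP.
  by rewrite ifF//; apply/negP; rewrite inE => /in_triangleP; case: z zt => x y /= /negbTE ->.
apply/(measurable_restrictT _ measurable_triangle).
by case: j => j; [exact: mK|exact: mL].
Qed.

Lemma kernel_bounded : exists2 M : R, 0 <= M & forall i j x y, `|kern i j x y| <= M.
Proof.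
have [_ _ [M HM] _ _] := hKL; exists `|M| => // i j x y.
rewrite /kern; case: ifP => [/in_triangleP xy|_]; last by rewrite normr0.
have [HK HL] := HM _ _ xy; apply: le_trans (ler_norm M).
by case: j => j /=; [exact: HK|exact: HL].
Qed.

Lemma measurable_omg i p : measurable_fun setT (omg i p).
Proof.
have mk := measurable_kern; apply: measurable_funD; last exact: measurable_cst.
apply: measurable_funM; first exact: measurable_cst.
by refine (measurableT_comp (mk i (inr p)) (g := fun x => (x, x)) _); meas.
Qed.

Lemma omg_bounded : exists2 M : R, 0 <= M & forall i p x, `|omg i p x| <= M.
Proof.
have [M M0 HM] := kernel_bounded.
exists (\sum_(i < m) \sum_(p < m) (`|mu i - mu p| * M + `|Smm i p|)).
  by do 2 (apply: sumr_ge0 => ? _); rewrite addr_ge0// mulr_ge0.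
move=> i p x; rewrite /omg; apply: le_trans (ler_normD _ _) _.
apply: (@le_trans _ _ (`|mu i - mu p| * M + `|Smm i p|)).
  by rewrite lerD2r normrM ler_wpM2l.
have pos (k q : 'I_m) : 0 <= `|mu k - mu q| * M + `|Smm k q| by rewrite addr_ge0// mulr_ge0.
rewrite (bigD1 i)//= (bigD1 p)//= -addrA lerDl addr_ge0//; first exact: sumr_ge0.
by apply: sumr_ge0 => k _; exact: sumr_ge0.
Qed.

Lemma measurable_kern_rhs i j : measurable2 R (kernel_rhs i j).
Proof.
have mk := measurable_kern; have mo := measurable_omg.
apply: measurable_fun_ifT; [by rewrite /in_triangle; meas| |exact: measurable_cst].
apply: measurable_funB.
  by apply: measurable_sumr => k; apply: measurable_funM; [exact: measurable_cst|exact: mk].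
apply: measurable_sumr => p; apply: measurable_funM; first exact: mk.
exact: (measurableT_comp (mo i p) measurable_fst).
Qed.

Lemma kernel_rhs_bounded : exists2 M : R, 0 <= M & forall i j x y, `|kernel_rhs i j x y| <= M.
Proof.
have [M M0 HM] := kernel_bounded; have [N N0 HN] := omg_bounded.
exists (\sum_(j : J) (\sum_(k : J) `|coupling k j| * M) + \sum_(p < m) M * N).
  apply: addr_ge0; last by apply: sumr_ge0 => p _; rewrite mulr_ge0.
  by do 2 (apply: sumr_ge0 => ? _); rewrite mulr_ge0.
move=> i j x y; rewrite /kernel_rhs; case: ifP => _; last first.
  rewrite normr0; apply: addr_ge0; last by apply: sumr_ge0 => p _; rewrite mulr_ge0.
  by do 2 (apply: sumr_ge0 => ? _); rewrite mulr_ge0.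
apply: le_trans (ler_normB _ _) _; apply: lerD.
  apply: (@le_trans _ _ (\sum_(k : J) `|coupling k j| * M)).
    by apply: le_trans (ler_norm_sum _ _ _) _; apply: ler_sum => k _; rewrite normrM ler_wpM2l.
  rewrite [leRHS](bigD1 j)//= lerDl; apply: sumr_ge0 => k _; apply: sumr_ge0 => q _.
  by rewrite mulr_ge0.
apply: le_trans (ler_norm_sum _ _ _) _.
rewrite [leRHS](bigID (fun p : 'I_m => (i <= p)%N))/= ler_wpDr//.
  by apply: sumr_ge0 => p _; rewrite mulr_ge0.
by apply: ler_sum => p _; rewrite normrM ler_pM.
Qed.

(* In the frame x = g0 - mu i * s, kern i j is the backward transport of its boundary
   value with the speed of the j-th component. *)
Lemma char_integral (i : 'I_m) (j : J) (g0 s y d : R) :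
  let x := g0 - mu i * s in
  in_triangle x y ->
  (forall t, (0 <= t <= d) = (0 <= t) && in_triangle (x - mu i * t) (y + speed j * t)) ->
  \int[leb]_(t in `[0, d]) kernel_rhs i j (x - mu i * t) (y + speed j * t) =
  \int[leb]_(r in `[s, g0 / mu i]) kernel_rhs i j (g0 - mu i * r) (y + speed j * (r - s)).
Proof.
move=> x xy dT; have mr := measurable_kern_rhs i j.
have [M M0 HM] := kernel_rhs_bounded.
(* After [d] the characteristic has left the triangle, where [kernel_rhs] is 0. All characteristics
   can thus be followed up to the common time [g0 / mu i], at which the line reaches [x = 0]. *)
pose H (r : R) : R := if s <= r <= g0 / mu i then kernel_rhs i j (g0 - mu i * r) (y + speed j * (r - s)) else 0.
have Hi : int1 H.
  apply: (int1_le (g := fun r => if s <= r <= g0 / mu i then M else 0)); last exact: int1_cst.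
    by rewrite /H; meas.
  by move=> r; rewrite /H; case: ifP => // _; rewrite (le_trans (HM _ _ _ _)) ?ler_norm.
rewrite [RHS]Rint_if -/H.
have := integral_affine s (oner_neq0 R) Hi; rewrite normr1 invr1 mul1r => <-.
rewrite Rint_if; apply: eq_Rint => t.
have xt : g0 - mu i * (1 * t + s) = x - mu i * t by rewrite /x; ring.
have yt : y + speed j * (1 * t + s - s) = y + speed j * t by ring.
rewrite /H xt yt dT.
case: (leP 0 t) => t0 /=; last first.
  by rewrite ifF//; apply/negbTE; rewrite negb_and -ltNge; apply/orP; left; lra.
have [tT|tT] := boolP (in_triangle _ _); last by rewrite /kernel_rhs (negbTE tT); case: ifP.
rewrite ifT//; apply/andP; split; first by lra.
rewrite ler_pdivlMr//; move: tT; rewrite /in_triangle /x => /andP[/andP[h1 h2] _]; nra.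
Qed.

Lemma mu_le (i j : 'I_m) : (i <= j)%N -> mu i <= mu j.
Proof. by rewrite leq_eqVlt => /predU1P[/ord_inj->//|/mu_incr/ltW]. Qed.

Lemma kernelK_backward (i : 'I_m) (j : 'I_n) (g0 s y : R) : in_triangle (g0 - mu i * s) y ->
  kern i (inl j) (g0 - mu i * s) y =
  backward (lam j) (g0 / mu i) (fun=> - Smp i j / (mu i + lam j))
    (fun r => kernel_rhs i (inl j) (g0 - mu i * r)) s y.
Proof.
have [_ _ _ HK _] := hKL; set x := g0 - mu i * s => xy.
rewrite /kern xy /= HK; last exact/in_triangleP.
rewrite /K_char /backward; congr (_ + _).
have ml : 0 < mu i + lam j by rewrite addr_gt0.
have dT t : (0 <= t <= (x - y) / (mu i + lam j)) =
    (0 <= t) && in_triangle (x - mu i * t) (y + lam j * t).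
  case: (leP 0 t) => //= t0; rewrite ler_pdivlMr//.
  have h1 : 0 <= mu i * t by rewrite mulr_ge0// ltW.
  have h2 : 0 <= lam j * t by rewrite mulr_ge0// ltW.
  move: xy; rewrite /in_triangle => /andP[/andP[y0 yx] x1].
  rewrite mulrDr (mulrC t) (mulrC t).
  by apply/idP/idP => [h|/andP[/andP[_ h] _]]; [rewrite -andbA; apply/and3P; split|]; lra.
rewrite -(@char_integral i (inl j) g0 s y _ xy dT) !Rint_if; apply: eq_Rint => t.
case: ifP => //; rewrite dT => /andP[_ tT].
by rewrite -kernel_rhsK.
Qed.

(** [eta = y + mu j * s] labels the characteristic. The quantity [mu i * eta - mu j * g0] equals
    [mu i * y - mu j * x] all along it, hence the choice between the diagonal and the side depends
    on the label alone. An exit through the side takes place at the time [eta / mu j]. *)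
Definition boundaryL (i j : 'I_m) (g0 eta : R) : R :=
  if (j < i)%N && (0 <= mu i * eta - mu j * g0) then - Smm i j / (mu i - mu j)
  else (mu j)^-1 * \sum_(k < n) lam k * kern i (inl k) (g0 - mu i * (eta / mu j)) 0 * Q0 k j.

Lemma kernelL_backward (i j : 'I_m) (g0 s y : R) : in_triangle (g0 - mu i * s) y ->
  kern i (inr j) (g0 - mu i * s) y =
  backward (- mu j) (g0 / mu i) (boundaryL i j g0)
    (fun r => kernel_rhs i (inr j) (g0 - mu i * r)) s y.
Proof.
have [_ _ _ _ HL] := hKL; set x := g0 - mu i * s => xy.
rewrite /kern xy /= HL; last exact/in_triangleP.
have mi := mu_pos i; have mj := mu_pos j.
have xyE := xy; move: xyE; rewrite {1}/in_triangle => /andP[/andP[y0 yx] x1].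
rewrite /L_char /backward /boundaryL.
have -> : mu i * (y - - mu j * s) - mu j * g0 = mu i * y - mu j * x by rewrite /x; ring.
case: ifP => [/andP[ji h]|/negbT n1]; congr (_ + _).
- have mm : 0 < mu i - mu j by rewrite subr_gt0 mu_incr.
  have dT t : (0 <= t <= (x - y) / (mu i - mu j)) =
      (0 <= t) && in_triangle (x - mu i * t) (y + - mu j * t).
    case: (leP 0 t) => //= t0; rewrite ler_pdivlMr// mulNr.
    have h1 : 0 <= mu i * t by rewrite mulr_ge0// ltW.
    rewrite /in_triangle; apply/idP/idP => [h2|/andP[/andP[_ h2] _]].
      (* The test [0 <= mu i * y - mu j * x] says that the diagonal is reached no later than the
         side [y = 0]. *)
      have h3 : mu j * t <= y.
        rewrite -(ler_pM2r mm).
        have : mu j * (t * (mu i - mu j)) <= mu j * (x - y) by rewrite ler_wpM2l// ltW.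
        by move: h; lra.
      by rewrite -andbA; apply/and3P; split; move: h1 h2 h3 x1; lra.
    by move: h2; lra.
  rewrite -(@char_integral i (inr j) g0 s y _ xy dT) !Rint_if; apply: eq_Rint => t.
  case: ifP => //; rewrite dT => /andP[_ tT].
  by move: tT; rewrite [speed _]/= mulNr => tT; rewrite -(kernel_rhsL _ _ tT).
- congr (_ * _); apply: eq_bigr => k _; congr (_ * _ * _).
  have -> : g0 - mu i * ((y - - mu j * s) / mu j) = x - mu i * (y / mu j).
    by rewrite /x; field; rewrite gt_eqF.
  rewrite /kern ifT//= /in_triangle lexx/=.
  have h0 : 0 <= mu i * (y / mu j) by rewrite mulr_ge0 ?divr_ge0// ltW.
  apply/andP; split; last by move: x1 h0; lra.
  have -> : x - mu i * (y / mu j) = (mu j * x - mu i * y) / mu j by field; rewrite gt_eqF.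
  rewrite divr_ge0 ?(ltW mj)//; move: n1; rewrite negb_and -leqNgt -ltNge.
  case/orP => [/mu_le mij|h]; last by move: h; lra.
  have : mu i * y <= mu j * x by apply: ler_pM => //; exact: ltW.
  by lra.
- have dT t : (0 <= t <= y / mu j) =
      (0 <= t) && in_triangle (x - mu i * t) (y + - mu j * t).
    case: (leP 0 t) => //= t0; rewrite ler_pdivlMr// mulNr.
    have h1 : 0 <= mu i * t by rewrite mulr_ge0// ltW.
    rewrite /in_triangle; apply/idP/idP => [h2|/andP[/andP[h2 _] _]]; last by move: h2; lra.
    rewrite -andbA; apply/and3P; split; [by move: h2; lra| |by move: h1 x1; lra].
    (* The diagonal must not be crossed before [y = 0] is reached. If [mu i <= mu j] the gap [x - y]
       does not shrink; otherwise [mu i * y < mu j * x] limits its decrease up to the time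
       [y / mu j]. *)
    move: n1; rewrite negb_and -leqNgt -ltNge => /orP[/mu_le mij|h].
      have : mu i * t <= mu j * t by rewrite ler_wpM2r.
      by move: yx; lra.
    have [mij|mij] := leP (mu i) (mu j).
      have : mu i * t <= mu j * t by rewrite ler_wpM2r.
      by move: yx; lra.
    have : (mu i - mu j) * t <= x - y; last by lra.
    rewrite -(ler_pM2r mj).
    have : (mu i - mu j) * (t * mu j) <= (mu i - mu j) * y by rewrite ler_wpM2l// subr_ge0 ltW.
    by move: h; lra.
  rewrite -(@char_integral i (inr j) g0 s y _ xy dT) !Rint_if; apply: eq_Rint => t.
  case: ifP => //; rewrite dT => /andP[_ tT].
  by move: tT; rewrite [speed _]/= mulNr => tT; rewrite -(kernel_rhsL _ _ tT).
Qed.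

(** The form in which [trapezoid] takes its kernel, common to [K] and [L]: the boundary value [B]
    depends on the line [g0] and on the label of the characteristic, but not on the time. *)
Lemma kernel_backward (i : 'I_m) (j : J) (g0 : R) :
  exists B : R -> R, [/\ measurable_fun setT B, exists M, forall y, `|B y| <= M &
    forall s y, in_triangle (g0 - mu i * s) y ->
      kern i j (g0 - mu i * s) y =
      backward (speed j) (g0 / mu i) B (fun r => kernel_rhs i j (g0 - mu i * r)) s y].
Proof.
have [M M0 HM] := kernel_bounded; have mk := measurable_kern.
case: j => j.
  exists (fun=> - Smp i j / (mu i + lam j)); split; [exact: measurable_cst|by eexists|].
  by move=> s y; exact: kernelK_backward.
exists (boundaryL i j g0); split; last by move=> s y; exact: kernelL_backward.
  apply: measurable_fun_ifT; [by apply: measurable_and; meas|exact: measurable_cst|].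
  apply: measurable_funM; first exact: measurable_cst.
  apply: measurable_sumr => k; apply: measurable_funM; last exact: measurable_cst.
  apply: measurable_funM; first exact: measurable_cst.
  by refine (measurableT_comp (mk i (inl k)) (g := fun e : R => (g0 - mu i * (e / mu j), 0 : R)) _); meas.
exists (`|- Smm i j / (mu i - mu j)| + `|(mu j)^-1| * \sum_(k < n) `|lam k| * M * `|Q0 k j|).
move=> e; rewrite /boundaryL; case: ifP => _.
  by rewrite lerDl mulr_ge0// sumr_ge0// => k _; rewrite !mulr_ge0.
rewrite ler_wpDl// normrM ler_wpM2l// (le_trans (ler_norm_sum _ _ _))// ler_sum// => k _.
by rewrite !normrM ler_wpM2r// ler_wpM2l.
Qed.

(** The flux of [trapezoid] through its moving end, which runs along the diagonal. For [K], and for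
    [L] with [j < i], the prescribed value turns it into the coupling coefficient of [v_i]. For
    [i <= j] no value is prescribed, and the equation is the definition of [omg]. *)
Lemma kernel_diag (i : 'I_m) (j : J) (x : R) : 0 <= x <= 1 ->
  - (mu i + speed j) * kern i j x x =
  coupling (inr i) j - match j with inl _ => 0 | inr p => if (i <= p)%N then omg i p x else 0 end.
Proof.
move=> /andP[x0 x1]; have [_ _ _ HK HL] := hKL.
have xx : in_triangle x x by rewrite /in_triangle x0 lexx x1.
have mi := mu_pos i.
case: j => j /=.
  rewrite subr0 /kern xx /= HK; last exact/in_triangleP.
  rewrite /K_char subrr mul0r set_itv1 Rintegral_set1 addr0.
  by field; rewrite gt_eqF// addr_gt0.
case: ifP => [ij|/negbT]; first by rewrite /omg; ring.
rewrite -ltnNge => ji; rewrite subr0 /kern xx /= HL; last exact/in_triangleP.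
have mm : 0 < mu i - mu j by rewrite subr_gt0 mu_incr.
rewrite /L_char ji /= -mulrBl mulr_ge0 ?(ltW mm)// subrr mul0r set_itv1 Rintegral_set1 addr0.
by field; rewrite gt_eqF.
Qed.

(** The condition on [L] at [xi = 0] is dual to [u = Q0 v] with respect to the speeds: weighted by
    the kernels, the flux of [u] entering at [x = 0] balances the flux of [v] leaving there. *)
Lemma kernel_bottom (i : 'I_m) (x : R) (w : J -> R) : 0 < x <= 1 ->
  (forall k, w (inl k) = \sum_(p < m) Q0 k p * w (inr p)) ->
  \sum_(j : J) speed j * (w j * kern i j x 0) = 0.
Proof.
move=> /andP[x0 x1] wE; have [_ _ _ HK HL] := hKL.
have xx : in_triangle x 0 by rewrite /in_triangle lexx (ltW x0) x1.
have LE p : mu p * kern i (inr p) x 0 = \sum_(k < n) lam k * kern i (inl k) x 0 * Q0 k p.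
  have mp := mu_pos p.
  rewrite {1}/kern xx /= HL; last exact/in_triangleP.
  (* At the corner [x = 0] the test would hold for [p < i] and select the diagonal value, whence the
     assumption [0 < x]. *)
  rewrite /L_char ifF; last first.
    by apply/negbTE; rewrite negb_and mulr0 sub0r -ltNge oppr_lt0 mulr_gt0 ?orbT.
  rewrite mul0r set_itv1 Rintegral_set1 addr0 mulr0 subr0 mulrA mulfV ?gt_eqF// mul1r.
  by apply: eq_bigr => k _; rewrite /kern xx.
have -> : \sum_(j : J) speed j * (w j * kern i j x 0) =
    \sum_(p < m) w (inr p) * \sum_(k < n) lam k * kern i (inl k) x 0 * Q0 k p -
    \sum_(p < m) w (inr p) * (mu p * kern i (inr p) x 0).
  rewrite sum_J /= -sumrN; congr (_ + _); last by apply: eq_bigr => p _; ring.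
  under eq_bigr do rewrite wE mulr_suml mulr_sumr.
  rewrite exchange_big; apply: eq_bigr => p _; rewrite mulr_sumr.
  by apply: eq_bigr => k _; ring.
by apply/eqP; rewrite subr_eq0; apply/eqP; apply: eq_bigr => p _; rewrite LE.
Qed.

End Kernels.

(** * Growth of the energy *)

Section TransportL2.
Context {R : realType}.
Local Notation leb := (@lebesgue_measure R).

Lemma sqrD_le (x y : R) : (x + y) ^+ 2 <= 2 * x ^+ 2 + 2 * y ^+ 2.
Proof. by have := sqr_ge0 (x - y); lra. Qed.

Section Estimates.
Variables (c : R) (base : R -> R) (S : R -> R -> R).
Hypothesis mb : measurable_fun setT base.
Hypothesis mS : measurable2 R S.

Let mt : measurable2 R (transport c base S).
Proof. exact: measurable_transport. Qed.

Let h (t r x : R) : \bar R := (if (0 <= r <= t)%R then (S r x ^+ 2)%:E else 0)%E.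

Let h0 t r x : (0 <= h t r x)%E.
Proof. by rewrite /h; case: ifP => // _; rewrite lee_fin sqr_ge0. Qed.

Let mh t : measurable2 R (h t).
Proof. by rewrite /h; meas. Qed.

Let hE t : (\int[leb]_r \int[leb]_x h t r x = \int[leb]_(r in `[0%R, t]) \int[leb]_x (S r x ^+ 2)%:E)%E.
Proof.
rewrite int_if; apply: eq_integral => r _; rewrite /h; case: ifP => // _.
by rewrite integral0.
Qed.

(** Cauchy-Schwarz for the source along one characteristic. The common bound [t'] keeps the
    integrand [h t'] fixed when [t] is itself integrated over. *)
Let pointwise t t' x : 0 <= t -> t <= t' ->
  ((transport c base S t x ^+ 2)%:E <= (2 * base (x - c * t) ^+ 2)%:E +
    (2 * t')%:E * \int[leb]_r h t' r (x - c * (t - r))%R)%E.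
Proof.
move=> t0 tt'; have t'0 := le_trans t0 tt'; rewrite /transport.
apply: le_trans (_ : (2 * base (x - c * t)%R ^+ 2)%:E + 2%:E * ((\int[leb]_(r in `[0, t]) S r (x - c * (t - r))) ^+ 2)%:E <= _)%E.
  by rewrite -EFinM -EFinD lee_fin sqrD_le.
apply: leeD => //; rewrite [(2 * t')%:E]EFinM -muleA; apply: lee_wpmul2l; first by rewrite lee_fin.
apply: le_trans (Cauchy_Schwarz_itv t0 _) _; first by meas.
rewrite subr0; apply: lee_pmul => //.
- by apply: integral_ge0 => r _; rewrite lee_fin sqr_ge0.
- rewrite int_if; apply: ge0_le_integral => //.
  + by move=> r _; case: ifP => // _; rewrite lee_fin sqr_ge0.
  + by meas.
  + by have H := mh t'; meas.
  + move=> r _; rewrite /h; case: ifP => [/andP[r0 rt]|_]; last by case: ifP => // _; rewrite lee_fin sqr_ge0.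
    by rewrite r0 (le_trans rt tt').
Qed.

Lemma transport_L2_x (t : R) : 0 <= t ->
  (\int[leb]_(x in `[0%R, 1%R]) (transport c base S t x ^+ 2)%:E <=
   2%:E * \int[leb]_(x in `[0%R, 1%R]) (base (x - c * t) ^+ 2)%:E +
   (2 * t)%:E * \int[leb]_(r in `[0%R, t]) \int[leb]_x (S r x ^+ 2)%:E)%E.
Proof.
move=> t0; have mht := mh t.
have mI : measurable_fun setT (fun x : R => \int[leb]_r h t r (x - c * (t - r))%R)%E.
  by apply: (@measurable_int_l _ (fun x r : R => h t r (x - c * (t - r)))) => //; meas.
apply: le_trans (_ : \int[leb]_(x in `[0%R, 1%R]) ((2 * base (x - c * t)%R ^+ 2)%:E +
    (2 * t)%:E * \int[leb]_r h t r (x - c * (t - r))%R) <= _)%E.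
  apply: ge0_le_integral => //.
  - by move=> x _; rewrite lee_fin sqr_ge0.
  - by apply: measurable_funTS; meas.
  - by apply: measurable_funTS; meas.
  - by move=> x _; exact: pointwise.
rewrite ge0_integralD//; last 4 first.
- by move=> x _; rewrite lee_fin mulr_ge0// sqr_ge0.
- by apply: measurable_funTS; meas.
- by move=> x _; rewrite mule_ge0 ?lee_fin ?mulr_ge0// integral_ge0.
- by apply: measurable_funTS; meas.
apply: leeD.
  rewrite -ge0_integralZl//; last 2 first.
  - by apply: measurable_funTS; meas.
  - by move=> x _; rewrite lee_fin sqr_ge0.
rewrite ge0_integralZl//; last 3 first.
- exact: measurable_funTS.
- by move=> x _; exact: integral_ge0.
- by rewrite lee_fin mulr_ge0.
apply: lee_wpmul2l; first by rewrite lee_fin mulr_ge0.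
rewrite -hE -(sweep_x c t mht (h0 t)).
by apply: ge0_subset_integral => // x _; exact: integral_ge0.
Qed.

(** The trace at one position is square integrable in time although a position is a null set: as the
    time varies, the characteristics through [x] sweep space-time ([sweep_t]), provided that
    [c != 0]. *)
Lemma transport_L2_t (x t : R) : c != 0 -> 0 <= t ->
  (\int[leb]_(s in `[0%R, t]) (transport c base S s x ^+ 2)%:E <=
   2%:E * \int[leb]_(s in `[0%R, t]) (base (x - c * s) ^+ 2)%:E +
   (2 * t * `|c|^-1)%:E * \int[leb]_(r in `[0%R, t]) \int[leb]_x (S r x ^+ 2)%:E)%E.
Proof.
move=> c0 t0; have mht := mh t.
have mI : measurable_fun setT (fun s : R => \int[leb]_r h t r (x - c * (s - r))%R)%E.
  by apply: (@measurable_int_l _ (fun s r : R => h t r (x - c * (s - r)))) => //; meas.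
apply: le_trans (_ : \int[leb]_(s in `[0%R, t]) ((2 * base (x - c * s)%R ^+ 2)%:E +
    (2 * t)%:E * \int[leb]_r h t r (x - c * (s - r))%R) <= _)%E.
  apply: ge0_le_integral => //.
  - by move=> s _; rewrite lee_fin sqr_ge0.
  - by apply: measurable_funTS; meas.
  - by apply: measurable_funTS; meas.
  - by move=> s; rewrite /= in_itv/= => /andP[s0 st]; exact: pointwise.
rewrite ge0_integralD//; last 4 first.
- by move=> s _; rewrite lee_fin mulr_ge0// sqr_ge0.
- by apply: measurable_funTS; meas.
- by move=> s _; rewrite mule_ge0 ?lee_fin ?mulr_ge0// integral_ge0.
- by apply: measurable_funTS; meas.
apply: leeD.
  rewrite -ge0_integralZl//; last 2 first.
  - by apply: measurable_funTS; meas.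
  - by move=> s _; rewrite lee_fin sqr_ge0.
rewrite ge0_integralZl//; last 3 first.
- exact: measurable_funTS.
- by move=> s _; exact: integral_ge0.
- by rewrite lee_fin mulr_ge0.
rewrite [(2 * t * _)%:E]EFinM -muleA; apply: lee_wpmul2l; first by rewrite lee_fin mulr_ge0.
rewrite -hE -(sweep_t x c0 mht (h0 t)).
by apply: ge0_subset_integral => // s _; exact: integral_ge0.
Qed.

End Estimates.

Lemma sum_sqr_le (I : finType) (a : I -> R) :
  (\sum_i a i) ^+ 2 <= #|I|%:R * \sum_i a i ^+ 2.
Proof.
rewrite expr2 mulr_suml.
apply: (@le_trans _ _ (\sum_i \sum_j (a i ^+ 2 / 2 + a j ^+ 2 / 2))).
  apply: ler_sum => i _; rewrite mulr_sumr; apply: ler_sum => j _.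
  by have := sqr_ge0 (a i - a j); lra.
under eq_bigr do rewrite big_split/= sumr_const.
rewrite big_split/= sumr_const sumrMnl -mulr_suml.
by rewrite -(mulr_natl (_ / 2)); lra.
Qed.

End TransportL2.

(** * The energy of the coupled system *)

Section Energy.
Context {R : realType} {n m : nat}.
Local Notation leb := (@lebesgue_measure R).
Local Notation J := ('I_n + 'I_m)%type.
Variables (lam : 'I_n -> R) (mu : 'I_m -> R) (A : J -> J -> R).
Variables (G1 : 'I_m -> J -> R -> R) (Q0 : 'M[R]_(n, m)) (T : R).
Variables (z : J -> R -> R -> R) (z0 : J -> R -> R).

Definition source (j : J) (t x : R) : R := \sum_(k : J) A j k * z k t x.

(** With [G1] the kernels at [x = 1] this is [v_i(t, 1)] in closed loop: the feedback cancels the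
    reflection [R1 u] and leaves an integral of the interior state. *)
Definition inflow1 (i : 'I_m) (t : R) : R := \int[leb]_(x in `[0, 1]) \sum_(k : J) G1 i k x * z k t x.

Definition inflow0 (i : 'I_n) (t : R) : R := \sum_(p < m) Q0 i p * z (inr p) t 0.

(* The inflow of time te through a side of [0,1] is carried backwards in time along its
   characteristic, out of [0,1], down to time 0. Each component is then a free transport
   on the whole line, whatever side its characteristics leave through. *)
Definition datum (j : J) (y : R) : R :=
  match j with
  | inl i => if 0 <= y <= 1 then z0 (inl i) y
             else if - lam i * T <= y < 0 then inflow0 i (- y / lam i) else 0
  | inr i => if 0 <= y <= 1 then z0 (inr i) y
             else if 1 < y <= 1 + mu i * T then inflow1 i ((y - 1) / mu i) else 0
  end.

Definition char_value (j : J) : R -> R -> R := transport (speed lam mu j) (datum j) (source j).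

Definition energy (t : R) : \bar R := (\int[leb]_x (\sum_(j : J) z j t x ^+ 2)%:E)%E.
Definition energy0 : \bar R := (\int[leb]_x (\sum_(j : J) z0 j x ^+ 2)%:E)%E.

Hypothesis mu_pos : forall i, 0 < mu i.
Hypothesis lam_pos : forall i, 0 < lam i.
Hypothesis T0 : 0 <= T.
Hypothesis mz : forall j, measurable2 R (z j).
Hypothesis mz0 : forall j, measurable_fun setT (z0 j).
Hypothesis mG : forall i j, measurable_fun setT (G1 i j).
Variables (a g qb : R).
Hypothesis Aa : forall j k, `|A j k| <= a.
Hypothesis Gg : forall i j x, `|G1 i j x| <= g.
Hypothesis Qq : forall i j, `|Q0 i j| <= qb.
Hypothesis z_zt : forall j t, 0 <= t <= T ->
  {ae leb, forall x, 0 <= x <= 1 -> z j t x = char_value j t x}.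
Hypothesis z_zt0 : forall i, {ae leb, forall t, 0 <= t <= T -> z (inr i) t 0 = char_value (inr i) t 0}.
Hypothesis z_out : forall j t x, ~~ (0 <= x <= 1) -> z j t x = 0.

Let I (t : R) : \bar R := (\int[leb]_(s in `[0%R, t]) energy s)%E.
Let Y (t : R) : \bar R := (energy0 + I t)%E.

(** Every bound is a multiple of [Y t], the initial energy plus the energy accumulated until [t].
    The constants follow an order that avoids circularity: the inflow of [v] at [x = 1] is
    controlled by the energy ([CG], [BR]), it controls the trace of [v] at [x = 0] ([FR]), this
    controls the inflow of [u] ([QI], [BL]), and the components come last ([ER]). None depends on
    the solution, so that the stability constant is uniform. *)
Let NJ : R := #|{: J}|%:R.
Let CA := NJ * a ^+ 2.
Let CG := NJ * g ^+ 2.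
Let CQ := m%:R * qb ^+ 2.
Let BR i := 1 + mu i * CG.
Let FR i := 2 * ((mu i)^-1 * BR i) + 2 * T * (mu i)^-1 * CA.
Let QI := CQ * \sum_(i < m) FR i.
Let BL i := 1 + lam i * QI.
Let ER (j : J) := 2 * (match j with inl i => BL i | inr i => BR i end) + 2 * T * CA.
Definition energy_const : R := \sum_(j : J) ER j.

Let CA0 : 0 <= CA. Proof. by rewrite mulr_ge0 ?ler0n// sqr_ge0. Qed.
Let CG0 : 0 <= CG. Proof. by rewrite mulr_ge0 ?ler0n// sqr_ge0. Qed.
Let CQ0 : 0 <= CQ. Proof. by rewrite mulr_ge0 ?ler0n// sqr_ge0. Qed.
Let BR0 i : 0 <= BR i. Proof. by rewrite addr_ge0// mulr_ge0// ltW. Qed.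
Let FR0 i : 0 <= FR i.
Proof.
by apply: addr_ge0; repeat (apply: mulr_ge0 => //); rewrite ?invr_ge0 ?(ltW (mu_pos i)) ?BR0.
Qed.
Let QI0 : 0 <= QI. Proof. by rewrite mulr_ge0// sumr_ge0. Qed.
Let BL0 i : 0 <= BL i. Proof. by rewrite addr_ge0// mulr_ge0// ltW. Qed.
Let ER0 j : 0 <= ER j.
Proof.
apply: addr_ge0; repeat (apply: mulr_ge0 => //).
by case: j => j; [exact: BL0|exact: BR0].
Qed.

Lemma energy_const_ge0 : 0 <= energy_const.
Proof. exact: sumr_ge0. Qed.

Lemma measurable_source j : measurable2 R (source j).
Proof.
by apply: measurable_sumr => k; apply: measurable_funM; [exact: measurable_cst|exact: mz].
Qed.

Let mz1 j t : measurable_fun setT (z j t).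
Proof. by have h := mz j; meas. Qed.

Lemma measurable_inflow1 i : measurable_fun setT (inflow1 i).
Proof.
apply: (@measurable_Rint_itv _ _ _ (fun t x => \sum_(k : J) G1 i k x * z k t x)); [|by meas|by meas].
apply: measurable_sumr => k; apply: measurable_funM; last exact: mz.
exact: (measurableT_comp (mG i k) measurable_snd).
Qed.

Lemma measurable_inflow0 i : measurable_fun setT (inflow0 i).
Proof.
apply: measurable_sumr => k; apply: measurable_funM; first exact: measurable_cst.
by refine (measurableT_comp (mz (inr k)) (g := fun t : R => (t, 0 : R)) _); meas.
Qed.

Lemma measurable_datum j : measurable_fun setT (datum j).
Proof.
case: j => j /=; apply: measurable_fun_ifT; [by meas|exact: mz0| |by meas|exact: mz0|];
  (apply: measurable_fun_ifT; [by meas| |exact: measurable_cst]).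
- by have h := measurable_inflow0 j; meas.
- by have h := measurable_inflow1 j; meas.
Qed.

Lemma measurable_char_value j : measurable2 R (char_value j).
Proof. by apply: measurable_transport; [exact: measurable_datum|exact: measurable_source]. Qed.

Lemma measurable_energy_integrand : measurable_fun setT (fun p : R * R => \sum_(j : J) z j p.1 p.2 ^+ 2).
Proof. by apply: measurable_sumr => k; apply: measurable_funX; exact: mz. Qed.

Lemma measurable_energy : measurable_fun setT energy.
Proof.
apply: (@measurable_int_l _ (fun t x => (\sum_(j : J) z j t x ^+ 2)%:E)).
  by apply/measurable_EFinP; exact: measurable_energy_integrand.
by move=> t x; rewrite lee_fin sumr_ge0// => k _; exact: sqr_ge0.
Qed.

Lemma energy_ge0 t : (0 <= energy t)%E.
Proof. by apply: integral_ge0 => x _; rewrite lee_fin sumr_ge0// => k _; exact: sqr_ge0. Qed.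

Let e00 : (0 <= energy0)%E.
Proof. by apply: integral_ge0 => x _; rewrite lee_fin sumr_ge0// => k _; exact: sqr_ge0. Qed.
Let I0 t : (0 <= I t)%E.
Proof. by apply: integral_ge0 => s _; exact: energy_ge0. Qed.
Let Y0 t : (0 <= Y t)%E. Proof. exact: adde_ge0. Qed.
Let IY t : (I t <= Y t)%E. Proof. exact: leeDr. Qed.

Let leYD t (x y : \bar R) (al be : R) : 0 <= al -> 0 <= be ->
  (x <= al%:E * Y t)%E -> (y <= be%:E * Y t)%E -> (x + y <= (al + be)%:E * Y t)%E.
Proof. by move=> a0 b0 xa yb; rewrite EFinD ge0_muleDl ?lee_fin//; exact: leeD. Qed.

Let leYZ t (k al : R) (x : \bar R) : 0 <= k ->
  (x <= al%:E * Y t)%E -> (k%:E * x <= (k * al)%:E * Y t)%E.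
Proof. by move=> k0 xa; rewrite EFinM -muleA; apply: lee_wpmul2l => //; rewrite lee_fin. Qed.

Let leYI t (k : R) : 0 <= k -> (k%:E * I t <= k%:E * Y t)%E.
Proof. by move=> k0; apply: lee_wpmul2l; [rewrite lee_fin|exact: IY]. Qed.

Let leY_sum t (X : finType) (x : X -> \bar R) (al : X -> R) :
  (forall i, 0 <= al i) -> (forall i, (x i <= (al i)%:E * Y t)%E) ->
  (\sum_(i : X) x i <= (\sum_(i : X) al i)%:E * Y t)%E.
Proof.
move=> a0 xa; rewrite -sumEFin ge0_sume_distrl; last by move=> i _; rewrite lee_fin.
exact: lee_sum.
Qed.

Let wsum_sqr (c : R) (b w : J -> R) : (forall k, `|b k| <= c) ->
  (\sum_k b k * w k) ^+ 2 <= NJ * c ^+ 2 * \sum_k w k ^+ 2.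
Proof.
move=> bc; apply: le_trans (sum_sqr_le _) _; rewrite -mulrA ler_wpM2l ?ler0n// mulr_sumr.
apply: ler_sum => k _; rewrite exprMn ler_wpM2r ?sqr_ge0//.
by rewrite -(real_normK (num_real (b k))) lerXn2r ?nnegrE// (le_trans _ (bc k)).
Qed.

Let src_sqr j t : (\int[leb]_x (source j t x ^+ 2)%:E <= CA%:E * energy t)%E.
Proof.
have ms := measurable_source j.
rewrite -ge0_integralZl//; last 2 first.
- by apply/measurable_EFinP; apply: measurable_sumr => k; apply: measurable_funX; exact: mz1.
- by move=> x _; rewrite lee_fin sumr_ge0// => k _; exact: sqr_ge0.
apply: ge0_le_integral => //.
- by move=> x _; rewrite lee_fin sqr_ge0.
- by meas.
- apply: emeasurable_funM; first exact: measurable_cst.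
  by apply/measurable_EFinP; apply: measurable_sumr => k; apply: measurable_funX; exact: mz1.
- by move=> x _; rewrite -EFinM lee_fin; exact: wsum_sqr.
Qed.

Let srcI j t : (\int[leb]_(r in `[0%R, t]) \int[leb]_x (source j r x ^+ 2)%:E <= CA%:E * I t)%E.
Proof.
have ms := measurable_source j; have me := measurable_energy.
rewrite -ge0_integralZl//; last 2 first.
- exact: measurable_funTS.
- by move=> x _; exact: energy_ge0.
apply: ge0_le_integral => //.
- by move=> x _; apply: integral_ge0 => y _; rewrite lee_fin sqr_ge0.
- apply: measurable_funTS; apply: (@measurable_int_l _ (fun r x => (source j r x ^+ 2)%:E)).
    by meas.
  by move=> x y; rewrite lee_fin sqr_ge0.
- by apply: measurable_funTS; meas.
Qed.

Let inflow1_sqr i t : ((inflow1 i t ^+ 2)%:E <= CG%:E * energy t)%E.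
Proof.
have mI : measurable_fun setT (fun x => \sum_(k : J) G1 i k x * z k t x).
  by apply: measurable_sumr => k; apply: measurable_funM; [exact: mG|exact: mz1].
apply: le_trans (Cauchy_Schwarz_itv ler01 mI) _; rewrite subr0 mul1e.
have me : measurable_fun setT (fun x => (\sum_(j : J) z j t x ^+ 2)%:E).
  by apply/measurable_EFinP; apply: measurable_sumr => k; apply: measurable_funX; exact: mz1.
rewrite -ge0_integralZl//; last first.
- by move=> x _; rewrite lee_fin sumr_ge0// => k _; exact: sqr_ge0.
rewrite int_if; apply: ge0_le_integral => //.
- by move=> x _; case: ifP => // _; rewrite lee_fin sqr_ge0.
- by meas.
- by meas.
- move=> x _; rewrite -EFinM; case: ifP => _; rewrite lee_fin; first exact: wsum_sqr.
  by rewrite mulr_ge0// sumr_ge0// => k _; exact: sqr_ge0.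
Qed.

Let inflow1_L2 i t : (\int[leb]_(s in `[0%R, t]) (inflow1 i s ^+ 2)%:E <= CG%:E * I t)%E.
Proof.
have mi := measurable_inflow1 i; have me := measurable_energy.
rewrite -ge0_integralZl//; last 2 first.
- exact: measurable_funTS.
- by move=> x _; exact: energy_ge0.
apply: ge0_le_integral => //.
- by move=> s _; rewrite lee_fin sqr_ge0.
- by apply: measurable_funTS; meas.
- by apply: measurable_funTS; meas.
Qed.

Let z0_L2 j : (\int[leb]_x (z0 j x ^+ 2)%:E <= energy0)%E.
Proof.
apply: ge0_le_integral => //.
- by move=> x _; rewrite lee_fin sqr_ge0.
- by have h := mz0 j; meas.
- by apply/measurable_EFinP; apply: measurable_sumr => k; apply: measurable_funX; exact: mz0.
- move=> x _; rewrite lee_fin (bigD1 j)//= lerDl sumr_ge0// => k _; exact: sqr_ge0.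
Qed.

(** The labels, that is the positions at time 0, of the characteristics that pass through [[0, 1]]
    at some time up to [t]. *)
Definition window (j : J) (t y : R) : bool :=
  match j with inl i => - lam i * t <= y <= 1 | inr i => 0 <= y <= 1 + mu i * t end.

Let W (j : J) (t y : R) : \bar R := (if window j t y then (datum j y ^+ 2)%:E else 0)%E.

Let W0 j t y : (0 <= W j t y)%E.
Proof. by rewrite /W; case: ifP => // _; rewrite lee_fin sqr_ge0. Qed.

Let mW j t : measurable_fun setT (W j t).
Proof.
have mb := measurable_datum j.
apply: measurable_fun_ifT; [|by meas|exact: measurable_cst].
by rewrite /window; case: j mb => j mb; meas.
Qed.

(** Meant for [k = mu i] or [k = - lam i]: the affine map in the hypothesis sends a label outside
    [[0, 1]] to the time of entry, and the change of variable costs [|k|]. *)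
Let W_le j t (h : R -> R) (k : R) : k != 0 -> measurable_fun setT h ->
  (forall y, W j t y <= (z0 j y ^+ 2)%:E +
     (if (0 <= k^-1 * y + (match j with inl _ => 0 | inr _ => - k^-1 end) <= t)%R
      then (h (k^-1 * y + (match j with inl _ => 0 | inr _ => - k^-1 end))%R ^+ 2)%:E else 0))%E ->
  (\int[leb]_y W j t y <= energy0 + `|k|%:E * \int[leb]_(s in `[0%R, t]) (h s ^+ 2)%:E)%E.
Proof.
move=> k0 mh; pose b : R := match j with inl _ => 0 | inr _ => - k^-1 end; rewrite -/b => Wh.
have mz0j := mz0 j.
pose H (s : R) : \bar R := (if (0 <= s <= t)%R then (h s ^+ 2)%:E else 0)%E.
have mH : measurable_fun setT H by rewrite /H; meas.
have H0 s : (0 <= H s)%E by rewrite /H; case: ifP => // _; rewrite lee_fin sqr_ge0.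
apply: (@le_trans _ _ (\int[leb]_y ((z0 j y ^+ 2)%:E + H (k^-1 * y + b)%R))%E).
  apply: ge0_le_integral => //; [exact: mW|by meas].
rewrite ge0_integralD//; [|by move=> y _; rewrite lee_fin sqr_ge0|by meas|by meas].
apply: leeD; first exact: z0_L2.
rewrite ge0_integral_affine ?invr_eq0// normfV invrK.
by rewrite [X in (_ <= _ * X)%E]int_if.
Qed.

Let WR i t : 0 <= t <= T -> (\int[leb]_y W (inr i) t y <= (BR i)%:E * Y t)%E.
Proof.
move=> /andP[t0 tT]; have mi := mu_pos i.
apply: le_trans (W_le (k := mu i) (h := inflow1 i) _ _ _) _ => /=.
- by rewrite gt_eqF.
- exact: measurable_inflow1.
- move=> y; have z00 : (0 <= (z0 (inr i) y ^+ 2)%:E)%E by rewrite lee_fin sqr_ge0.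
  rewrite /W /window /datum.
  have -> : (mu i)^-1 * y - (mu i)^-1 = (y - 1) / mu i by rewrite mulrBl mul1r mulrC.
  have [/andP[y0 y1]|] := boolP (0 <= y <= 1 + mu i * t); last first.
    by move=> _; apply: adde_ge0 => //; case: ifP => // _; rewrite lee_fin sqr_ge0.
  rewrite y0 /=; have [yl|yg] := leP y 1.
    by apply: leeDl; case: ifP => // _; rewrite lee_fin sqr_ge0.
  have y1T : y <= 1 + mu i * T by apply: le_trans y1 _; rewrite lerD2l ler_wpM2l// ltW.
  rewrite y1T /= ifT; first exact: leeDr.
  by rewrite divr_ge0 ?(ltW mi) ?subr_ge0 ?(ltW yg)//= ler_pdivrMr// lerBlDl mulrC.
- rewrite gtr0_norm//; apply: leYD => //; first by rewrite mulr_ge0// ltW.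
    by rewrite mul1e leeDl.
  by apply: leYZ; [exact: ltW|apply: le_trans (inflow1_L2 i t) (leYI t CG0)].
Qed.

Let FRle i t : 0 <= t <= T ->
  (\int[leb]_(s in `[0%R, t]) (z (inr i) s 0 ^+ 2)%:E <= (FR i)%:E * Y t)%E.
Proof.
move=> tT; have /andP[t0 t1] := tT; have mi := mu_pos i.
have mzt := measurable_char_value (inr i).
have mb := measurable_datum (inr i); have ms := measurable_source (inr i).
have mzi : measurable_fun setT (fun s => z (inr i) s 0).
  by refine (measurableT_comp (mz (inr i)) (g := fun t : R => (t, 0 : R)) _); meas.
have -> : (\int[leb]_(s in `[0%R, t]) (z (inr i) s 0 ^+ 2)%:E =
    \int[leb]_(s in `[0%R, t]) (char_value (inr i) s 0 ^+ 2)%:E)%E.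
  apply: ge0_ae_eq_integral => //.
  - by apply: measurable_funTS; meas.
  - apply: measurable_funTS; apply/measurable_EFinP; apply: measurable_funX.
    by refine (measurableT_comp mzt (g := fun t : R => (t, 0 : R)) _); meas.
  - by move=> s _; rewrite lee_fin sqr_ge0.
  - by move=> s _; rewrite lee_fin sqr_ge0.
  - have := z_zt0 i; apply: aeS => s hs; rewrite /= in_itv/= => /andP[s0 st].
    by rewrite hs// s0 (le_trans st t1).
have c0 : speed lam mu (inr i) != 0 by rewrite /= oppr_eq0 gt_eqF.
apply: le_trans (transport_L2_t mb ms 0 c0 t0) _.
rewrite [speed _ _ _]/= normrN (gtr0_norm mi); apply: leYD.
- by repeat apply: mulr_ge0 => //; rewrite ?invr_ge0 ?BR0 ?ltW.
- by repeat apply: mulr_ge0 => //; rewrite invr_ge0 ltW.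
- apply: leYZ => //.
  apply: (@le_trans _ _ (\int[leb]_s W (inr i) t (mu i * s + 0)%R)%E); last first.
    rewrite ge0_integral_affine ?gt_eqF// gtr0_norm//.
    by apply: leYZ; [rewrite invr_ge0 ltW|exact: WR].
  rewrite int_if; apply: ge0_le_integral => //.
  + by move=> s _; case: ifP => // _; rewrite lee_fin sqr_ge0.
  + by meas.
  + by have h := mW (inr i) t; meas.
  + move=> s _; rewrite sub0r mulNr opprK addr0 /W /window.
    case: ifP => [/andP[s0 st]|_]; last by case: ifP => // _; rewrite lee_fin sqr_ge0.
    rewrite ifT// mulr_ge0 ?(ltW mi)//=.
    by rewrite (le_trans (_ : _ <= mu i * t)) ?ler_wpM2l ?(ltW mi)// lerDr.
- apply: (@le_trans _ _ ((2 * t * (mu i)^-1 * CA)%:E * Y t)%E).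
    rewrite [(2 * t * (mu i)^-1 * CA)%:E]EFinM -muleA.
    apply: lee_wpmul2l; first by rewrite lee_fin; repeat apply: mulr_ge0 => //; rewrite invr_ge0 ltW.
    by apply: le_trans (srcI _ t) (leYI t CA0).
  apply: lee_wpmul2r => //; rewrite lee_fin ler_wpM2r// ler_wpM2r ?invr_ge0 ?(ltW mi)//.
  by rewrite ler_wpM2l.
Qed.

Let inflow0_L2 i t : 0 <= t <= T ->
  (\int[leb]_(s in `[0%R, t]) (inflow0 i s ^+ 2)%:E <= QI%:E * Y t)%E.
Proof.
move=> tT; have mi := measurable_inflow0 i.
have mzi p : measurable_fun setT (fun s => z (inr p) s 0).
  by refine (measurableT_comp (mz (inr p)) (g := fun t : R => (t, 0 : R)) _); meas.
have msum : measurable_fun setT (fun s : R => \sum_(p < m) (z (inr p) s 0 ^+ 2)%:E)%E.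
  have -> : (fun s : R => \sum_(p < m) (z (inr p) s 0 ^+ 2)%:E)%E =
      (fun s => (\sum_(p < m) z (inr p) s 0 ^+ 2)%:E) by apply/funext => s; rewrite sumEFin.
  by apply/measurable_EFinP; apply: measurable_sumr => p; apply: measurable_funX.
apply: (@le_trans _ _ (CQ%:E * \sum_(p < m) \int[leb]_(s in `[0%R, t]) (z (inr p) s 0 ^+ 2)%:E)%E).
  rewrite -ge0_integral_sum//; last 2 first.
  - by move=> p; apply: measurable_funTS; have h := mzi p; meas.
  - by move=> p s _; rewrite lee_fin sqr_ge0.
  rewrite -ge0_integralZl//; last 2 first.
  - exact: measurable_funTS.
  - by move=> s _; rewrite sumEFin lee_fin sumr_ge0// => p _; exact: sqr_ge0.
  apply: ge0_le_integral => //.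
  - by move=> s _; rewrite lee_fin sqr_ge0.
  - by apply: measurable_funTS; meas.
  - apply: measurable_funTS; apply: emeasurable_funM; [exact: measurable_cst|exact: msum].
  - move=> s _; rewrite sumEFin -EFinM lee_fin /inflow0.
    apply: le_trans (sum_sqr_le _) _; rewrite card_ord -mulrA ler_wpM2l ?ler0n// mulr_sumr.
    apply: ler_sum => k _; rewrite exprMn ler_wpM2r ?sqr_ge0//.
    by rewrite -(real_normK (num_real (Q0 i k))) lerXn2r ?nnegrE// (le_trans _ (Qq i k)).
apply: leYZ => //; apply: leY_sum => // p; exact: FRle.
Qed.

Let WL i t : 0 <= t <= T -> (\int[leb]_y W (inl i) t y <= (BL i)%:E * Y t)%E.
Proof.
move=> tT; have /andP[t0 t1] := tT; have li := lam_pos i.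
apply: le_trans (W_le (k := - lam i) (h := inflow0 i) _ _ _) _ => /=.
- by rewrite oppr_eq0 gt_eqF.
- exact: measurable_inflow0.
- move=> y; have z00 : (0 <= (z0 (inl i) y ^+ 2)%:E)%E by rewrite lee_fin sqr_ge0.
  rewrite /W /window /datum.
  have -> : (- lam i)^-1 * y + 0 = - y / lam i by rewrite invrN addr0 mulNr mulNr mulrC.
  have [/andP[y0 y1]|] := boolP (- lam i * t <= y <= 1); last first.
    by move=> _; apply: adde_ge0 => //; case: ifP => // _; rewrite lee_fin sqr_ge0.
  rewrite y1 andbT; have [yl|yg] := leP 0 y.
    by apply: leeDl; case: ifP => // _; rewrite lee_fin sqr_ge0.
  have y1T : - lam i * T <= y.
    by apply: le_trans y0; rewrite !mulNr lerN2 ler_wpM2l// ltW.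
  rewrite y1T /= ifT; first exact: leeDr.
  rewrite divr_ge0 ?(ltW li) ?oppr_ge0 ?(ltW yg)//= ler_pdivrMr// mulrC.
  by move: y0; rewrite mulNr lerNl.
- rewrite normrN gtr0_norm//; apply: leYD => //; first by rewrite mulr_ge0// ltW.
    by rewrite mul1e leeDl.
  by apply: leYZ; [exact: ltW|exact: inflow0_L2].
Qed.

Lemma datum_L2 j t : 0 <= t <= T ->
  (\int[leb]_y W j t y <= (match j with inl i => BL i | inr i => BR i end)%:E * Y t)%E.
Proof. by case: j => j; [exact: WL|exact: WR]. Qed.

Let z_L2 j t : 0 <= t <= T -> (\int[leb]_x (z j t x ^+ 2)%:E <= (ER j)%:E * Y t)%E.
Proof.
move=> tT; have /andP[t0 t1] := tT.
have mb := measurable_datum j; have ms := measurable_source j; have mzj := mz1 j t.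
have mzt := measurable_char_value j.
have -> : (\int[leb]_x (z j t x ^+ 2)%:E =
    \int[leb]_(x in `[0%R, 1%R]) (char_value j t x ^+ 2)%:E)%E.
  rewrite int_if; apply: ge0_ae_eq_integral => //.
  - by meas.
  - by apply: measurable_fun_ifT; [by meas| |exact: measurable_cst]; meas.
  - by move=> x _; rewrite lee_fin sqr_ge0.
  - by move=> x _; case: ifP => // _; rewrite lee_fin sqr_ge0.
  - have := z_zt j tT; apply: aeS => x hx _.
    case: ifP => [/hx ->//|/negbT /z_out ->]; by rewrite expr0n.
apply: le_trans (transport_L2_x (speed lam mu j) mb ms t0) _.
apply: leYD.
- by rewrite mulr_ge0//; case: (j) => k; [exact: BL0|exact: BR0].
- by repeat apply: mulr_ge0 => //.
- apply: leYZ => //.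
  apply: (@le_trans _ _ (\int[leb]_x W j t (1 * x + - (speed lam mu j * t))%R)%E); last first.
    by rewrite ge0_integral_affine ?oner_eq0// normr1 invr1 mul1e; exact: datum_L2.
  rewrite int_if; apply: ge0_le_integral => //.
  + by move=> x _; case: ifP => // _; rewrite lee_fin sqr_ge0.
  + by meas.
  + by have h := mW j t; meas.
  + move=> x _; rewrite mul1r; case: ifP => [/andP[x0 x1]|_]; last exact: W0.
    rewrite /W ifT// /window; case: (j) => k /=.
      rewrite mulNr lerDr x0/= lerBlDr (le_trans x1)// lerDl mulr_ge0// ltW//.
    by rewrite mulNr opprK addr_ge0 ?mulr_ge0 ?(ltW (mu_pos _))//= lerD2r.
- apply: (@le_trans _ _ ((2 * t)%:E * (CA%:E * Y t))%E).
    apply: lee_wpmul2l; first by rewrite lee_fin mulr_ge0.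
    by apply: le_trans (srcI _ t) (leYI t CA0).
  rewrite muleA -EFinM; apply: lee_wpmul2r => //.
  by rewrite lee_fin ler_wpM2r// ler_wpM2l.
Qed.

Lemma energy_le t : 0 <= t <= T -> (energy t <= energy_const%:E * (energy0 + \int[leb]_(s in `[0%R, t]) energy s))%E.
Proof.
move=> tT; rewrite -/(I t) -/(Y t).
have -> : energy t = (\sum_(j : J) \int[leb]_x (z j t x ^+ 2)%:E)%E.
  rewrite /energy -ge0_integral_sum//.
  - by apply: eq_integral => x _; rewrite sumEFin.
  - by move=> j; have h := mz1 j t; meas.
  - by move=> j x _; rewrite lee_fin sqr_ge0.
by apply: leY_sum => // j; exact: z_L2.
Qed.

Hypothesis energy_fin : (\int[leb]_(s in `[0%R, T]) energy s < +oo)%E.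

(** The summand 1 provides the positive rate that [Gronwall] asks for. Gronwall bounds the
    accumulated energy; [energy_le], applied once more, turns this into a bound at every single
    time. *)
Definition growth_const : R :=
  energy_const * (1 + expR (2 * (energy_const + 1) * T) / (energy_const + 1) * energy_const).

Lemma energy_growth t : 0 <= t <= T -> (energy t <= growth_const%:E * energy0)%E.
Proof.
move=> tT; have /andP[t0 t1] := tT; have C0 := energy_const_ge0.
have C1 : 0 < energy_const + 1 by rewrite ltr_pwDr.
have me := measurable_energy.
have gr : (\int[leb]_(s in `[0%R, T]) energy s <=
    (expR (2 * (energy_const + 1) * T) / (energy_const + 1))%:E * (energy_const%:E * energy0))%E.
  apply: (@Gronwall _ T (energy_const + 1)) => //.
  - by apply: mule_ge0 => //; rewrite lee_fin.
  - exact: energy_ge0.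
  - apply: ae_true => s sT; apply: le_trans (energy_le sT) _.
    rewrite ge0_muleDr//; last exact: I0.
    apply: leeD => //; apply: lee_wpmul2r; first exact: I0.
    by rewrite lee_fin lerDl.
apply: le_trans (energy_le tT) _.
rewrite EFinM -muleA; apply: lee_wpmul2l; first by rewrite lee_fin.
rewrite EFinD ge0_muleDl ?lee_fin//; last by apply: mulr_ge0 => //; apply: divr_ge0; [exact: expR_ge0|exact: ltW].
rewrite mul1e; apply: leeD => //.
rewrite EFinM -muleA; apply: le_trans gr.
apply: ge0_subset_integral => //.
- exact: measurable_funTS.
- by move=> s _; exact: energy_ge0.
- by apply: subset_itvl; rewrite bnd_simp.
Qed.

Hypothesis energy0_fin : (energy0 < +oo)%E.

(** A solution is required to have finite norm at almost every time only; the identities along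
    characteristics use integrability at each given time. *)
Lemma energy_lty t : 0 <= t <= T -> (energy t < +oo)%E.
Proof.
move=> tT; apply: le_lt_trans (energy_growth tT) _.
by rewrite lte_mul_pinfty// lee_fin mulr_ge0 ?energy_const_ge0// addr_ge0// !mulr_ge0 ?expR_ge0// ?invr_ge0 ?addr_ge0 ?energy_const_ge0.
Qed.

Let abs_le_sqr (x : R) : `|x| <= x ^+ 2 + 1.
Proof. by rewrite -(real_normK (num_real x)); have := sqr_ge0 (`|x| - 1); have := normr_ge0 x; lra. Qed.

Lemma int1_z j t : 0 <= t <= T -> int1 (z j t).
Proof.
move=> tT; have mzj := mz1 j t.
have sqi : int1 (fun x => z j t x ^+ 2).
  apply/int1P; split; first by meas.
  apply: le_lt_trans (energy_lty tT); apply: ge0_le_integral => //.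
  - by meas.
  - by apply/measurable_EFinP; apply: measurable_sumr => k; apply: measurable_funX; exact: mz1.
  - move=> x _; rewrite lee_fin ger0_norm ?sqr_ge0// (bigD1 j)//= lerDl sumr_ge0// => k _; exact: sqr_ge0.
apply: int1_le (int1D sqi (int1_cst 0 1 1)) => // x.
rewrite [leRHS]ger0_norm; last by rewrite addr_ge0 ?sqr_ge0//; case: ifP.
case: ifP => [_|/negbT /z_out ->]; first exact: abs_le_sqr.
by rewrite normr0 addr0 sqr_ge0.
Qed.

Lemma int2_z j : int2 (fun s x => if 0 <= s <= T then z j s x else 0).
Proof.
have mzj := mz j; have me := measurable_energy.
have sqi : int2 (fun s x => if 0 <= s <= T then z j s x ^+ 2 else 0).
  split; first by meas.
  apply: le_lt_trans energy_fin; rewrite int_if; apply: ge0_le_integral => //.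
  - by move=> s _; exact: integral_ge0.
  - by apply: (@measurable_int_l _ (fun s x => `|if 0 <= s <= T then z j s x ^+ 2 else 0|%:E)) => //; meas.
  - by meas.
  - move=> s _; case: ifP => _; last by rewrite normr0 integral0.
    apply: ge0_le_integral => //.
    + by have h := mz1 j s; meas.
    + by apply/measurable_EFinP; apply: measurable_sumr => k; apply: measurable_funX; exact: mz1.
    + move=> x _; rewrite lee_fin ger0_norm ?sqr_ge0// (bigD1 j)//= lerDl sumr_ge0// => k _; exact: sqr_ge0.
apply: int2_le (int2D sqi (int2_prod (int1_cst 0 T 1) (int1_cst 0 1 1))); first by meas.
move=> s x; case: ifP => _; last by rewrite normr0.
rewrite [leRHS]ger0_norm; last by rewrite addr_ge0 ?sqr_ge0// mulr_ge0//; case: ifP.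
rewrite mul1r; case: ifP => [_|/negbT /z_out ->]; first exact: abs_le_sqr.
by rewrite normr0 addr0 sqr_ge0.
Qed.

Lemma int2_source j : int2 (fun s x => if 0 <= s <= T then source j s x else 0).
Proof.
have -> : (fun s x => if 0 <= s <= T then source j s x else 0) =
    (fun s x => \sum_(k : J) A j k * (if 0 <= s <= T then z k s x else 0)).
  apply/funext => s; apply/funext => x; rewrite /source; case: ifP => // _.
  by rewrite big1// => k _; rewrite mulr0.
elim: (index_enum _) => [|k r ih].
  apply: (eq_int2 (g := fun _ _ => 0 * 0)) => [s x|]; first by rewrite big_nil mul0r.
  exact: int2_prod int1_0 int1_0.
apply: (eq_int2 (g := fun s x => A j k * (if 0 <= s <= T then z k s x else 0) +
   \sum_(l <- r) A j l * (if 0 <= s <= T then z l s x else 0))) => [s x|]; first by rewrite big_cons.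
apply: int2D; last exact: ih.
by apply: int2Z; exact: int2_z.
Qed.

Lemma int1_datum j : int1 (datum j).
Proof.
have mb := measurable_datum j; have TT : 0 <= T <= T by rewrite T0 lexx.
have bw y : ~~ window j T y -> datum j y = 0.
  rewrite /window /datum; case: (j) => k yw.
    case: ifP => [/andP[y0 y1]|_].
      by move: yw; rewrite y1 andbT (le_trans _ y0)// mulNr oppr_le0 mulr_ge0// ltW.
    by case: ifP => // /andP[h1 h2]; move: yw; rewrite h1 (le_trans (ltW h2)).
  case: ifP => [/andP[y0 y1]|_].
    by move: yw; rewrite y0 (le_trans y1)// lerDl mulr_ge0// ltW.
  by case: ifP => // /andP[h1 h2]; move: yw; rewrite h2 (le_trans _ (ltW h1)).
have sqi : int1 (fun y => datum j y ^+ 2).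
  apply/int1P; split; first by meas.
  apply: (@le_lt_trans _ _ (\int[leb]_y W j T y)%E).
    apply: ge0_le_integral => //; [by meas|exact: mW|].
    move=> y _; rewrite /W ger0_norm ?sqr_ge0//; case: ifP => // /negbT /bw ->.
    by rewrite expr0n.
  apply: le_lt_trans (datum_L2 j TT) _.
  apply: lte_mul_pinfty => //; last exact: lte_add_pinfty.
  by rewrite lee_fin; case: (j) => k; [exact: BL0|exact: BR0].
(* Square integrability implies integrability on a set of finite measure, and the window is
   bounded. *)
have bd : exists b, forall y, window j T y -> - b <= y <= b.
  case: (j) => k; rewrite /window.
    exists (1 + lam k * T) => y /andP[y0 y1].
    by have : 0 <= lam k * T by [rewrite mulr_ge0// ltW]; move: y0; rewrite mulNr => *; apply/andP; split; lra.
  exists (1 + mu k * T) => y /andP[y0 y1].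
  by have : 0 <= mu k * T by [rewrite mulr_ge0// ltW] => *; apply/andP; split; lra.
have [b hb] := bd.
apply: int1_le (int1D sqi (int1_cst (- b) b 1)) => // y.
rewrite [leRHS]ger0_norm; last by rewrite addr_ge0 ?sqr_ge0//; case: ifP.
have [yw|/bw ->] := boolP (window j T y); first by rewrite hb ?abs_le_sqr.
by rewrite normr0 addr_ge0 ?sqr_ge0//; case: ifP.
Qed.

End Energy.

(** * From integral inequalities to vanishing almost everywhere *)

Section Vanishing.
Context {R : realType}.
Local Notation leb := (@lebesgue_measure R).

Lemma ae_affine (a b : R) (P : R -> Prop) : a != 0 ->
  {ae leb, forall x, P x} -> {ae leb, forall x, P (a * x + b)}.
Proof.
move=> a0 [N [mN N0 PN]].
exists ((fun x : R => a * x + b) @^-1` N); split.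
- by rewrite -[X in measurable X]setTI; exact: (@measurable_affine R a b setT measurableT N).
- have /esym/eqP := lebesgue_measure_affine b a0 mN; rewrite N0 mule_eq0 eqe normr_eq0 (negbTE a0)/=.
  by move/eqP.
- by move=> x /= nP; exact: PN.
Qed.

Lemma measurable_int_EFin (f : R -> R -> R) :
  measurable2 R f -> (forall x y, 0 <= f x y) ->
  measurable_fun setT (fun x => \int[leb]_y (f x y)%:E)%E.
Proof.
move=> mf f0; have := @measurable_int_l R (fun x y => (f x y)%:E); apply; last by move=> x y; rewrite lee_fin.
exact/measurable_EFinP.
Qed.

Lemma le_int (f g : R -> \bar R) : measurable_fun setT f -> measurable_fun setT g ->
  (forall x, 0 <= f x)%E -> (forall x, f x <= g x)%E -> (\int[leb]_x f x <= \int[leb]_x g x)%E.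
Proof. by move=> mf mg f0 fg; exact: ge0_le_integral. Qed.

Lemma le_int_ae (f g : R -> \bar R) : measurable_fun setT f -> measurable_fun setT g ->
  (forall x, 0 <= f x)%E -> (forall x, 0 <= g x)%E ->
  {ae leb, forall x, (f x <= g x)%E} -> (\int[leb]_x f x <= \int[leb]_x g x)%E.
Proof.
move=> mf mg f0 g0 fg; apply: ae_ge0_le_integral => //.
by move: fg; apply: aeS => x h _.
Qed.

Lemma int_ae0 (f : R -> R) : measurable_fun setT f -> (forall x, 0 <= f x) ->
  (\int[leb]_x (f x)%:E <= 0)%E -> {ae leb, forall x, f x = 0}.
Proof.
move=> mf f0 If.
have mEf : measurable_fun setT (EFin \o f) by exact/measurable_EFinP.
have : (\int[leb]_x `|(EFin \o f) x| = 0)%E.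
  apply/eqP; rewrite eq_le integral_ge0// andbT; apply: le_trans If.
  by under eq_integral do rewrite /= ger0_norm//.
move/(ae_eq_integral_abs leb measurableT mEf); apply: aeS => x /(_ Logic.I).
by case.
Qed.

Lemma abs_Rint_le (f : R -> R) : measurable_fun setT f ->
  (`|\int[leb]_x f x|%:E <= \int[leb]_x `|f x|%:E)%E.
Proof.
move=> mf; have mEf : measurable_fun setT (EFin \o f) by exact/measurable_EFinP.
have := le_abse_integral leb measurableT mEf.
apply: le_trans; rewrite /Rintegral /=.
by case: (integral _ _ _) => [r| |]; rewrite ?leey//= lee_fin.
Qed.

(** With [A = 0] Gronwall annihilates the integral over time; the hypothesis, used a second time,
    then reaches each individual [t]. *)
Lemma Gronwall_zero (T C : R) (W : R -> R -> R) : 0 <= T ->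
  measurable2 R W -> (forall t x, 0 <= W t x) ->
  (\int[leb]_(t in `[0%R, T]) \int[leb]_x (W t x)%:E < +oo)%E ->
  (forall t, 0 <= t <= T ->
    (\int[leb]_x (W t x)%:E <= C%:E * \int[leb]_(s in `[0%R, t]) \int[leb]_x (W s x)%:E)%E) ->
  forall t, 0 <= t <= T -> {ae leb, forall x, W t x = 0}.
Proof.
move=> T0 mW W0 Wfin HW t /andP[t0 tT].
pose E s := (\int[leb]_x (W s x)%:E)%E.
have E0 s : (0 <= E s)%E by apply: integral_ge0 => x _; rewrite lee_fin.
have mE : measurable_fun setT E.
  exact: (@measurable_int_EFin W mW W0).
have C1 : 0 < `|C| + 1 by rewrite ltr_pwDr.
have H (s : R) : 0 <= s <= T -> (E s <= 0 + (`|C| + 1)%:E * \int[leb]_(r in `[0%R, s]) E r)%E.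
  move=> sT; rewrite add0e; apply: le_trans (HW s sT) _; apply: lee_wpmul2r; first by apply: integral_ge0 => r _; exact: E0.
  by rewrite lee_fin (le_trans (ler_norm C))// lerDl.
have := @Gronwall R T (`|C| + 1) 0 E C1 T0 (lexx _) mE E0 Wfin (ae_true H); rewrite mule0 => HI.
have It : (\int[leb]_(r in `[0%R, t]) E r <= 0)%E.
  apply: le_trans HI; apply: ge0_subset_integral => //; first exact: measurable_funTS.
  by move=> x /=; rewrite !in_itv/= => /andP[-> /le_trans]; apply.
have mWt : measurable_fun setT (W t) by have h := mW; meas.
apply: int_ae0 => //; apply: le_trans (HW t _) _; first by rewrite t0.
have -> : (\int[leb]_(r in `[0%R, t]) E r = 0)%E by apply/eqP; rewrite eq_le It/= integral_ge0.
by rewrite mule0.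
Qed.

End Vanishing.

(** * The backstepping transformation *)

(** [A] acts on the state and its transpose on the kernels, so the coupling terms cancel in the
    pairing. What survives are the omega terms, and they pair the state with the kernels of the
    components [p]. *)
Lemma bulk_algebra (R : comRingType) (J P : finType) (A : J -> J -> R) (z g : J -> R)
    (H : P -> J -> R) (o : P -> R) (b : pred P) :
  \sum_(j : J) ((\sum_(k : J) A j k * z k) * g j -
     z j * (\sum_(k : J) A k j * g k - \sum_(p : P | b p) H p j * o p)) =
  \sum_(p : P) (if b p then o p else 0) * (\sum_(j : J) H p j * z j).
Proof.
under eq_bigr do rewrite mulrBr opprB addrCA.
rewrite big_split/= sumrB.
have -> : \sum_(j : J) (\sum_(k : J) A j k * z k) * g j = \sum_(j : J) z j * \sum_(k : J) A k j * g k.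
  under eq_bigr do rewrite mulr_suml.
  rewrite exchange_big; apply: eq_bigr => k _; rewrite mulr_sumr.
  by apply: eq_bigr => j _; rewrite mulrCA mulrA.
rewrite subrr addr0; under eq_bigr do rewrite big_mkcond mulr_sumr.
rewrite exchange_big; apply: eq_bigr => p _; rewrite mulr_sumr.
by apply: eq_bigr => j _; case: (b p); rewrite ?mulr0 ?mul0r// mulrC mulrAC mulrC mulrA.
Qed.

(** Backwards in time the point approaches [x = 1] with speed [c], while the boundary
    [1 - x = m1 * t] of the cone does so with speed [m1 <= c] only; the point cannot fall out of the
    cone. *)
Lemma char_range (R : realFieldType) (c t s x m1 : R) : 0 < c -> m1 <= c -> 0 <= x <= 1 ->
  1 - x < m1 * t -> t - (1 - x) / c <= s <= t ->
  0 <= x + c * t - c * s <= 1 /\ 1 - (x + c * t - c * s) < m1 * s.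
Proof.
move=> c0 mc /andP[x0 x1] D /andP[h1 h2].
have h3 : c * t - (1 - x) <= c * s.
  have := ler_wpM2l (ltW c0) h1; rewrite mulrBr.
  by have -> : c * ((1 - x) / c) = 1 - x by field; rewrite gt_eqF.
have h4 : c * s <= c * t by rewrite ler_wpM2l// ltW.
have h5 : 0 <= (c - m1) * (t - s) by rewrite mulr_ge0// subr_ge0.
split; first by apply/andP; split; lra.
by move: h5; rewrite mulrBl !mulrBr; lra.
Qed.

Section Backstepping.
Context {R : realType} {n m : nat}.
Local Notation leb := (@lebesgue_measure R).
Local Notation J := ('I_n + 'I_m)%type.
Variables (lam : 'I_n -> R) (mu : 'I_m -> R).
Variables (Spp : 'M[R]_n) (Spm : 'M[R]_(n, m)) (Smp : 'M[R]_(m, n)) (Smm : 'M[R]_m).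
Variables (Q0 : 'M[R]_(n, m)).
Variables (K : R -> R -> 'M[R]_(m, n)) (L : R -> R -> 'M[R]_m).
Variables (T : R) (z : J -> R -> R -> R) (z0 : J -> R -> R).

Local Notation A := (coupling Spp Spm Smp Smm).
Local Notation G := (kern K L).
Local Notation om := (omg mu Smm K L).
Local Notation rhs := (kernel_rhs mu Spp Spm Smp Smm K L).
Local Notation c := (speed lam mu).
Local Notation src := (source A z).
Local Notation Gx1 := (fun i j y => kern K L i j 1 y).
Local Notation base := (datum lam mu Gx1 Q0 T z z0).
Local Notation zt := (char_value lam mu A Gx1 Q0 T z z0).

Hypothesis mu_pos : forall i, 0 < mu i.
Hypothesis lam_pos : forall i, 0 < lam i.
Hypothesis mu_incr : forall i j : 'I_m, (i < j)%N -> mu i < mu j.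
Hypothesis hKL : backstepping_kernels lam mu Spp Spm Smp Smm Q0 K L.
Hypothesis mz : forall j, measurable2 R (z j).
Hypothesis mz0 : forall j, measurable_fun setT (z0 j).
Hypothesis z_zt : forall j t, 0 <= t <= T ->
  {ae leb, forall x, 0 <= x <= 1 -> z j t x = zt j t x}.
Hypothesis z_zt0 : forall i, {ae leb, forall t, 0 <= t <= T -> z (inr i) t 0 = zt (inr i) t 0}.
Hypothesis z_out : forall j t x, ~~ (0 <= x <= 1) -> z j t x = 0.
Hypothesis zi : forall j t, 0 <= t <= T -> int1 (z j t).
Hypothesis srci : forall j, int2 (fun s x => if 0 <= s <= T then src j s x else 0).
Hypothesis basei : forall j, int1 (base j).

Definition volterra (i : 'I_m) (t x : R) : R :=
  \int[leb]_(y in `[0, x]) \sum_(j : J) G i j x y * z j t y.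

(* The backstepping variable. Using char_value instead of z gives it a meaning at every
   point, whereas z solves the equations only for a.e. x at each time; defect accounts
   for the difference. *)
Definition beta (i : 'I_m) (t x : R) : R := zt (inr i) t x - volterra i t x.

Definition defect (i : 'I_m) (t x : R) : R := \sum_(j : J) A (inr i) j * (z j t x - zt j t x).

Let mG i j := measurable_kern hKL i j.
Let mrhs i j := measurable_kern_rhs hKL i j.
Let mb j : measurable_fun setT (base j).
Proof.
apply: measurable_datum => // i k.
by refine (measurableT_comp (mG i k) (g := fun y : R => (1 : R, y)) _); meas.
Qed.
Let ms j : measurable2 R (src j).
Proof. exact: measurable_source. Qed.
Let mzt j : measurable2 R (zt j).
Proof. exact: measurable_transport. Qed.

Let src_out j t x : ~~ (0 <= x <= 1) -> src j t x = 0.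
Proof. by move=> xo; rewrite /src big1// => k _; rewrite z_out ?mulr0. Qed.

Let G_int1 i j x t : 0 <= t <= T -> int1 (fun y => G i j x y * z j t y).
Proof.
move=> tT; have [M M0 HM] := kernel_bounded hKL.
apply: (eq_int1 (g := fun y => z j t y * G i j x y)) => [y|]; first by rewrite mulrC.
apply: (int1_bounded (M := M)) => //; first exact: zi.
by refine (measurableT_comp (mG i j) (g := fun y : R => (x, y)) _); meas.
Qed.

Let cut_int1 (a b : R) (f : R -> R) : int1 f -> int1 (fun y => if a <= y <= b then f y else 0).
Proof. by move=> fi; apply: (int1_cut (P := fun y => a <= y <= b)) => //; meas. Qed.

Let volterraE i t x : 0 <= t <= T ->
  volterra i t x = \sum_(j : J) \int[leb]_(y in `[0, x]) (G i j x y * z j t y).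
Proof.
move=> tT; rewrite /volterra Rint_if.
under [RHS]eq_bigr do rewrite Rint_if.
rewrite -Rint_sum; last by move=> j; apply: cut_int1; exact: G_int1.
by apply: eq_Rint => y; case: ifP => //; rewrite big1.
Qed.

Lemma measurable_volterra i : measurable2 R (volterra i).
Proof.
apply: (@measurable_Rint_itv _ _ _ (fun (p : R * R) y => \sum_(j : J) G i j p.2 y * z j p.1 y)); [|by meas|by meas].
have m1 : measurable_fun setT (fun t : (R * R) * R => t.1.1) by apply: measurableT_comp.
have m2 : measurable_fun setT (fun t : (R * R) * R => t.1.2) by apply: measurableT_comp.
apply: measurable_sumr => j; apply: measurable_funM.
  by refine (measurableT_comp (mG i j) (g := fun t : (R * R) * R => (t.1.2, t.2)) _); meas.
by refine (measurableT_comp (mz j) (g := fun t : (R * R) * R => (t.1.1, t.2)) _); meas.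
Qed.

Lemma measurable_beta i : measurable2 R (beta i).
Proof. by apply: measurable_funB; [exact: mzt|exact: measurable_volterra]. Qed.

Lemma measurable_defect i : measurable2 R (defect i).
Proof.
apply: measurable_sumr => k; apply: measurable_funM; first exact: measurable_cst.
by apply: measurable_funB; [exact: mz|exact: mzt].
Qed.

(** Holds at every time, not just almost every one: before [s] the characteristic runs in [x < 0],
    where there is no source, so [char_value] returns the inflow unchanged. *)
Lemma char_value_bottom k s : 0 < s <= T -> zt (inl k) s 0 = inflow0 Q0 z k s.
Proof.
move=> /andP[s0 sT]; have lk := lam_pos k.
rewrite /zt /transport /= sub0r ifF; last by rewrite oppr_ge0 leNgt mulr_gt0.
rewrite ifT; last by rewrite mulNr lerN2 ler_wpM2l ?(ltW lk)//= oppr_lt0 mulr_gt0.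
rewrite opprK mulrC mulKf ?gt_eqF// [X in _ + X](_ : _ = 0) ?addr0//.
rewrite Rint_if (Rint_ae (g := fun=> 0)) ?Rint_0//.
- by have h := ms (inl k); meas.
- have := ae_neq s; apply: aeS => r rs; case: ifP => // /andP[r0 rs'].
  apply: src_out; rewrite negb_and -ltNge; apply/orP; left.
  by rewrite sub0r oppr_lt0 mulr_gt0// subr_gt0 lt_neqAle rs.
Qed.

(** * The identity along one characteristic of [v_i] *)

Section Line.
Variables (i : 'I_m) (t x : R).
Hypothesis tT : 0 <= t <= T.
Hypothesis x01 : 0 <= x <= 1.
Let te := t - (1 - x) / mu i.
Hypothesis te0 : 0 < te.
Let g0 := x + mu i * t.
Let gam (s : R) := g0 - mu i * s.
Hypothesis line_int : int1 (fun r => if 0 <= r <= t then src (inr i) r (gam r) else 0).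

Let te_t : te <= t.
Proof. by rewrite /te lerBlDr lerDl divr_ge0 ?(ltW (mu_pos i))// subr_ge0; case/andP: x01. Qed.

Let gam_t : gam t = x. Proof. by rewrite /gam /g0; ring. Qed.
Let gam_te : gam te = 1.
Proof. by rewrite /gam /g0 /te; field; rewrite gt_eqF. Qed.

Let gam01 s : te <= s <= t -> 0 <= gam s <= 1.
Proof.
move=> /andP[h1 h2]; rewrite -gam_te; case/andP: x01 => x0 x1; rewrite /gam; apply/andP; split.
  apply: le_trans x0 _; rewrite -gam_t /gam lerD2l lerN2 ler_wpM2l// ltW//.
by rewrite lerD2l lerN2 ler_wpM2l// ltW.
Qed.

Let s0T s : te <= s <= t -> 0 < s <= T.
Proof.
move=> /andP[h1 h2]; case/andP: tT => _ tT'; rewrite (le_trans h2 tT') andbT.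
exact: lt_le_trans h1.
Qed.

Let X (j : J) (s : R) : R := if te <= s <= t then
    \int[leb]_(y in `[0, gam s]) (src j s y * G i j (gam s) y - z j s y * rhs i j (gam s) y)
    - (mu i + c j) * (zt j s (gam s) * G i j (gam s) (gam s))
    + c j * (zt j s 0 * G i j (gam s) 0) else 0.

(** [trapezoid] from the entry time [te], where [gam te = 1], up to [t], with the kernel in place of
    its backward transport. Under an integral in [y] one may replace [char_value] by [z]; in the
    fluxes, which are values at single points, [char_value] has to stay. *)
Let line_identity j : int1 (X j) /\
  \int[leb]_(y in `[0, x]) (G i j x y * z j t y) -
  \int[leb]_(y in `[0, 1]) (G i j 1 y * z j te y) = \int[leb]_s X j s.
Proof.
have [B [mB [M BM] HB]] := kernel_backward mu_pos lam_pos mu_incr hKL i j g0.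
have [MP MP0 HMP] := kernel_rhs_bounded hKL.
have te0' : 0 <= te by exact: ltW.
have be : t <= g0 / mu i.
  by rewrite ler_pdivlMr// /g0 mulrC lerDr; case/andP: x01.
have ga : 0 <= g0 - mu i * te by rewrite -/(gam te) gam_te.
have gb : 0 <= g0 - mu i * t by rewrite -/(gam t) gam_t; case/andP: x01.
have Si : int2 (fun s y => if 0 <= s <= t then src j s y else 0).
  apply: int2_le (srci j); first by have h := ms j; meas.
  move=> s y; case: ifP => [/andP[s0 st]|_]; last by rewrite normr0.
  by rewrite s0 (le_trans st)//; case/andP: tT.
have mP : measurable_fun setT (fun p : R * R => rhs i j (g0 - mu i * p.1) p.2).
  by refine (measurableT_comp (mrhs i j) (g := fun p : R * R => (g0 - mu i * p.1, p.2)) _); meas.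
have [] := @trapezoid R (c j) te t (g0 / mu i) (mu i) g0 M MP (base j) B (src j)
  (fun s y => rhs i j (g0 - mu i * s) y) te0' te_t be ga gb (basei j) (ms j) Si mB BM mP
  (fun s y => HMP i j (g0 - mu i * s) y).
set kap := backward _ _ _ _.
have kapE s y : te <= s <= t -> 0 <= y <= gam s -> kap s y = G i j (gam s) y.
  move=> st /andP[y0 y1]; rewrite /kap -HB// /in_triangle y0 y1 /=.
  by case/andP: (gam01 st).
rewrite -/(zt j) -/gam.
have XE s : (if te <= s <= t then
   \int[leb]_(y in `[0, gam s]) (src j s y * kap s y - zt j s y * rhs i j (gam s) y) -
   (mu i + c j) * (zt j s (gam s) * kap s (gam s)) + c j * (zt j s 0 * kap s 0) else 0) = X j s.
  rewrite /X; case: ifP => // st; have /andP[gs0 gs1] := gam01 st.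
  rewrite !kapE ?lexx ?gs0//; congr (_ - _ + _).
  rewrite !Rint_if; apply: Rint_ae.
  - apply: measurable_fun_ifT; [by meas| |exact: measurable_cst].
    apply: measurable_funB; apply: measurable_funM.
    + by have h := ms j; meas.
    + have mk := @measurable_backward R (c j) (g0 / mu i) B (fun s y => rhs i j (g0 - mu i * s) y) mB mP.
      by refine (measurableT_comp mk (g := fun y : R => (s, y)) _); meas.
    + by have h := mzt j; meas.
    + by refine (measurableT_comp (mrhs i j) (g := fun y : R => (gam s, y)) _); meas.
  - apply: measurable_fun_ifT; [by meas| |exact: measurable_cst].
    apply: measurable_funB; apply: measurable_funM.
    + by have h := ms j; meas.
    + by refine (measurableT_comp (mG i j) (g := fun y : R => (gam s, y)) _); meas.
    + by have h := mz j; meas.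
    + by refine (measurableT_comp (mrhs i j) (g := fun y : R => (gam s, y)) _); meas.
  - have sT : 0 <= s <= T by have /andP[h1 h2] := s0T st; rewrite (ltW h1) h2.
    have := z_zt j sT; apply: aeS => y hy; case: ifP => // /andP[y0 y1].
    by rewrite kapE ?y0// hy// y0 (le_trans y1).
move=> Xi XI; split; first by apply: eq_int1 Xi => s; rewrite -XE.
have YE s : te <= s <= t -> \int[leb]_(y in `[0, gam s]) (zt j s y * kap s y) =
    \int[leb]_(y in `[0, gam s]) (G i j (gam s) y * z j s y).
  move=> st; have /andP[gs0 gs1] := gam01 st; rewrite !Rint_if; apply: Rint_ae.
  - apply: measurable_fun_ifT; [by meas| |exact: measurable_cst].
    apply: measurable_funM; first by have h := mzt j; meas.
    have mk := @measurable_backward R (c j) (g0 / mu i) B (fun s y => rhs i j (g0 - mu i * s) y) mB mP.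
    by refine (measurableT_comp mk (g := fun y : R => (s, y)) _); meas.
  - apply: measurable_fun_ifT; [by meas| |exact: measurable_cst].
    apply: measurable_funM; last by have h := mz j; meas.
    by refine (measurableT_comp (mG i j) (g := fun y : R => (gam s, y)) _); meas.
  - have sT : 0 <= s <= T by have /andP[h1 h2] := s0T st; rewrite (ltW h1) h2.
    have := z_zt j sT; apply: aeS => y hy; case: ifP => // /andP[y0 y1].
    by rewrite kapE ?y0// hy ?y0 ?(le_trans y1)// mulrC.
have tt : te <= t <= t by rewrite te_t lexx.
have tete : te <= te <= t by rewrite te_t lexx.
have {}XI : \int[leb]_(y in `[0, gam t]) (zt j t y * kap t y) -
    \int[leb]_(y in `[0, gam te]) (zt j te y * kap te y) = \int[leb]_s X j s.
  by rewrite [LHS]XI; apply: eq_Rint => s; exact: XE.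
by move: XI; rewrite (YE _ tt) (YE _ tete) gam_t gam_te.
Qed.

Let bulk s : te <= s <= t ->
  \sum_(j : J) \int[leb]_(y in `[0, gam s]) (src j s y * G i j (gam s) y - z j s y * rhs i j (gam s) y) =
  \sum_(p < m | (i <= p)%N) om i p (gam s) * volterra p s (gam s).
Proof.
move=> st; have /andP[h1 h2] := s0T st; have sT : 0 <= s <= T by rewrite (ltW h1).
have /andP[gs0 gs1] := gam01 st; set x' := gam s.
have [M M0 HM] := kernel_bounded hKL; have [N N0 HN] := kernel_rhs_bounded hKL.
have Gi k p j : int1 (fun y => z k s y * G p j x' y).
  apply: (int1_bounded (M := M)) => //; first exact: zi.
  by refine (measurableT_comp (mG p j) (g := fun y : R => (x', y)) _); meas.
have srcG j : int1 (fun y => src j s y * G i j x' y).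
  apply: (eq_int1 (g := fun y => \sum_(k : J) A j k * (z k s y * G i j x' y))) => [y|].
    by rewrite /source mulr_suml; apply: eq_bigr => k _; rewrite mulrA.
  by apply: int1_sum => k; apply: int1Z; exact: Gi.
have zr j : int1 (fun y => z j s y * rhs i j x' y).
  apply: (int1_bounded (M := N)) => //; first exact: zi.
  by refine (measurableT_comp (mrhs i j) (g := fun y : R => (x', y)) _); meas.
under eq_bigr do rewrite Rint_if.
rewrite -Rint_sum; last by move=> j; apply: cut_int1; exact: int1B.
rewrite big_mkcond /=.
have Vi p : int1 (fun y => if 0 <= y <= x' then \sum_(j : J) G p j x' y * z j s y else 0).
  by apply: cut_int1; apply: int1_sum => j; exact: G_int1.
transitivity (\sum_(p < m) \int[leb]_y ((if (i <= p)%N then om i p x' else 0) *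
    (if 0 <= y <= x' then \sum_(j : J) G p j x' y * z j s y else 0))); last first.
  apply: eq_bigr => p _; rewrite RintZ// /volterra Rint_if.
  by case: ifP => _; rewrite ?mul0r.
rewrite -Rint_sum; last by move=> p; apply: int1Z.
apply: eq_Rint => y; case yx : (0 <= y <= x'); last first.
  by rewrite big1// [RHS]big1// => p _; rewrite mulr0.
have xy : in_triangle x' y by rewrite /in_triangle yx gs1.
rewrite -(bulk_algebra A (fun j => z j s y) (fun j => G i j x' y) (fun p j => G p j x' y)
  (fun p => om i p x') (fun p => (i <= p)%N)).
by apply: eq_bigr => j _; rewrite /kernel_rhs xy.
Qed.

(** The interior contributes the omega terms of [volterra] ([bulk]), the moving end the coupling of
    [v_i] minus the omega terms of [v] ([kernel_diag]), and the end 0 nothing ([kernel_bottom]). The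
    source contains [z] and the flux contains [char_value], which leaves [defect]. The condition
    [s != t] ensures [0 < gam s] even if [x = 0]. *)
Let X_sum s : te <= s <= t -> s != t -> (forall p, z (inr p) s 0 = zt (inr p) s 0) ->
  src (inr i) s (gam s) - \sum_(j : J) X j s =
  defect i s (gam s) + \sum_(p < m | (i <= p)%N) om i p (gam s) * beta p s (gam s).
Proof.
move=> st snt zz0; have gs := gam01 st; have /andP[gs0 gs1] := gs.
have gpos : 0 < gam s.
  case/andP: x01 => x0 _; apply: le_lt_trans x0 _; rewrite -gam_t /gam ltrD2l ltrN2 ltr_pM2l//.
  by case/andP: st => _ s_t; rewrite lt_neqAle snt.
have bot : \sum_(j : J) c j * (zt j s 0 * G i j (gam s) 0) = 0.
  apply: (@kernel_bottom _ _ _ _ _ _ _ _ _ _ _ _ mu_pos hKL i (gam s) (fun j => zt j s 0)); first by rewrite gpos gs1.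
  move=> k; rewrite char_value_bottom; last exact: s0T.
  by apply: eq_bigr => p _; rewrite zz0.
have diag : \sum_(j : J) (- (mu i + c j) * (zt j s (gam s) * G i j (gam s) (gam s))) =
   \sum_(j : J) A (inr i) j * zt j s (gam s) - \sum_(p < m | (i <= p)%N) om i p (gam s) * zt (inr p) s (gam s).
  under eq_bigr do rewrite mulrCA (kernel_diag mu_pos lam_pos mu_incr hKL i _ gs) mulrBr.
  rewrite sumrB; congr (_ - _); first by apply: eq_bigr => j _; rewrite mulrC.
  rewrite sum_J big1 ?add0r => [|k _]; last by rewrite mulr0.
  rewrite [RHS]big_mkcond; apply: eq_bigr => p _.
  by case: ifP => _; rewrite ?mulr0// mulrC.
have -> : \sum_(j : J) X j s = \sum_(p < m | (i <= p)%N) om i p (gam s) * volterra p s (gam s) +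
   (\sum_(j : J) A (inr i) j * zt j s (gam s) - \sum_(p < m | (i <= p)%N) om i p (gam s) * zt (inr p) s (gam s)).
  rewrite -bulk// -diag -[RHS]addr0 -[X in _ = _ + X]bot -!big_split /=.
  by apply: eq_bigr => j _; rewrite /X st mulNr.
have -> : defect i s (gam s) = src (inr i) s (gam s) - \sum_(j : J) A (inr i) j * zt j s (gam s).
  by rewrite /defect /source -sumrB; apply: eq_bigr => j _; rewrite mulrBr.
have -> : \sum_(p < m | (i <= p)%N) om i p (gam s) * beta p s (gam s) =
   \sum_(p < m | (i <= p)%N) om i p (gam s) * zt (inr p) s (gam s) -
   \sum_(p < m | (i <= p)%N) om i p (gam s) * volterra p s (gam s).
  by rewrite -sumrB; apply: eq_bigr => p _; rewrite /beta mulrBr.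
ring.
Qed.

(** There is no boundary term because the inflow of [v_i] at the time [te] is [volterra i te 1]: the
    control law is exactly [beta_i = 0] at [x = 1]. *)
Lemma beta_line : int1 (fun s => if te <= s <= t then
    defect i s (gam s) + \sum_(p < m | (i <= p)%N) om i p (gam s) * beta p s (gam s) else 0) /\
  beta i t x = \int[leb]_(s in `[te, t])
    (defect i s (gam s) + \sum_(p < m | (i <= p)%N) om i p (gam s) * beta p s (gam s)).
Proof.
have /andP[t0 tT'] := tT; have /andP[x0 x1] := x01; have mi := mu_pos i.
pose F (s : R) : R := if te <= s <= t then
    defect i s (gam s) + \sum_(p < m | (i <= p)%N) om i p (gam s) * beta p s (gam s) else 0.
pose Sr (s : R) : R := if te <= s <= t then src (inr i) s (gam s) else 0.
have Sri : int1 Sr.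
  have := @int1_sub R 0 t te t (fun s => src (inr i) s (gam s)) (ltW te0) (lexx t) line_int.
  exact.
have Xi j := (line_identity j).1; have XE j := (line_identity j).2.
have FE : {ae leb, forall s, F s = Sr s - \sum_(j : J) X j s}.
  have := aeI (ae_neq t) (ae_fin (fun p => z_zt0 p)); apply: aeS => s [snt zz].
  rewrite /F /Sr; case: ifP => st; last first.
    by rewrite big1 ?subrr// => j _; rewrite /X st.
  rewrite X_sum// => p; apply: zz; have /andP[h1 h2] := s0T st.
  by rewrite (ltW h1).
have mF : measurable_fun setT F.
  apply: measurable_fun_ifT; [by meas| |exact: measurable_cst].
  have mgam : measurable_fun setT gam by rewrite /gam; meas.
  apply: measurable_funD.
    by refine (measurableT_comp (measurable_defect i) (g := fun s : R => (s, gam s)) _); meas.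
  apply: measurable_sumr => p; apply: measurable_funM.
    by refine (measurableT_comp (measurable_omg hKL i p) (g := gam) _).
  by refine (measurableT_comp (measurable_beta p) (g := fun s : R => (s, gam s)) _); meas.
have Di : int1 (fun s => Sr s - \sum_(j : J) X j s) by apply: int1B => //; exact: int1_sum.
have Fi : int1 F by exact: int1_ae FE Di.
split => //; rewrite Rint_if -/F (Rint_ae mF (int1_meas Di) FE).
rewrite RintB//; last exact: int1_sum.
rewrite Rint_sum//; under [in RHS]eq_bigr do rewrite -XE.
rewrite sumrB -!volterraE//; last by rewrite (ltW te0) (le_trans te_t).
have mte : mu i * te = mu i * t - (1 - x) by rewrite /te; field; rewrite gt_eqF.
have xt1 : 1 < x + mu i * t by have := mulr_gt0 mi te0; rewrite mte; lra.
have ztE : zt (inr i) t x = volterra i te 1 + \int[leb]_s Sr s.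
  rewrite /char_value /transport [speed _ _ _]/= mulNr opprK; congr (_ + _).
    rewrite /datum ifF; last by apply/negbTE; rewrite negb_and -(ltNge 1) xt1 orbT.
    rewrite xt1 /= ifT; last by apply: lerD => //; rewrite ler_wpM2l// ltW.
    suff -> : (x + mu i * t - 1) / mu i = te by [].
    by rewrite /te; field; rewrite gt_eqF.
  rewrite Rint_if; apply: eq_Rint => r; rewrite /Sr.
  have -> : x - - mu i * (t - r) = gam r by rewrite /gam /g0; ring.
  (* Before [te] the extended line lies beyond [x = 1], where the source is 0. *)
  have [rte|rte] := leP te r; first by rewrite (le_trans (ltW te0) rte).
  rewrite [RHS]/=; case: ifP => // _; apply: src_out; rewrite negb_and -(ltNge 1).
  by rewrite -gam_te /gam ltrD2l ltrN2 ltr_pM2l// rte orbT.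
by rewrite /beta ztE; ring.
Qed.

End Line.

(** * Vanishing of the backstepping variable *)

Hypothesis zi2 : forall j, int2 (fun s x => if 0 <= s <= T then z j s x else 0).
Hypothesis T0 : 0 <= T.
Variables (m1 M : R).
Hypothesis mu_min : forall i, m1 <= mu i.
Hypothesis M0 : 0 <= M.
Hypothesis omM : forall i p x, `|om i p x| <= M.

Definition abs_sum (t x : R) : R := \sum_(j : J) `|z j t x|.

(* The points from which all characteristics of v, followed backwards, leave through
   x = 1 at a positive time. *)
Definition cone_beta (t x : R) : bool := (0 <= x <= 1) && (1 - x < m1 * t).

Definition beta_mass (t x : R) : R := if cone_beta t x then \sum_(i < m) `|beta i t x| else 0.

(** Dominates the integrand of [beta_line]. At each time the defect vanishes for almost every [y],
    but it need not vanish on one given characteristic; it drops out in [sweep_int], after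
    integration over all characteristics. *)
Definition sweep (t : R) (i : 'I_m) (s y : R) : R :=
  if (0 <= s <= t) && (0 <= y <= 1) then `|defect i s y| + M * beta_mass s y else 0.

Let mB := measurable_beta.
Let mD := measurable_defect.

Lemma measurable_abs_sum : measurable2 R abs_sum.
Proof. by apply: measurable_sumr => j; have h := mz j; meas. Qed.

Lemma measurable_beta_mass : measurable2 R beta_mass.
Proof.
apply: measurable_fun_ifT; [by rewrite /cone_beta; meas| |exact: measurable_cst].
by apply: measurable_sumr => i; have h := mB i; meas.
Qed.

Lemma measurable_sweep t i : measurable2 R (sweep t i).
Proof.
have mB' := measurable_beta_mass; have mDi := mD i.
by apply: measurable_fun_ifT; [by meas| |exact: measurable_cst]; meas.
Qed.

Lemma abs_sum_ge0 t x : 0 <= abs_sum t x. Proof. exact: sumr_ge0. Qed.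
Lemma beta_mass_ge0 t x : 0 <= beta_mass t x. Proof. by rewrite /beta_mass; case: ifP => // _; exact: sumr_ge0. Qed.
Lemma sweep_ge0 t i s x : 0 <= sweep t i s x.
Proof. by rewrite /sweep; case: ifP => // _; rewrite addr_ge0// mulr_ge0// beta_mass_ge0. Qed.

Lemma volterra_bound : exists2 N : R, 0 <= N & forall i t x,
  (`|volterra i t x|%:E <= N%:E * \int[leb]_(y in `[0%R, x]) (abs_sum t y)%:E)%E.
Proof.
have [N N0 HN] := kernel_bounded hKL; exists N => // i t x.
have mt := measurable_abs_sum.
rewrite /volterra Rint_if int_if.
have mf : measurable_fun setT (fun y : R => if 0 <= y <= x then \sum_(j : J) G i j x y * z j t y else 0).
  apply: measurable_fun_ifT; [by meas| |exact: measurable_cst].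
  apply: measurable_sumr => j; apply: measurable_funM; last by have h := mz j; meas.
  by refine (measurableT_comp (mG i j) (g := fun y : R => (x, y)) _); meas.
apply: le_trans (abs_Rint_le mf) _.
have mg : measurable_fun setT (fun y : R => (if (0 <= y <= x)%R then (abs_sum t y)%:E else 0)%E).
  by apply: measurable_fun_ifT; [by meas|by meas|exact: measurable_cst].
rewrite -ge0_integralZl//; last by move=> y _; case: ifP; rewrite // lee_fin abs_sum_ge0.
apply: le_int => [|||y].
- by meas.
- by apply: emeasurable_funM => //; exact: measurable_cst.
- by move=> y; rewrite lee_fin.
- case: ifP => _; last by rewrite normr0 mule0.
  rewrite -EFinM lee_fin /abs_sum mulr_sumr; apply: le_trans (ler_norm_sum _ _ _) _.
  by apply: ler_sum => j _; rewrite normrM ler_wpM2r.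
Qed.

Lemma beta_bound i t x : 0 <= t <= T -> cone_beta t x ->
  int1 (fun r => if 0 <= r <= t then src (inr i) r (x + mu i * t - mu i * r) else 0) ->
  (`|beta i t x|%:E <= \int[leb]_s (sweep t i s (x - (- mu i) * (t - s))%R)%:E)%E.
Proof.
move=> tT /andP[x01 D] li; have mi := mu_pos i.
have te0 : 0 < t - (1 - x) / mu i.
  rewrite subr_gt0 ltr_pdivrMr//; apply: lt_le_trans D _; rewrite mulrC ler_wpM2l//.
  by case/andP: tT.
have [Fi ->] := beta_line tT x01 te0 li.
rewrite Rint_if; apply: le_trans (abs_Rint_le (int1_meas Fi)) _.
have mF := int1_meas Fi; have msw := measurable_sweep t i.
apply: le_int => [|||s].
- by apply/measurable_EFinP; exact: (measurableT_comp (@normr_measurable _ setT) mF).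
- apply/measurable_EFinP.
  by refine (measurableT_comp msw (g := fun s : R => (s, x - (- mu i) * (t - s))) _); meas.
- by move=> s; rewrite lee_fin.
- rewrite lee_fin; case: ifP => st; last by rewrite normr0 sweep_ge0.
  have [g01 gD] := char_range mi (mu_min i) x01 D st.
  have -> : x - - mu i * (t - s) = x + mu i * t - mu i * s by ring.
  rewrite /sweep g01 andbT ifT; last first.
    by case/andP: st => h1 ->; rewrite andbT (le_trans _ h1)// ltW.
  rewrite /beta_mass /cone_beta g01 gD /=; apply: le_trans (ler_normD _ _) _; rewrite lerD2l.
  apply: le_trans (ler_norm_sum _ _ _) _; rewrite mulr_sumr big_mkcond.
  apply: ler_sum => p _; case: ifP => _; last by rewrite mulr_ge0.
  by rewrite normrM ler_wpM2r.
Qed.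

Lemma line_int_x i t : 0 <= t <= T -> {ae leb, forall y,
  int1 (fun r => if 0 <= r <= t then src (inr i) r (y - mu i * r) else 0)}.
Proof.
move=> /andP[t0 tT].
have := int2_ae (int2_swap (int2_shear (- mu i) (srci (inr i)))); apply: aeS => y.
have := @int1_sub R 0 T 0 t (fun r => src (inr i) r (y - mu i * r)) (lexx _) tT.
move=> h h'; apply: h; apply: eq_int1 h' => r.
by rewrite mulNr.
Qed.

Lemma defect_ae i s : 0 <= s <= T -> {ae leb, forall x, 0 <= x <= 1 -> defect i s x = 0}.
Proof.
move=> sT; have := ae_fin (fun j => z_zt j sT); apply: aeS => x h x01.
by rewrite /defect big1// => j _; rewrite h// subrr mulr0.
Qed.

Lemma sweep_int i t : 0 <= t <= T ->
  (\int[leb]_s \int[leb]_x (sweep t i s x)%:E <=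
   M%:E * \int[leb]_(s in `[0%R, t]) \int[leb]_x (beta_mass s x)%:E)%E.
Proof.
move=> /andP[t0 tT]; have mB' := measurable_beta_mass; have msw := measurable_sweep t i.
have IB0 s : (0 <= \int[leb]_x (beta_mass s x)%:E)%E by apply: integral_ge0 => x _; rewrite lee_fin beta_mass_ge0.
have mIB : measurable_fun setT (fun s => \int[leb]_x (beta_mass s x)%:E)%E.
  exact: (@measurable_int_EFin R beta_mass mB' beta_mass_ge0).
have mif : measurable_fun setT (fun s : R => if (0 <= s <= t)%R then \int[leb]_x (beta_mass s x)%:E else 0)%E.
  by apply: measurable_fun_ifT; [by meas|exact: mIB|exact: measurable_cst].
rewrite int_if -ge0_integralZl//; last by move=> s _; case: ifP.
apply: le_int => [|||s].
- exact: (@measurable_int_EFin R (sweep t i) msw (sweep_ge0 t i)).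
- by apply: emeasurable_funM => //; exact: measurable_cst.
- by move=> s; apply: integral_ge0 => x _; rewrite lee_fin sweep_ge0.
- rewrite /sweep; case: ifP => st /=; last by rewrite integral0 mule0.
  have sT : 0 <= s <= T by case/andP: st => -> /le_trans ->.
  have mBs : measurable_fun setT (beta_mass s) by meas.
  have mDs : measurable_fun setT (defect i s) by have h := mD i; meas.
  rewrite -ge0_integralZl//; last 2 first.
  + by meas.
  + by move=> x _; rewrite lee_fin beta_mass_ge0.
  apply: le_int_ae.
  + by apply/measurable_EFinP; apply: measurable_fun_ifT; [by meas| |exact: measurable_cst]; meas.
  + by apply: emeasurable_funM; [exact: measurable_cst|meas].
  + by move=> x; rewrite lee_fin; case: ifP => // _; rewrite addr_ge0// mulr_ge0// beta_mass_ge0.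
  + by move=> x; rewrite -EFinM lee_fin mulr_ge0// beta_mass_ge0.
  + have := defect_ae i sT; apply: aeS => x hx; rewrite -EFinM lee_fin; case: ifP => [x01|_].
      by rewrite hx// normr0 add0r.
    by rewrite mulr_ge0// beta_mass_ge0.
Qed.

Lemma beta_mass_ineq t : 0 <= t <= T ->
  (\int[leb]_x (beta_mass t x)%:E <=
   (m%:R * M)%:E * \int[leb]_(s in `[0%R, t]) \int[leb]_x (beta_mass s x)%:E)%E.
Proof.
move=> tT; have mB' := measurable_beta_mass.
have mIsw i : measurable_fun setT (fun x : R => \int[leb]_s (sweep t i s (x - (- mu i) * (t - s))%R)%:E)%E.
  have := @measurable_int_l R (fun x s : R => (sweep t i s (x - (- mu i) * (t - s))%R)%:E); apply.
    by apply/measurable_EFinP; have h := measurable_sweep t i; meas.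
  by move=> x s; rewrite lee_fin sweep_ge0.
have sw0 i (x : R) : (0 <= \int[leb]_s (sweep t i s (x - (- mu i) * (t - s))%R)%:E)%E.
  by apply: integral_ge0 => s _; rewrite lee_fin sweep_ge0.
apply: (@le_trans _ _ (\int[leb]_x \sum_(i < m) \int[leb]_s (sweep t i s (x - (- mu i) * (t - s))%R)%:E)%E).
  apply: le_int_ae.
  - by apply/measurable_EFinP; meas.
  - exact: emeasurable_sum.
  - by move=> x; rewrite lee_fin beta_mass_ge0.
  - by move=> x; exact: sume_ge0.
  - have := ae_fin (fun i => ae_affine (mu i * t) (oner_neq0 R) (line_int_x i tT)).
    apply: aeS => x li; rewrite /beta_mass; case: ifP => [D|_]; last exact: sume_ge0.
    rewrite -sumEFin; apply: lee_sum => i _; apply: beta_bound => //.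
    by apply: eq_int1 (li i) => r; rewrite mul1r.
rewrite ge0_integral_sum//.
have -> : ((m%:R * M)%:E * \int[leb]_(s in `[0%R, t]) \int[leb]_x (beta_mass s x)%:E =
   \sum_(i < m) (M%:E * \int[leb]_(s in `[0%R, t]) \int[leb]_x (beta_mass s x)%:E))%E.
  have -> : m%:R * M = \sum_(i < m) M by rewrite sumr_const card_ord mulr_natl.
  by rewrite -sumEFin ge0_sume_distrl.
apply: lee_sum => i _; apply: le_trans (sweep_int i tT).
rewrite le_eqVlt; apply/orP; left; apply/eqP.
apply: (@sweep_x R (- mu i) t (fun s x => (sweep t i s x)%:E)).
- by apply/measurable_EFinP; exact: measurable_sweep.
- by move=> s x; rewrite lee_fin sweep_ge0.
Qed.

Let mIt : measurable_fun setT (fun s => \int[leb]_x (abs_sum s x)%:E)%E.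
Proof.
exact: (@measurable_int_EFin R abs_sum measurable_abs_sum abs_sum_ge0).
Qed.

Let It0 s : (0 <= \int[leb]_x (abs_sum s x)%:E)%E.
Proof. by apply: integral_ge0 => x _; rewrite lee_fin abs_sum_ge0. Qed.

Lemma abs_sum_fin : (\int[leb]_(s in `[0%R, T]) \int[leb]_x (abs_sum s x)%:E < +oo)%E.
Proof.
have : int2 (fun s x => \sum_(j : J) `|if 0 <= s <= T then z j s x else 0|).
  elim: (index_enum _) => [|j r ih].
    split; first by apply: measurable_sumr => j; have h := mz j; meas.
    rewrite integral0_eq ?ltry// => s _; rewrite integral0_eq// => x _.
    by rewrite big_nil normr0.
  apply: eq_int2 (int2D (int2_norm (zi2 j)) ih) => s x.
  by rewrite big_cons.
move=> [_]; apply: le_lt_trans; rewrite int_if le_eqVlt; apply/orP; left; apply/eqP.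
apply: eq_integral => s _; case: ifP => sT.
  by apply: eq_integral => x _; rewrite ger0_norm ?sumr_ge0.
by rewrite integral0_eq// => x _; rewrite big1 ?normr0// => j _; rewrite normr0.
Qed.

(** The finiteness that Gronwall presupposes: on an interval of length 1 the variables [beta] are
    bounded in mean by the state plus [m] times a kernel bound times the total mass of the state. *)
Lemma beta_mass_fin : (\int[leb]_(s in `[0%R, T]) \int[leb]_x (beta_mass s x)%:E < +oo)%E.
Proof.
have [N N0 HN] := volterra_bound; have mB' := measurable_beta_mass; have mt := measurable_abs_sum.
have bnd (s : R) : 0 <= s <= T ->
    (\int[leb]_x (beta_mass s x)%:E <= (1 + m%:R * N)%:E * \int[leb]_x (abs_sum s x)%:E)%E.
  move=> sT; set I := (\int[leb]_x (abs_sum s x)%:E)%E; have I0 : (0 <= I)%E by exact: It0.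
  have mc : measurable_fun setT (fun x : R => if (0 <= x <= 1)%R then I else 0)%E.
    by apply: measurable_fun_ifT; [by meas|exact: measurable_cst|exact: measurable_cst].
  apply: (@le_trans _ _ (\int[leb]_x ((abs_sum s x)%:E + (m%:R * N)%:E * (if (0 <= x <= 1)%R then I else 0)))%E).
    apply: le_int_ae.
    - by meas.
    - by apply: emeasurable_funD; [meas|apply: emeasurable_funM => //; exact: measurable_cst].
    - by move=> x; rewrite lee_fin beta_mass_ge0.
    - move=> x; rewrite adde_ge0 ?lee_fin ?abs_sum_ge0// mule_ge0 ?lee_fin ?mulr_ge0//.
      by case: ifP.
    - have := ae_fin (fun j => z_zt j sT); apply: aeS => x hx.
      have r0 : (0 <= (m%:R * N)%:E * (if (0 <= x <= 1)%R then I else 0))%E.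
        by rewrite mule_ge0 ?lee_fin ?mulr_ge0//; case: ifP.
      rewrite /beta_mass /cone_beta; case: ifP => [/andP[x01 _]|_]; last by rewrite adde_ge0// lee_fin abs_sum_ge0.
      rewrite x01 -sumEFin; apply: (@le_trans _ _ (\sum_(i < m) (`|z (inr i) s x|%:E + N%:E * I))%E).
        apply: lee_sum => i _; rewrite /beta -hx//.
        apply: (@le_trans _ _ (`|z (inr i) s x| + `|volterra i s x|)%:E); first by rewrite lee_fin ler_normB.
        rewrite EFinD leeD2l//; apply: le_trans (HN i s x) _; apply: lee_wpmul2l; first by rewrite lee_fin.
        rewrite int_if; apply: le_int => [||y|y].
        + by apply: measurable_fun_ifT; [by meas|by meas|exact: measurable_cst].
        + by meas.
        + by case: ifP; rewrite // lee_fin abs_sum_ge0.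
        + by case: ifP; rewrite // lee_fin abs_sum_ge0.
      rewrite big_split/= sumEFin; apply: leeD.
        rewrite lee_fin /abs_sum sum_J lerDr; exact: sumr_ge0.
      have -> : m%:R * N = \sum_(i < m) N by rewrite sumr_const card_ord mulr_natl.
      by rewrite -sumEFin ge0_sume_distrl.
  rewrite ge0_integralD//; last 4 first.
  - by move=> x _; rewrite lee_fin abs_sum_ge0.
  - by meas.
  - by move=> x _; rewrite mule_ge0 ?lee_fin ?mulr_ge0//; case: ifP.
  - by apply: emeasurable_funM => //; exact: measurable_cst.
  rewrite ge0_integralZl//; last 2 first.
  - by move=> x _; case: ifP.
  - by rewrite lee_fin mulr_ge0.
  rewrite EFinD ge0_muleDl ?lee_fin ?mulr_ge0// mul1e leeD2l// lee_wpmul2l ?lee_fin ?mulr_ge0//.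
  by rewrite -int_if (integral_cst leb _ I)//= lebesgue_measure_itv/= lte_fin ltr01 -EFinB subr0 mule1.
apply: (@le_lt_trans _ _ ((1 + m%:R * N)%:E * \int[leb]_(s in `[0%R, T]) \int[leb]_x (abs_sum s x)%:E)%E); last first.
  by rewrite lte_mul_pinfty ?abs_sum_fin// lee_fin addr_ge0// mulr_ge0.
rewrite !int_if -ge0_integralZl//; last 3 first.
- by apply: measurable_fun_ifT; [by meas|exact: mIt|exact: measurable_cst].
- by move=> s _; case: ifP.
- by rewrite lee_fin addr_ge0// mulr_ge0.
apply: le_int => [||s|s].
- apply: measurable_fun_ifT; [by meas| |exact: measurable_cst].
  exact: (@measurable_int_EFin R beta_mass mB' beta_mass_ge0).
- apply: emeasurable_funM; first exact: measurable_cst.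
  by apply: measurable_fun_ifT; [by meas|exact: mIt|exact: measurable_cst].
- by case: ifP => // _; apply: integral_ge0 => x _; rewrite lee_fin beta_mass_ge0.
- by case: ifP => sT; [exact: bnd|rewrite mule0].
Qed.

Lemma beta_mass_zero t : 0 <= t <= T -> {ae leb, forall x, beta_mass t x = 0}.
Proof. exact: (@Gronwall_zero R T (m%:R * M) beta_mass T0 measurable_beta_mass beta_mass_ge0 beta_mass_fin beta_mass_ineq). Qed.

Lemma beta0_x i t : 0 <= t <= T -> {ae leb, forall x, cone_beta t x -> beta i t x = 0}.
Proof.
move=> tT; apply: aeS (beta_mass_zero tT) => x; rewrite /beta_mass; case: ifP => // _.
by move/psumr_eq0P => h _; apply/eqP; rewrite -normr_eq0 h.
Qed.

(** [beta0_x] says nothing about the null set [x = 0]. Here the characteristics ending at [x = 0]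
    are swept in time by [sweep_t], with [sweep T] in place of [sweep t] so that the integrand does
    not change with the time of arrival. *)
Lemma beta0_0 i : {ae leb, forall t, 0 <= t <= T -> cone_beta t 0 -> beta i t 0 = 0}.
Proof.
have mi := mu_pos i; have mBi := mB i; have msw := measurable_sweep T i.
pose W (t : R) : R := if (0 <= t <= T) && cone_beta t 0 then `|beta i t 0| else 0.
suff : {ae leb, forall t, W t = 0}.
  apply: aeS => t; rewrite /W => + tT c; rewrite tT c /= => /eqP.
  by rewrite normr_eq0 => /eqP.
have mW : measurable_fun setT W.
  apply: measurable_fun_ifT; [by rewrite /cone_beta; meas| |exact: measurable_cst].
  apply: (measurableT_comp (@normr_measurable _ setT)).
  by refine (measurableT_comp mBi (g := fun t : R => (t, 0 : R)) _); meas.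
apply: int_ae0 => //; first by move=> t; rewrite /W; case: ifP.
have TT : 0 <= T <= T by rewrite T0 lexx.
have swT0 : (\int[leb]_s \int[leb]_x (sweep T i s x)%:E <= 0)%E.
  apply: le_trans (sweep_int i TT) _; rewrite int_if integral0_eq ?mule0// => s _.
  case: ifP => // sT; have mBs : measurable_fun setT (beta_mass s) by have h := measurable_beta_mass; meas.
  rewrite (ae_eq_integral (cst 0)%E) ?integral0//; first by meas.
  by have := beta_mass_zero sT; apply: aeS => x -> _.
apply: (@le_trans _ _ (\int[leb]_t \int[leb]_s (sweep T i s (0 - (- mu i) * (t - s))%R)%:E)%E); last first.
  rewrite (@sweep_t R (- mu i) 0 (fun s x => (sweep T i s x)%:E))//.
  - rewrite normrN mule_ge0_le0// lee_fin invr_ge0//.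
  - by rewrite oppr_eq0 gt_eqF.
  - by apply/measurable_EFinP; exact: measurable_sweep.
  - by move=> s x; rewrite lee_fin sweep_ge0.
have sw0 (t : R) : (0 <= \int[leb]_s (sweep T i s (0 - (- mu i) * (t - s))%R)%:E)%E.
  by apply: integral_ge0 => s _; rewrite lee_fin sweep_ge0.
apply: le_int_ae => //.
- exact/measurable_EFinP.
- have := @measurable_int_l R (fun t s => (sweep T i s (0 - (- mu i) * (t - s))%R)%:E); apply.
    by apply/measurable_EFinP; meas.
  by move=> t s; rewrite lee_fin sweep_ge0.
- by move=> t; rewrite lee_fin /W; case: ifP.
have := ae_affine 0 (lt0r_neq0 mi) (line_int_x i TT); apply: aeS => t li.
rewrite /W; case: ifP => // /andP[tT c].
apply: le_trans (@beta_bound i t 0 tT c _) _.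
  have /andP[_ tT'] := tT.
  apply: (@int1_sub R 0 T 0 t (fun r => src (inr i) r (0 + mu i * t - mu i * r))) => //.
  by apply: eq_int1 li => r; rewrite add0r addr0.
apply: le_int => [||s|s].
- by apply/measurable_EFinP; have h := measurable_sweep t i; meas.
- by apply/measurable_EFinP; meas.
- by rewrite lee_fin sweep_ge0.
- rewrite lee_fin; set y := 0 - _; rewrite {1}/sweep; case: ifP => [/andP[/andP[s0 st] y01]|_]; last exact: sweep_ge0.
  by rewrite /sweep s0 y01 (le_trans st)//; case/andP: tT.
Qed.

(** At [x = 0] the Volterra integral extends over a single point, so that [beta] and [v] coincide
    there. *)
Lemma state_bottom_zero : {ae leb, forall t, 0 <= t <= T -> cone_beta t 0 -> forall i, z (inr i) t 0 = 0}.
Proof.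
have := aeI (ae_fin beta0_0) (ae_fin z_zt0); apply: aeS => t [b0 zz] tT c i.
rewrite zz//; have := b0 i tT c; rewrite /beta => /eqP; rewrite subr_eq0 => /eqP ->.
by rewrite /volterra set_itv1 Rintegral_set1.
Qed.

End Backstepping.

(** * Extinction of the state *)

Section Extinction.
Context {R : realType} {n m : nat}.
Local Notation leb := (@lebesgue_measure R).
Local Notation J := ('I_n + 'I_m)%type.
Variables (lam : 'I_n -> R) (mu : 'I_m -> R) (A : J -> J -> R).
Variables (G1 : 'I_m -> J -> R -> R) (Q0 : 'M[R]_(n, m)) (T : R).
Variables (z : J -> R -> R -> R) (z0 : J -> R -> R).
Variables (t1 l1 a N : R).

Local Notation zt := (char_value lam mu A G1 Q0 T z z0).
Local Notation src := (source A z).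
Local Notation mag := (abs_sum z).

Hypothesis lam_min : forall k, l1 <= lam k.
Hypothesis l1_pos : 0 < l1.
Hypothesis t1_ge0 : 0 < t1.
Hypothesis T0 : 0 <= T.
Hypothesis a0 : 0 <= a.
Hypothesis N0 : 0 <= N.
Hypothesis Aa : forall j k, `|A j k| <= a.
Hypothesis mz : forall j, measurable2 R (z j).
Hypothesis z_zt : forall j t, 0 <= t <= T ->
  {ae leb, forall x, 0 <= x <= 1 -> z j t x = zt j t x}.
Hypothesis z_out : forall j t x, ~~ (0 <= x <= 1) -> z j t x = 0.
Hypothesis zi : forall j t, 0 <= t <= T -> int1 (z j t).
Hypothesis abs_sum_fin : (\int[leb]_(s in `[0%R, T]) \int[leb]_x (mag s x)%:E < +oo)%E.
Hypothesis v_bound : forall t, t1 <= t <= T -> {ae leb, forall x, 0 <= x <= 1 -> forall i,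
  (`|z (inr i) t x|%:E <= N%:E * \int[leb]_(y in `[0%R, x]) (mag t y)%:E)%E}.
Hypothesis bottom : {ae leb, forall t, t1 <= t <= T -> forall i, z (inr i) t 0 = 0}.

(* Backwards in time, the characteristics of u from this set stay in it until they leave
   through x = 0 after the time t1. *)
Definition cone_state (t x : R) : bool := (0 <= x <= 1) && (x <= l1 * (t - t1)).

Definition mass (t x : R) : R := if cone_state t x then mag t x else 0.
Definition mass_u (t x : R) : R := if cone_state t x then \sum_(k < n) `|z (inl k) t x| else 0.
Definition mass_v (t x : R) : R := if cone_state t x then \sum_(i < m) `|z (inr i) t x| else 0.

Let WE t x : mass t x = mass_u t x + mass_v t x.
Proof. by rewrite /mass /mass_u /mass_v; case: ifP; rewrite ?addr0// /abs_sum sum_J. Qed.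

Let WU0 t x : 0 <= mass_u t x. Proof. by rewrite /mass_u; case: ifP => // _; exact: sumr_ge0. Qed.
Let WV0 t x : 0 <= mass_v t x. Proof. by rewrite /mass_v; case: ifP => // _; exact: sumr_ge0. Qed.
Let W0 t x : 0 <= mass t x. Proof. by rewrite WE addr_ge0. Qed.

Let mt : measurable2 R mag.
Proof. exact: measurable_abs_sum. Qed.
Let mc : measurable2 R cone_state.
Proof. by rewrite /cone_state; meas. Qed.
Let mW : measurable2 R mass.
Proof. by apply: measurable_fun_ifT; [exact: mc|exact: mt|exact: measurable_cst]. Qed.
Let mWU : measurable2 R mass_u.
Proof.
apply: measurable_fun_ifT; [exact: mc| |exact: measurable_cst].
by apply: measurable_sumr => k; have h := mz (inl k); meas.
Qed.
Let mWV : measurable2 R mass_v.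
Proof.
apply: measurable_fun_ifT; [exact: mc| |exact: measurable_cst].
by apply: measurable_sumr => k; have h := mz (inr k); meas.
Qed.

Let cone2_t1 t x : cone_state t x -> t1 <= t.
Proof.
by move=> /andP[/andP[x0 _] xl]; have := le_trans x0 xl; rewrite pmulr_rge0// subr_ge0.
Qed.

Let src_le j t x : `|src j t x| <= a * mag t x.
Proof.
rewrite /source /abs_sum mulr_sumr; apply: le_trans (ler_norm_sum _ _ _) _.
by apply: ler_sum => k _; rewrite normrM ler_wpM2r.
Qed.

(** No datum is left: the characteristic entered through [x = 0] no earlier than [t1], when the
    inflow [Q0 v] is 0. Only the source remains, and it is taken at points of the cone. *)
Let u_bound k t : 0 <= t <= T -> {ae leb, forall x, cone_state t x ->
  (`|z (inl k) t x|%:E <=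
   \int[leb]_s (if (0 <= s <= t)%R then a * mass s (x - lam k * (t - s)) else 0)%R%:E)%E}.
Proof.
move=> tT; have /andP[t0 tT'] := tT.
have lk : 0 < lam k := lt_le_trans l1_pos (lam_min k).
have li : - (lam k)^-1 != 0 by rewrite oppr_eq0 invr_eq0 gt_eqF.
(* [bottom] concerns almost every time; the map from [x] to the entry time [t - x / lam k] is affine
   and pulls null sets back to null sets. *)
have := aeI (z_zt (inl k) tT) (ae_affine t li bottom); apply: aeS => x [zx bx] c.
have := c => /andP[x01 xl]; have /andP[x0 x1] := x01.
have tt1 : t1 <= t := cone2_t1 c.
have lt1 : l1 * (t - t1) <= lam k * (t - t1) by rewrite ler_wpM2r// subr_ge0.
have y0 : x - lam k * t < 0.
  have : lam k * (t - t1) < lam k * t by rewrite ltr_pM2l// gtrBl.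
  by rewrite subr_lt0; apply: le_lt_trans; exact: le_trans lt1.
have teE : - (x - lam k * t) / lam k = - (lam k)^-1 * x + t by field; rewrite gt_eqF.
have te1 : t1 <= - (lam k)^-1 * x + t <= T.
  apply/andP; split.
    rewrite mulNr mulrC addrC lerBrDr -lerBrDl ler_pdivrMr// mulrC; exact: le_trans lt1.
  by apply: le_trans tT'; rewrite mulNr gerDr oppr_le0 mulr_ge0// invr_ge0 ltW.
rewrite zx// /char_value /transport /= ifF; last by rewrite leNgt y0.
have yT : - lam k * T <= x - lam k * t.
  have : lam k * t <= lam k * T by rewrite ler_wpM2l// ltW.
  by rewrite mulNr; lra.
rewrite yT y0 /= teE /inflow0 big1 ?add0r => [|p _]; last by rewrite bx// mulr0.
have ms := measurable_source A mz (inl k).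
rewrite Rint_if; apply: le_trans (abs_Rint_le _) _.
  by apply: measurable_fun_ifT; [by meas| |exact: measurable_cst]; meas.
apply: le_int => [|||s].
- apply/measurable_EFinP; apply: (measurableT_comp (@normr_measurable _ setT)).
  by apply: measurable_fun_ifT; [by meas| |exact: measurable_cst]; meas.
- apply/measurable_EFinP.
  by apply: measurable_fun_ifT; [by meas| |exact: measurable_cst]; meas.
- by move=> s; rewrite lee_fin.
- rewrite lee_fin; case: ifP => [/andP[s0 st]|_]; last by rewrite normr0.
  set y := x - _; have [y01|yo] := boolP (0 <= y <= 1); last first.
    rewrite /source big1 ?normr0 ?mulr_ge0// => j _; rewrite z_out ?mulr0//.
  apply: le_trans (src_le _ _ _) _; rewrite /mass /cone_state y01 ifT//.
  rewrite /y; have : l1 * (t - s) <= lam k * (t - s) by rewrite ler_wpM2r// subr_ge0.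
  by move: xl; rewrite !mulrBr; lra.
Qed.

Let U_ineq t : 0 <= t <= T ->
  (\int[leb]_x (mass_u t x)%:E <= (n%:R * a)%:E * \int[leb]_(s in `[0%R, t]) \int[leb]_x (mass s x)%:E)%E.
Proof.
move=> tT.
pose h (s y : R) : R := if 0 <= s <= t then a * mass s y else 0.
have h0 s y : 0 <= h s y by rewrite /h; case: ifP => // _; rewrite mulr_ge0.
have mh : measurable2 R h.
  by apply: measurable_fun_ifT; [by meas| |exact: measurable_cst]; meas.
have mI k : measurable_fun setT (fun x : R => \int[leb]_s (h s (x - lam k * (t - s))%R)%:E)%E.
  have := @measurable_int_l R (fun x s : R => (h s (x - lam k * (t - s))%R)%:E); apply.
    by apply/measurable_EFinP; meas.
  by move=> x s; rewrite lee_fin.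
have I0 k (x : R) : (0 <= \int[leb]_s (h s (x - lam k * (t - s))%R)%:E)%E.
  by apply: integral_ge0 => s _; rewrite lee_fin.
apply: (@le_trans _ _ (\int[leb]_x \sum_(k < n) \int[leb]_s (h s (x - lam k * (t - s))%R)%:E)%E).
  apply: le_int_ae.
  - by apply/measurable_EFinP; meas.
  - exact: emeasurable_sum.
  - by move=> x; rewrite lee_fin.
  - by move=> x; exact: sume_ge0.
  - have := ae_fin (fun k => u_bound k tT); apply: aeS => x hx; rewrite /mass_u.
    case: ifP => c; last exact: sume_ge0.
    by rewrite -sumEFin; apply: lee_sum => k _; exact: hx.
rewrite ge0_integral_sum//.
have -> : n%:R * a = \sum_(k < n) a by rewrite sumr_const card_ord mulr_natl.
rewrite -sumEFin ge0_sume_distrl//; apply: lee_sum => k _.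
rewrite (@sweep_x R (lam k) t (fun s x => (h s x)%:E)); last 2 first.
- exact/measurable_EFinP.
- by move=> s x; rewrite lee_fin.
have mI' : measurable_fun setT (fun s => \int[leb]_x (mass s x)%:E)%E.
  exact: (@measurable_int_EFin R mass mW W0).
have IW0 s : (0 <= \int[leb]_x (mass s x)%:E)%E by apply: integral_ge0 => x _; rewrite lee_fin.
rewrite int_if -ge0_integralZl//; last 2 first.
- by apply: measurable_fun_ifT; [by meas|exact: mI'|exact: measurable_cst].
- by move=> s _; case: ifP.
apply: le_int => [|||s].
- exact: (@measurable_int_EFin R h mh h0).
- apply: emeasurable_funM; first exact: measurable_cst.
  by apply: measurable_fun_ifT; [by meas|exact: mI'|exact: measurable_cst].
- by move=> s; apply: integral_ge0 => x _; rewrite lee_fin.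
- rewrite /h; case: ifP => st; last by rewrite integral0 mule0.
  rewrite -ge0_integralZl//; last 2 first.
  + by apply/measurable_EFinP; meas.
  + by move=> x _; rewrite lee_fin.
Qed.

Let CV : R := expR (2 * (m%:R * N + 1)) / (m%:R * N + 1) * (m%:R * N).

Let mN0 : 0 <= m%:R * N. Proof. by rewrite mulr_ge0. Qed.

(** At fixed [t] the bound on [v] is a Volterra inequality in space, so Gronwall is applied with [x]
    as the time variable. The cone at time [t] is the interval [[0, xb]] with [xb <= 1], which gives
    the constant [CV]. *)
Let V_ineq t : 0 <= t <= T -> (\int[leb]_x (mass_v t x)%:E <= CV%:E * \int[leb]_x (mass_u t x)%:E)%E.
Proof.
move=> tT; set IU := (\int[leb]_x (mass_u t x)%:E)%E.
have IU0 : (0 <= IU)%E by apply: integral_ge0 => x _; rewrite lee_fin.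
have CV0 : 0 <= CV by rewrite mulr_ge0// divr_ge0 ?expR_ge0// addr_ge0.
have [tt1|tt1] := leP t1 t; last first.
  rewrite integral0_eq ?mule_ge0 ?lee_fin// => x _; rewrite /mass_v ifF//.
  by apply/negP => /cone2_t1; rewrite leNgt tt1.
pose xb := Num.min 1 (l1 * (t - t1)).
have xb0 : 0 <= xb by rewrite le_min ler01 mulr_ge0 ?subr_ge0// ltW.
have xb1 : xb <= 1 by rewrite ge_min lexx.
have coneE x : cone_state t x = (0 <= x <= xb) by rewrite /cone_state le_min andbA.
have mWVt : measurable_fun setT (mass_v t) by have h := mWV; meas.
have mWUt : measurable_fun setT (mass_u t) by have h := mWU; meas.
have mtt : measurable_fun setT (mag t) by have h := mt; meas.
have IVE : (\int[leb]_x (mass_v t x)%:E = \int[leb]_(x in `[0%R, xb]) (mass_v t x)%:E)%E.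
  rewrite int_if; apply: eq_integral => x _; rewrite -coneE.
  by rewrite /mass_v; case: ifP.
have fin : (\int[leb]_(x in `[0%R, xb]) (mass_v t x)%:E < +oo)%E.
  rewrite -IVE; have [_] := (int1P _).1 (int1_sum (index_enum _) (fun j => int1_norm (zi j tT))).
  apply: le_lt_trans; apply: le_int => [||x|x].
  - exact/measurable_EFinP.
  - by apply/measurable_EFinP; exact: (measurableT_comp (@normr_measurable _ setT) mtt).
  - by rewrite lee_fin.
  - rewrite lee_fin /mass_v; case: ifP => _ //; apply: le_trans (ler_norm _).
    by rewrite sum_J lerDr sumr_ge0.
have C0 : 0 < m%:R * N + 1 by rewrite ltr_pwDr.
rewrite IVE; apply: le_trans (@Gronwall R xb (m%:R * N + 1) ((m%:R * N)%:E * IU)%E (fun x => (mass_v t x)%:E) C0 xb0 _ _ _ fin _) _.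
- by rewrite mule_ge0// lee_fin.
- exact/measurable_EFinP.
- by move=> x; rewrite lee_fin.
- have tt : t1 <= t <= T by rewrite tt1; case/andP: tT.
  have := v_bound tt; apply: aeS => x hx /andP[x0 xxb].
  have I0 : (0 <= \int[leb]_(s in `[0%R, x]) (mass_v t s)%:E)%E by apply: integral_ge0 => s _; rewrite lee_fin.
  apply: (@le_trans _ _ ((m%:R * N)%:E * (IU + \int[leb]_(s in `[0%R, x]) (mass_v t s)%:E))%E); last first.
    rewrite ge0_muleDr// leeD2l// lee_wpmul2r// lee_fin lerDl//.
  rewrite /mass_v coneE x0 xxb/= -sumEFin.
  have -> : m%:R * N = \sum_(i < m) N by rewrite sumr_const card_ord mulr_natl.
  rewrite -sumEFin ge0_sume_distrl//; apply: lee_sum => i _.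
  apply: le_trans (hx _ i) _; first by rewrite x0 (le_trans xxb).
  rewrite lee_wpmul2l ?lee_fin//.
  apply: (@le_trans _ _ (\int[leb]_(s in `[0%R, x]) (mass_u t s)%:E + \int[leb]_(s in `[0%R, x]) (mass_v t s)%:E)%E).
    rewrite !int_if -ge0_integralD//; last 4 first.
    + by move=> s _; case: ifP; rewrite // lee_fin.
    + by apply: measurable_fun_ifT; [by meas|by meas|exact: measurable_cst].
    + by move=> s _; case: ifP; rewrite // lee_fin.
    + by apply: measurable_fun_ifT; [by meas|by meas|exact: measurable_cst].
    rewrite le_eqVlt; apply/orP; left; apply/eqP; apply: eq_integral => s _.
    case: ifP => [/andP[s0 sx]|_]; last by rewrite adde0.
    by rewrite -EFinD -WE /mass coneE s0 (le_trans sx).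
  rewrite leeD2r// int_if; apply: le_int => [||s|s].
  + by apply: measurable_fun_ifT; [by meas|by meas|exact: measurable_cst].
  + by meas.
  + by case: ifP; rewrite // lee_fin.
  + by case: ifP; rewrite // lee_fin.
- rewrite muleA -EFinM lee_wpmul2r// lee_fin /CV ler_wpM2r// ler_wpM2r ?invr_ge0 ?(ltW C0)//.
  by rewrite ler_expR ler_piMr// mulr_ge0// ltW.
Qed.

Lemma mass_zero t : 0 <= t <= T -> {ae leb, forall x, mass t x = 0}.
Proof.
have CV0 : 0 <= CV by rewrite mulr_ge0// divr_ge0 ?expR_ge0// addr_ge0.
move: t; apply: (@Gronwall_zero R T ((1 + CV) * (n%:R * a)) mass T0 mW W0).
  apply: le_lt_trans abs_sum_fin; rewrite !int_if; apply: le_int => [||s|s].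
  - apply: measurable_fun_ifT; [by meas| |exact: measurable_cst].
    exact: (@measurable_int_EFin R mass mW W0).
  - apply: measurable_fun_ifT; [by meas| |exact: measurable_cst].
    exact: (@measurable_int_EFin R mag mt (abs_sum_ge0 z)).
  - by case: ifP => // _; apply: integral_ge0 => x _; rewrite lee_fin.
  - case: ifP => // _; have mWs : measurable_fun setT (mass s) by have h := mW; meas.
    have mts : measurable_fun setT (mag s) by have h := mt; meas.
    apply: le_int => [||x|x].
    + exact/measurable_EFinP.
    + exact/measurable_EFinP.
    + by rewrite lee_fin.
    + by rewrite lee_fin /mass; case: ifP => // _; exact: abs_sum_ge0.
move=> t tT.
have -> : (\int[leb]_x (mass t x)%:E = \int[leb]_x (mass_u t x)%:E + \int[leb]_x (mass_v t x)%:E)%E.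
  have mWVt : measurable_fun setT (mass_v t) by have h := mWV; meas.
  have mWUt : measurable_fun setT (mass_u t) by have h := mWU; meas.
  rewrite -ge0_integralD//.
  - by apply: eq_integral => x _; rewrite WE.
  - by move=> x _; rewrite lee_fin.
  - exact/measurable_EFinP.
  - by move=> x _; rewrite lee_fin.
  - exact/measurable_EFinP.
have IU0 : (0 <= \int[leb]_x (mass_u t x)%:E)%E by apply: integral_ge0 => x _; rewrite lee_fin.
apply: (@le_trans _ _ ((1 + CV)%:E * \int[leb]_x (mass_u t x)%:E)%E).
  by rewrite EFinD ge0_muleDl ?lee_fin// mul1e leeD2l// V_ineq.
by rewrite [X in (_ <= X * _)%E]EFinM -muleA lee_wpmul2l ?lee_fin ?addr_ge0// U_ineq.
Qed.

(** The condition on [t] says that the cone has filled [[0, 1]]. *)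
Lemma state_zero t : 0 <= t <= T -> 1 <= l1 * (t - t1) ->
  {ae leb, forall x, 0 <= x <= 1 -> forall j, z j t x = 0}.
Proof.
move=> tT l1t; apply: aeS (mass_zero tT) => x + x01 j.
have /andP[_ x1] := x01.
rewrite /mass /cone_state x01 (le_trans x1 l1t) /= => /psumr_eq0P h.
by apply/eqP; rewrite -normr_eq0 h.
Qed.

End Extinction.

(** * The closed-loop system *)

Section Norm.
Context {R : realType} {n m : nat}.
Local Notation leb := (@lebesgue_measure R).
Local Notation J := ('I_n + 'I_m)%type.

Definition component (a : 'cV[R]_n) (b : 'cV[R]_m) (j : J) : R :=
  match j with inl i => a i 0 | inr i => b i 0 end.

Definition on01 (f : R -> 'cV[R]_n) (g : R -> 'cV[R]_m) (j : J) (x : R) : R :=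
  if 0 <= x <= 1 then component (f x) (g x) j else 0.

Lemma L2norm_sqr (f : R -> 'cV[R]_n) (g : R -> 'cV[R]_m) :
  (L2norm f g ^+ 2 = \int[leb]_x (\sum_(j : J) on01 f g j x ^+ 2)%:E)%E.
Proof.
have L0 : (0 <= L2norm f g)%E by exact: Lnorm_ge0.
have -> : (L2norm f g ^+ 2 = (L2norm f g) `^ 2)%E.
  rewrite expe2; case: (L2norm f g) L0 => [r r0||//]; last by rewrite poweRyr ?mulyy// pnatr_eq0.
  by rewrite poweR_EFin powR_mulrn// expr2 EFinM.
rewrite /L2norm poweR_Lnorm ?pnatr_eq0//; apply: eq_integral => x _.
rewrite /= patchE mem_setE in_itv/=; case: ifP => x01.
  have s0 : 0 <= \sum_(i < n) f x i 0 ^+ 2 + \sum_(j < m) g x j 0 ^+ 2.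
    by apply: addr_ge0; apply: sumr_ge0 => ? _; exact: sqr_ge0.
  rewrite /= ger0_norm ?sqrtr_ge0// powR_mulrn ?sqrtr_ge0// sqr_sqrtr// sum_J.
  by congr (_ + _)%:E; apply: eq_bigr => i _; rewrite /on01 x01.
rewrite (_ : point = 0%E)//= normr0 powR0 ?pnatr_eq0// big1// => j _.
by rewrite /on01 x01 expr0n.
Qed.

(** Since [1 <= k] implies [k <= k ^+ 2], the constant can be kept without extracting a square
    root. *)
Lemma le_sqr_ereal (k : R) (x y : \bar R) : (1 <= k)%R -> (0 <= x)%E -> (0 <= y)%E ->
  (x ^+ 2 <= k%:E * y ^+ 2)%E -> (x <= k%:E * y)%E.
Proof.
move=> k1; have k0 : 0 < k by exact: lt_le_trans k1.
case: y => [b| |//]; last by move=> _ _ _; rewrite gt0_muley ?lte_fin// leey.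
case: x => [a| |//]; last by move=> _ _; rewrite !expe2 -!EFinM mulyy.
rewrite !expe2 -!EFinM !lee_fin => a0 b0 h.
have kb : 0 <= k * b by rewrite mulr_ge0// ltW.
rewrite -(@ler_pXn2r _ 2)// ?nnegrE// !expr2 (le_trans h)//.
rewrite mulrACA ler_wpM2r ?mulr_ge0// ler_peMl// ltW//.
Qed.

Lemma measurable_on01 (f : R -> 'cV[R]_n) (g : R -> 'cV[R]_m) j :
  (forall i, measurable_fun (`[0, 1] : set R) (fun x => f x i 0)) ->
  (forall i, measurable_fun (`[0, 1] : set R) (fun x => g x i 0)) ->
  measurable_fun setT (on01 f g j).
Proof.
move=> mf mg.
have -> : on01 f g j = (fun x => component (f x) (g x) j) \_ (`[0, 1]%classic : set R).
  by apply/funext => x; rewrite patchE mem_setE in_itv/=.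
apply/(measurable_restrictT _ _).1 => //.
by case: j => j; [exact: mf|exact: mg].
Qed.

End Norm.

Section ClosedLoop.
Context {R : realType} {n m : nat}.
Local Notation leb := (@lebesgue_measure R).
Local Notation J := ('I_n + 'I_m)%type.
Variables (lam : 'I_n -> R) (mu : 'I_m -> R).
Variables (Spp : 'M[R]_n) (Spm : 'M[R]_(n, m)) (Smp : 'M[R]_(m, n)) (Smm : 'M[R]_m).
Variables (Q0 : 'M[R]_(n, m)) (R1 : 'M[R]_(m, n)).
Variables (K : R -> R -> 'M[R]_(m, n)) (L : R -> R -> 'M[R]_m).
Variables (u0 : R -> 'cV[R]_n) (v0 : R -> 'cV[R]_m).
Variables (u : R -> R -> 'cV[R]_n) (v : R -> R -> 'cV[R]_m) (T : R).

Hypothesis mu_pos : forall i, 0 < mu i.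
Hypothesis lam_pos : forall i, 0 < lam i.
Hypothesis mu_incr : forall i j : 'I_m, (i < j)%N -> mu i < mu j.
Hypothesis hKL : backstepping_kernels lam mu Spp Spm Smp Smm Q0 K L.
Hypothesis init : in_L2 u0 v0.
Hypothesis sol : closed_loop_solution lam mu Spp Spm Smp Smm Q0 R1 K L u0 v0 u v.
Hypothesis T0 : 0 <= T.

(** Measurability is given for [0 <= t] and [0 <= x <= 1] only. The extension by 0 also switches off
    the sources outside [[0, 1]], so that characteristics can be followed on the whole line. *)
Definition state (j : J) (t x : R) : R := if 0 <= t then on01 (u t) (v t) j x else 0.
Local Notation z := state.
Local Notation z0 := (on01 u0 v0).
Local Notation A := (coupling Spp Spm Smp Smm).
Local Notation Gx1 := (fun i j y => kern K L i j 1 y).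
Local Notation src := (source A z).
Local Notation base := (datum lam mu Gx1 Q0 T z z0).
Local Notation zt := (char_value lam mu A Gx1 Q0 T z z0).

Lemma measurable_state j : measurable2 R (z j).
Proof.
pose D : set (R * R) := `[0, +oo[ `*` `[0, 1].
have mD : measurable D by exact: measurableX.
have -> : (fun p : R * R => z j p.1 p.2) = (fun p => component (u p.1 p.2) (v p.1 p.2) j) \_ D.
  apply/funext => p; rewrite patchE /state /on01.
  have -> : (p \in D) = (0 <= p.1) && (0 <= p.2 <= 1).
    apply/idP/idP; rewrite inE /D /= !in_itv/= andbT; first by case=> -> ->.
    by move=> /andP[-> ->].
  by case: (0 <= p.1).
apply/(measurable_restrictT _ _).1 => //.
by case: j => j; [exact: (sol_u_meas sol j)|exact: (sol_v_meas sol j)].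
Qed.

Lemma state_out j t x : ~~ (0 <= x <= 1) -> z j t x = 0.
Proof. by rewrite /state /on01 => /negbTE ->; case: ifP. Qed.

Lemma state_in j t x : 0 <= t -> 0 <= x <= 1 -> z j t x = component (u t x) (v t x) j.
Proof. by rewrite /state /on01 => -> ->. Qed.

Let src_out j t x : ~~ (0 <= x <= 1) -> src j t x = 0.
Proof. by move=> xo; rewrite /source big1// => k _; rewrite state_out ?mulr0. Qed.

Let src_u i t x : 0 <= t -> 0 <= x <= 1 ->
  src (inl i) t x = (Spp *m u t x + Spm *m v t x) i 0.
Proof.
move=> t0 x01; rewrite /source sum_J !mxE.
by congr (_ + _); apply: eq_bigr => k _; rewrite state_in.
Qed.

Let src_v i t x : 0 <= t -> 0 <= x <= 1 ->
  src (inr i) t x = (Smp *m u t x + Smm *m v t x) i 0.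
Proof.
move=> t0 x01; rewrite /source sum_J !mxE.
by congr (_ + _); apply: eq_bigr => k _; rewrite state_in.
Qed.

(** The lower limit [Num.max 0 te] can be replaced by 0, because before [te] the line is outside
    [[0, 1]] and the source vanishes; the inflow at [te] is stored in [datum] under the label of the
    line. *)
Lemma u_charE i t x : 0 <= t <= T -> 0 <= x <= 1 ->
  u_char lam Spp Spm Q0 u0 u v i t x = zt (inl i) t x.
Proof.
move=> /andP[t0 tT] x01; have /andP[x0 x1] := x01; have li := lam_pos i.
rewrite /u_char /char_value /transport /=; set te := t - x / lam i.
have teE : lam i * te = lam i * t - x by rewrite /te; field; rewrite gt_eqF.
have xlt : x - lam i * t <= 1 by rewrite lerBlDr (le_trans x1)// lerDl mulr_ge0// ltW.
have tet : te <= t by rewrite /te gerBl divr_ge0// ltW.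
congr (_ + _).
  have -> : (te <= 0) = (0 <= x - lam i * t) by rewrite -(pmulr_rle0 te li) teE subr_le0 subr_ge0.
  rewrite xlt andbT; case: ifP => y0; first by rewrite /on01 y0 xlt.
  have {}y0 : x - lam i * t < 0 by rewrite ltNge y0.
  have te0 : 0 <= te.
    by rewrite -(pmulr_rge0 te li) teE subr_ge0 -subr_le0 ltW.
  rewrite y0 andbT ifT; last first.
    have := ler_wpM2l (ltW li) tT; rewrite mulNr; lra.
  have -> : - (x - lam i * t) / lam i = te by rewrite opprB -teE mulrC mulKf// gt_eqF.
  rewrite /inflow0 mxE; apply: eq_bigr => p _.
  by rewrite state_in// lexx ler01.
rewrite !Rint_if; apply: eq_Rint => s; rewrite ge_max.
have [s0|s0] := leP 0 s; last by [].
rewrite /=; case: (leP te s) => tes /=.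
  case: ifP => // st; rewrite src_u//.
  have h1 : lam i * te <= lam i * s by rewrite ler_wpM2l// ltW.
  have h2 : 0 <= lam i * (t - s) by rewrite mulr_ge0 ?subr_ge0// ltW.
  by move: h1 h2; rewrite teE mulrBr => h1 h2; apply/andP; split; lra.
case: ifP => // st; rewrite src_out// negb_and -ltNge; apply/orP; left.
have h1 : lam i * s < lam i * te by rewrite ltr_pM2l.
by move: h1; rewrite teE mulrBr; lra.
Qed.

Lemma v_charE i t x : 0 <= t <= T -> 0 <= x <= 1 ->
  v_char mu Smp Smm R1 (feedback R1 K L u v) v0 u v i t x = zt (inr i) t x.
Proof.
move=> /andP[t0 tT] x01; have /andP[x0 x1] := x01; have mi := mu_pos i.
rewrite /v_char /char_value /transport [speed _ _ _]/= mulNr opprK; set te := t - (1 - x) / mu i.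
have teE : mu i * te = mu i * t - (1 - x) by rewrite /te; field; rewrite gt_eqF.
have mt0 : 0 <= mu i * t by rewrite mulr_ge0// ltW.
have tet : te <= t by rewrite /te gerBl divr_ge0 ?subr_ge0// ltW.
congr (_ + _).
  rewrite /datum.
  have -> : (te <= 0) = (x + mu i * t <= 1).
    by rewrite -(pmulr_rle0 te mi) teE subr_le0 lerBrDl.
  rewrite (addr_ge0 x0 mt0) /=; case: ifP => y1; first by rewrite /on01 (addr_ge0 x0 mt0) y1.
  have {}y1 : 1 < x + mu i * t by rewrite ltNge y1.
  have te0 : 0 <= te.
    by rewrite -(pmulr_rge0 te mi) teE subr_ge0 lerBlDl ltW.
  rewrite y1 /= ifT; last by apply: lerD => //; rewrite ler_wpM2l// ltW.
  have -> : (x + mu i * t - 1) / mu i = te by rewrite /te; field; rewrite gt_eqF.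
  (* The first term of the feedback cancels the reflection [R1 u]; the integral that remains is
     [inflow1]. *)
  rewrite /feedback addrA subrr add0r mxE /inflow1 !Rint_if; apply: eq_Rint => y.
  case: ifP => // y01; rewrite sum_J !mxE /kern /in_triangle y01 lexx /=.
  by congr (_ + _); apply: eq_bigr => k _; rewrite state_in.
rewrite !Rint_if; apply: eq_Rint => s; rewrite ge_max.
have -> : x - - mu i * (t - s) = x + mu i * (t - s) by rewrite mulNr opprK.
have [s0|s0] := leP 0 s; last by [].
rewrite /=; case: (leP te s) => tes /=.
  case: ifP => // st; rewrite src_v//.
  have h1 : mu i * te <= mu i * s by rewrite ler_wpM2l// ltW.
  have h2 : 0 <= mu i * (t - s) by rewrite mulr_ge0 ?subr_ge0// ltW.
  by move: h1 h2; rewrite teE mulrBr => h1 h2; apply/andP; split; lra.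
case: ifP => // st; rewrite src_out// negb_and -!ltNge; apply/orP; right.
have h1 : mu i * s < mu i * te by rewrite ltr_pM2l.
by move: h1; rewrite teE mulrBr; lra.
Qed.

Lemma state_zt j t : 0 <= t <= T -> {ae leb, forall x, 0 <= x <= 1 -> z j t x = zt j t x}.
Proof.
move=> tT; have /andP[t0 _] := tT; case: j => i.
  have := sol_u sol i t0; apply: aeS => x hx x01.
  by rewrite state_in//= hx// u_charE.
have := sol_v sol i t0; apply: aeS => x hx x01.
by rewrite state_in//= hx// v_charE.
Qed.

Lemma state_zt0 i : {ae leb, forall t, 0 <= t <= T -> z (inr i) t 0 = zt (inr i) t 0}.
Proof.
have := sol_v_trace sol i (or_introl erefl); apply: aeS => t ht tT; have /andP[t0 _] := tT.
have z01 : 0 <= (0 : R) <= 1 by rewrite lexx ler01.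
by rewrite state_in//= ht// v_charE.
Qed.

Lemma energyE t : 0 <= t -> energy z t = (L2norm (u t) (v t) ^+ 2)%E.
Proof.
move=> t0; rewrite L2norm_sqr; apply: eq_integral => x _.
by congr EFin; apply: eq_bigr => j _; rewrite /state t0.
Qed.

Lemma energy0E : energy0 z0 = (L2norm u0 v0 ^+ 2)%E.
Proof. by rewrite L2norm_sqr. Qed.

Lemma energy_fin : (\int[leb]_(s in `[0%R, T]) energy z s < +oo)%E.
Proof.
have := sol_L2 sol T0; apply: le_lt_trans; rewrite !int_if le_eqVlt; apply/orP; left; apply/eqP.
by apply: eq_integral => s _; case: ifP => // /andP[s0 _]; rewrite energyE.
Qed.

Lemma energy0_fin : (energy0 z0 < +oo)%E.
Proof.
have [_ _ fin] := init; rewrite energy0E expe2 lte_mul_pinfty//.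
  exact: Lnorm_ge0.
by rewrite ge0_fin_numE//; exact: Lnorm_ge0.
Qed.

Let mz0 j : measurable_fun setT (z0 j).
Proof. by have [mu0 mv0 _] := init; exact: measurable_on01. Qed.

Let mG i j : measurable_fun setT (Gx1 i j).
Proof.
by refine (measurableT_comp (measurable_kern hKL i j) (g := fun y : R => (1 : R, y)) _); meas.
Qed.

Section Bounds.
Variables (a g qb : R).
Hypothesis Aa : forall j k, `|A j k| <= a.
Hypothesis Gg : forall i j x, `|Gx1 i j x| <= g.
Hypothesis Qq : forall i j, `|Q0 i j| <= qb.

Lemma L2norm_growth t : 0 <= t <= T ->
  (L2norm (u t) (v t) ^+ 2 <= (growth_const lam mu T a g qb)%:E * L2norm u0 v0 ^+ 2)%E.
Proof.
move=> tT; have /andP[t0 _] := tT; rewrite -energyE// -energy0E.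
exact: (energy_growth mu_pos lam_pos T0 measurable_state mz0 mG Aa Gg Qq
  state_zt state_zt0 state_out energy_fin tT).
Qed.

(** The horizon [T] is itself the time at which the state vanishes; the theorem uses this with
    [T = t] for each [t >= tF]. *)
Lemma extinction (m1 l1 : R) : 0 < m1 -> 0 < l1 ->
  (forall i, m1 <= mu i) -> (forall k, l1 <= lam k) -> m1^-1 + l1^-1 <= T ->
  {ae leb, forall x, 0 <= x <= 1 -> forall j, z j T x = 0}.
Proof.
move=> m1_pos l1_pos m1_le l1_le TF.
have zi := int1_z mu_pos lam_pos T0 measurable_state mz0 mG Aa Gg Qq state_zt state_zt0
  state_out energy_fin energy0_fin.
have basei := int1_datum mu_pos lam_pos T0 measurable_state mz0 mG Aa Gg Qq state_zt0
  energy_fin energy0_fin.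
have srci := int2_source A measurable_state state_out energy_fin.
have zi2 := int2_z measurable_state state_out energy_fin.
have [M M0 omM] := omg_bounded hKL.
have [N N0 HN] := volterra_bound hKL measurable_state.
have b0 := beta0_x mu_pos lam_pos mu_incr hKL measurable_state mz0 state_zt state_zt0 state_out
  zi srci basei zi2 T0 m1_le M0 omM.
have zb := state_bottom_zero mu_pos lam_pos mu_incr hKL measurable_state mz0 state_zt state_zt0 state_out
  zi srci basei zi2 T0 m1_le M0 omM.
have t1_pos : 0 < m1^-1 by rewrite invr_gt0.
have m1t t : m1^-1 <= t -> 1 <= m1 * t by move=> h; rewrite -(mulfV (lt0r_neq0 m1_pos)) ler_pM2l.
have vb t : m1^-1 <= t <= T -> {ae leb, forall x, 0 <= x <= 1 -> forall i,
    (`|z (inr i) t x|%:E <= N%:E * \int[leb]_(y in `[0%R, x]) (abs_sum z t y)%:E)%E}.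
  move=> /andP[t1 tT]; have tT' : 0 <= t <= T by rewrite tT (le_trans _ t1)// ltW.
  have := aeI (ae_neq 0) (aeI (ae_fin (fun i => state_zt (inr i) tT')) (ae_fin (fun i => b0 i t tT'))).
  apply: aeS => x [x_neq0 [zx bx]] x01 i; apply: le_trans (HN i t x).
  (* For [x != 0] one has [1 - x < 1 <= m1 * t] already at the time [1 / m1]. *)
  have c : cone_beta m1 t x.
    rewrite /cone_beta x01 /=; apply: lt_le_trans (m1t _ t1); case/andP: x01 => x0 _.
    by rewrite gtrBl lt_neqAle eq_sym x_neq0.
  rewrite zx//; have := bx i c; rewrite /beta => /eqP; rewrite subr_eq0 => /eqP ->.
  exact: lexx.
have bot : {ae leb, forall t, m1^-1 <= t <= T -> forall i, z (inr i) t 0 = 0}.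
  (* At [x = 0] the strict inequality in [cone_beta] fails at [t = 1 / m1], a single time that is
     discarded. *)
  have := aeI (ae_neq m1^-1) zb; apply: aeS => t [tn zt0] /andP[t1 tT]; apply: zt0.
    by rewrite tT (le_trans _ t1)// ltW.
  rewrite /cone_beta lexx ler01 /= subr0 -(mulfV (lt0r_neq0 m1_pos)) ltr_pM2l// lt_neqAle t1 andbT.
  by rewrite eq_sym.
have a0 : 0 <= `|a| by [].
have Aa' j k : `|A j k| <= `|a| by exact: le_trans (Aa j k) (ler_norm a).
apply: (state_zero l1_le l1_pos t1_pos T0 a0 N0 Aa' measurable_state state_zt state_out zi
  (abs_sum_fin measurable_state zi2) vb bot); first by rewrite T0 lexx.
by rewrite -(mulfV (lt0r_neq0 l1_pos)) ler_pM2l// lerBrDl.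
Qed.

End Bounds.
End ClosedLoop.

Theorem theorem2 (R : realType) (m n : nat) (hm : (0 < m)%N) (hn : (0 < n)%N)
    (mu : 'I_m -> R) (lam : 'I_n -> R)
    (mu_gt0 : 0 < mu (Ordinal hm))
    (mu_incr : forall i j : 'I_m, (i < j)%N -> mu i < mu j)
    (lam_gt0 : 0 < lam (Ordinal hn))
    (lam_ndecr : forall i j : 'I_n, (i <= j)%N -> lam i <= lam j)
    (Spp : 'M[R]_n) (Spm : 'M[R]_(n, m))
    (Smp : 'M[R]_(m, n)) (Smm : 'M[R]_m)
    (Q0 : 'M[R]_(n, m)) (R1 : 'M[R]_(m, n))
    (K : R -> R -> 'M[R]_(m, n)) (L : R -> R -> 'M[R]_m)
    (hKL : backstepping_kernels lam mu Spp Spm Smp Smm Q0 K L) :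
  let tF := 1 / mu (Ordinal hm) + 1 / lam (Ordinal hn) in
  let solution := closed_loop_solution lam mu Spp Spm Smp Smm Q0 R1 K L in
  (forall u0 v0 u v, in_L2 u0 v0 -> solution u0 v0 u v ->
     forall t, tF <= t ->
       {ae @lebesgue_measure R, forall x, 0 <= x <= 1 ->
          u t x = 0 /\ v t x = 0}) /\
  (exists C nu : R, [/\ 0 < C, 0 < nu &
     forall u0 v0 u v, in_L2 u0 v0 -> solution u0 v0 u v ->
       forall t, 0 <= t ->
         (L2norm (u t) (v t) <= (C * expR (- nu * t))%:E * L2norm u0 v0)%E]).
Proof.
move=> tF solution.
have mu_min i : mu (Ordinal hm) <= mu i by apply: (mu_le mu_incr).
have lam_min k : lam (Ordinal hn) <= lam k by exact: lam_ndecr.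
have mu_pos i : 0 < mu i := lt_le_trans mu_gt0 (mu_min i).
have lam_pos k : 0 < lam k := lt_le_trans lam_gt0 (lam_min k).
have tF0 : 0 <= tF by rewrite addr_ge0// divr_ge0// ltW.
have [g g0 Gg] := kernel_bounded hKL.
pose A := coupling Spp Spm Smp Smm.
pose a := \sum_j \sum_k `|A j k|.
have Aa j k : `|A j k| <= a.
  rewrite /a (bigD1 j)//= (bigD1 k)//= -addrA lerDl addr_ge0// sumr_ge0// => j' _.
  exact: sumr_ge0.
pose qb := \sum_i \sum_j `|Q0 i j|.
have Qq i j : `|Q0 i j| <= qb.
  rewrite /qb (bigD1 i)//= (bigD1 j)//= -addrA lerDl addr_ge0// sumr_ge0// => j' _.
  exact: sumr_ge0.
have Gx i j x : `|kern K L i j 1 x| <= g by exact: Gg.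
have ext u0 v0 u v : in_L2 u0 v0 -> solution u0 v0 u v -> forall t, tF <= t ->
    {ae @lebesgue_measure R, forall x, 0 <= x <= 1 -> u t x = 0 /\ v t x = 0}.
  move=> init sol t tFt; have t0 := le_trans tF0 tFt.
  have TF : (mu (Ordinal hm))^-1 + (lam (Ordinal hn))^-1 <= t by move: tFt; rewrite /tF !div1r.
  have := extinction mu_pos lam_pos mu_incr hKL init sol t0 Aa Gx Qq mu_gt0 lam_gt0 mu_min lam_min TF.
  apply: aeS => x hx x01; split; apply/matrixP => i j; rewrite (ord1 j) !mxE.
    by have := hx x01 (inl i); rewrite state_in.
  by have := hx x01 (inr i); rewrite state_in.
split => //.
(* The absolute value and the summand 1 ensure [1 <= k], as [le_sqr_ereal] requires. *)
pose k := `|growth_const lam mu tF a g qb| + 1.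
have k1 : 1 <= k by rewrite lerDr.
have k0 : 0 < k := lt_le_trans ltr01 k1.
(* From [tF] on the norm is 0, so any rate is possible; before [tF] the factor [expR (tF - t)] is at
   least 1 and the growth bound [k] suffices. *)
exists (k * expR tF), 1; split => //; first by rewrite mulr_gt0// expR_gt0.
move=> u0 v0 u v init sol t t0; rewrite mulN1r.
have L0 : (0 <= L2norm u0 v0)%E by exact: Lnorm_ge0.
have Lt : (0 <= L2norm (u t) (v t))%E by exact: Lnorm_ge0.
have [tFt|tFt] := leP tF t.
  suff : (L2norm (u t) (v t) ^+ 2 = 0)%E.
    rewrite expe2 => /eqP; rewrite mule_eq0 orbb => /eqP ->.
    by rewrite mule_ge0// lee_fin mulr_ge0 ?expR_ge0// mulr_ge0 ?expR_ge0// ltW.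
  rewrite L2norm_sqr (ae_eq_integral (cst 0)%E) ?integral0//.
    apply/measurable_EFinP; apply: measurable_sumr => j; apply: measurable_funX.
    have -> : on01 (u t) (v t) j = state u v j t by apply/funext => x; rewrite /state t0.
    by have h := measurable_state sol j; meas.
  have := ext _ _ _ _ init sol _ tFt; apply: aeS => x hx _.
  rewrite /cst big1// => j _; rewrite /on01; case: ifP => [/hx[ux vx]|_]; last by rewrite expr0n.
  by case: j => j; rewrite /component ?ux ?vx mxE expr0n.
have tT : 0 <= t <= tF by rewrite t0 ltW.
apply: (@le_trans _ _ (k%:E * L2norm u0 v0)%E); last first.
  rewrite lee_wpmul2r// lee_fin -mulrA ler_peMr ?(ltW k0)// -expRD.
  by rewrite -[leLHS]expR0 ler_expR subr_ge0 ltW.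
apply: le_sqr_ereal => //.
apply: le_trans (L2norm_growth mu_pos lam_pos hKL init sol tF0 Aa Gx Qq tT) _.
apply: lee_wpmul2r; first by rewrite expe2 mule_ge0.
by rewrite lee_fin (le_trans (ler_norm _))// lerDl.
Qed.
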